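(* Let $\mathbb{K}$ be an infinite field, let $\mathsf{p}$ be a nonzero admissible Hilbert polynomial with Gotzmann partition $(b_1, b_2, \dots, b_r)$, $b_1 \ge b_2 \ge \dots \ge b_r \ge 0$, and let $d := \deg \mathsf{p} = b_1$. Let $n \ge d+2$ be an integer. The Hilbert scheme $\operatorname{Hilb}^{\mathsf{p}}(\mathbb{P}^n_{\mathbb{K}})$ has exactly two Borel-fixed points if and only if one of the following conditions holds: (i)(a) $b_1 = 0$ and $r = 3$; (i)(a') $b_1 = 0$, $r = 4$, $n = 2$, and $\mathbb{K}$ does not have characteristic $2$; (i)(b) $r \ge 2$, $b_1 = \dots = b_{r-1} = 1$ and $b_r = 0$, with $r-1 \notin \{1, 3\}$; (i)(c) $r \ge 2$, $b_1 = \dots = b_{r-1} \ge 2$ and $b_r = 0$, with $r-1 \ne 1$; (ii)(a) $b_1 > b_2 = 0$ and $r = 3$; (ii)(b) $r \ge 3$, $b_1 = \dots = b_{r-2} > b_{r-1} = 1$ and $b_r = 0$, with $r-2 \ne 2$; (ii)(c) $r \ge 3$, $b_1 = \dots = b_{r-2} > b_{r-1} \ge 2$ and $b_r = 0$.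
   Context: Let $S := \mathbb{K}[x_0, x_1, \dots, x_n]$ with its standard $\mathbb{Z}$-grading. For a homogeneous ideal $I \subset S$, the Hilbert polynomial of $I$ means the Hilbert polynomial of the quotient $S/I$, i.e. the polynomial $\mathsf{p}_I(t) \in \mathbb{Q}[t]$ with $\mathsf{p}_I(i) = \dim_{\mathbb{K}} (S/I)_i$ for all $i \gg 0$. A polynomial is an admissible Hilbert polynomial if it is the Hilbert polynomial of a closed subscheme of some projective space. For $a,b \in \mathbb{Z}$ with $b \ge 0$, set $\binom{t+a}{b} := \frac{(t+a)(t+a-1)\cdots(t+a-b+1)}{b!} \in \mathbb{Q}[t]$. By a classical result of Macaulay and Gotzmann, every nonzero admissible Hilbert polynomial $\mathsf{p}$ has a unique expression $\mathsf{p}(t) = \sum_{j=1}^r \binom{t+b_j-j+1}{b_j}$ with integers $b_1 \ge b_2 \ge \dots \ge b_r \ge 0$ and $r \ge 1$; conversely every such sequence gives a nonzero admissible Hilbert polynomial. The sequence $(b_1, \dots, b_r)$ is the Gotzmann partition of $\mathsf{p}$, and $\deg \mathsf{p} = b_1$. $\operatorname{Hilb}^{\mathsf{p}}(\mathbb{P}^n_{\mathbb{K}})$ is the Hilbert scheme parametrizing closed subschemes of $\mathbb{P}^n_{\mathbb{K}}$ with Hilbert polynomial $\mathsf{p}$. An ideal $I \subseteq S$ is Borel-fixed if it is fixed by the action $\gamma \cdot x_j = \sum_{i=0}^n \gamma_{ij} x_i$ of every upper triangular matrix $\gamma = (\gamma_{ij}) \in \operatorname{GL}_{n+1}(\mathbb{K})$.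 A Borel-fixed point of $\operatorname{Hilb}^{\mathsf{p}}(\mathbb{P}^n_{\mathbb{K}})$ is a point whose corresponding saturated homogeneous ideal is Borel-fixed; thus Borel-fixed points correspond bijectively to Borel-fixed ideals $I \subset S$ with Hilbert polynomial $\mathsf{p}$ that are saturated with respect to $\langle x_0, \dots, x_n \rangle$. *)

(* Defs.v *)
From mathcomp Require Import all_boot all_order all_algebra.
From mathcomp Require Export mpoly.

Set Implicit Arguments.
Unset Strict Implicit.
Unset Printing Implicit Defensive.

Import GRing.Theory.
Local Open Scope ring_scope.

Definition infinite_field (K : fieldType) : Prop :=
  forall s : seq K, exists x : K, x \notin s.

Section Ideals.
Variables (K : fieldType) (n : nat).
(* Coordinate ring of P^n: there are n.+1 variables 'X_0, ..., 'X_n. *)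
Local Notation S := {mpoly K[n.+1]}.
Implicit Types I J : S -> Prop.

Definition same_set I J : Prop := forall f, I f <-> J f.

Definition is_ideal I : Prop :=
  [/\ I 0, forall f g, I f -> I g -> I (f + g)
    & forall f g, I g -> I (f * g)].

Definition homogeneous_ideal I : Prop :=
  is_ideal I /\ forall f d, I f -> I (pihomog mdeg d f).

(* I : m^oo = I for m = <'X_0, ..., 'X_n>; the monomials of degree k generate
   m^k, so the premise says that m^k * f is contained in I. *)
Definition saturated I : Prop :=
  forall (f : S) (k : nat),
    (forall m : 'X_{1..n.+1}, mdeg m = k -> I ('X_[m] * f)) -> I f.

(* h = dim_K (S/I)_d: there are h forms of degree d whose classes are a basis
   of (S/I)_d. *)
Definition quotient_dim I (d h : nat) : Prop :=
  exists e : 'I_h -> S,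
    [/\ forall k, e k \is d.-homog,
        forall f : S, f \is d.-homog ->
          exists c : 'I_h -> K, I (f - \sum_(k < h) c k *: e k)
      & forall c : 'I_h -> K,
          I (\sum_(k < h) c k *: e k) -> forall k, c k = 0].

Definition has_hilbert_poly I (p : {poly rat}) : Prop :=
  exists i0 : nat, forall i : nat, (i0 <= i)%N ->
    exists2 h : nat, quotient_dim I i h & p.[i%:R] = h%:R.

Definition upper_triangular (g : 'M[K]_n.+1) : Prop :=
  forall i j : 'I_n.+1, (j < i)%N -> g i j = 0.

(* The K-algebra map given by 'X_j |-> \sum_i g i j *: 'X_i. *)
Definition mx_act (g : 'M[K]_n.+1) (f : S) : S :=
  f \mPo [tuple \sum_(i < n.+1) g i j *: 'X_i | j < n.+1].

Definition borel_fixed I : Prop :=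
  forall g : 'M[K]_n.+1, g \in unitmx -> upper_triangular g ->
    same_set (fun f => exists2 f0, I f0 & f = mx_act g f0) I.

(* Points of Hilb^p(P^n) are represented by their saturated homogeneous
   ideals. *)
Definition borel_fixed_point (p : {poly rat}) I : Prop :=
  [/\ homogeneous_ideal I, saturated I, has_hilbert_poly I p
    & borel_fixed I].

Definition exactly_two_ideals (P : (S -> Prop) -> Prop) : Prop :=
  exists I J, [/\ P I, P J, ~ same_set I J
    & forall L, P L -> same_set L I \/ same_set L J].

End Ideals.

Definition admissible_hilbert_poly (K : fieldType) (p : {poly rat}) : Prop :=
  exists (m : nat) (I : {mpoly K[m.+1]} -> Prop),
    homogeneous_ideal I /\ has_hilbert_poly I p.

(* The polynomial binom(t + a, b), where a may be negative. *)
Definition binom_poly (a : int) (b : nat) : {poly rat} :=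
  (b`!%:R)^-1 *: \prod_(k < b) ('X + ((a - k%:Z)%:~R)%:P).

(* Parts are numbered from 1: [part b j] is b_j for 1 <= j <= size b. *)
Definition part (b : seq nat) (j : nat) : nat := nth 0%N b j.-1.

Definition gotzmann_partition (p : {poly rat}) (b : seq nat) : Prop :=
  [/\ (1 <= size b)%N, sorted geq b
    & p = \sum_(1 <= j < (size b).+1)
            binom_poly ((part b j)%:Z - j%:Z + 1) (part b j)].

(* Main.v *)
Require Import Defs.
From mathcomp Require Import all_boot all_order all_algebra.
From mathcomp Require Import boolp.
From mathcomp Require Import zify.

(** Over an infinite field the torus makes a Borel-fixed ideal monomial. In
    such an ideal one may trade the whole exponent of a variable for the same
    power of an earlier variable, because the extreme binomial coefficients
    are 1 in every characteristic. Applied to the last variable, this shows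
    that saturation means that the last variable can be cancelled. A point is
    thus determined by a set [C] of exponent vectors in the remaining
    variables, those of the monomials outside the ideal: [C] is closed under
    divisors and under the reverse trade ([good]), and the dimension of the
    degree [i] part of the quotient is the number of elements of [C] of degree
    at most [i] ([mono_hilbert]).

    Listing the last remaining variable first, [C] is the cone over its base
    [{m | k :: m in C for all k}] together with a finite set, its rest. The
    base lives in one dimension less, and induction on the dimension proves
    the theorems of Macaulay and Gotzmann for good sets ([gotzmann]): an
    element of the rest of large degree has a divisor of the preceding degree
    in the rest, so the rest has no gaps in large degrees. The Gotzmann
    partition is encoded by the vector [a] whose [i]-th entry counts the parts
    equal to [i]; with this choice the monomials outside the lexicographic
    ideal are simply the vectors that precede [a] lexicographically, and
    removing the first entry of [a] corresponds to passing to the base.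

    A good set of type [e :: a] consists of a base of type [a] and of a rest,
    and [e] is the size of the rest plus the total excess of the Hilbert
    function of the base over the lexicographic one. The excess vanishes only
    for the lexicographic base ([lex_unique]). So if the partition has no part
    0 the lexicographic ideal is the only point. If there is one part 0, then
    either the base is lexicographic and the rest is one minimal generator of
    its ideal that no trade reaches from another element of the ideal, or the
    rest is empty and the excess is 1. When there are at least two positive
    parts, the last generator and the last linear generator are always
    available, and a third one is unless at most one positive part differs
    from the largest part; for such partitions, excess 1 occurs only for [(1,
    1, 1, 0)] and [(d, d, 1, 0)] with [d >= 2] ([excess_le1_lex]). With two or
    more parts 0 it is easy to write down three ideals, except for [(d, 0, 0)]
    and for at most four points ([linear_two_points], [finite3],
    [points4_plane]). In the other direction, all further ideals are given
    explicitly and are strongly stable, hence Borel-fixed ([stable_borel]);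
    the only exception is the ideal of two squares in the plane in
    characteristic 2 ([square_borel]). *)

Set Implicit Arguments.
Unset Strict Implicit.
Unset Printing Implicit Defensive.

Local Open Scope nat_scope.

Implicit Types (B C D : seq nat -> bool) (m a : seq nat).

(** * Exponent vectors *)

Fixpoint raise (j k : nat) (m : seq nat) : seq nat :=
  match m, j with
  | [::], _ => [::]
  | x :: m', 0 => x + k :: m'
  | x :: m', j'.+1 => x :: raise j' k m'
  end.

Lemma size_raise j k m : size (raise j k m) = size m.
Proof. by elim: m j => [|x m IH] [|j] //=; rewrite IH. Qed.

Lemma raise0 j m : raise j 0 m = m.
Proof. by elim: m j => [|x m IH] [|j] //=; rewrite ?addn0 ?IH. Qed.

Lemma raiseD j k l m : raise j k (raise j l m) = raise j (k + l) m.
Proof. by elim: m j => [|x m IH] [|j] //=; rewrite ?IH // addnAC addnA addnAC. Qed.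

Lemma sumn_raise j k m : j < size m -> sumn (raise j k m) = sumn m + k.
Proof. elim: m j => [|x m IH] [|j] //= lt_j; [lia | rewrite IH //; lia]. Qed.

Lemma nth_raise j k m i :
  nth 0 (raise j k m) i = nth 0 m i + (if (i == j) && (i < size m) then k else 0).
Proof.
by elim: m j i => [|x m IH] [|j] [|i] //=; rewrite ?nth_nil ?addn0 ?andbF ?IH.
Qed.

Lemma raise_gt0P m : 0 < sumn m ->
  exists j m0, [/\ j < size m, size m0 = size m & m = raise j 1 m0].
Proof.
elim: m => [|[|x] m IH] //=; rewrite ?add0n => s_gt0.
  have [j [m0 [lt_j sz_m0 em]]] := IH s_gt0.
  by exists j.+1, (0 :: m0); rewrite /= sz_m0 -em.
by exists 0, (x :: m); rewrite /= addn1.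
Qed.

Lemma sumn_zeros k : sumn (nseq k 0) = 0.
Proof. by rewrite sumn_nseq mul0n. Qed.

Lemma sumn0_zeros m : sumn m = 0 -> m = nseq (size m) 0.
Proof. by elim: m => [|x m IH] //= s0; rewrite -IH; [congr (_ :: _)|]; lia. Qed.

Lemma raise_cat_l j k m1 m2 : j < size m1 ->
  raise j k (m1 ++ m2) = raise j k m1 ++ m2.
Proof. by elim: m1 j => [|x m1 IH] [|j] //= lt_j; rewrite IH. Qed.

Lemma raise_cat_r j k m1 m2 :
  raise (size m1 + j) k (m1 ++ m2) = m1 ++ raise j k m2.
Proof. by elim: m1 => [|x m1 IH] //=; rewrite IH. Qed.

(** The last entry is the most significant one; it belongs to the first variable
    of the polynomial ring. *)
Fixpoint lexlt (m a : seq nat) : bool :=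
  match m, a with
  | k :: m', e :: a' => lexlt m' a' || (m' == a') && (k < e)
  | _, _ => false
  end.

Lemma lexlt_irr m : lexlt m m = false.
Proof. by elim: m => [|k m IH] //=; rewrite IH ltnn andbF. Qed.

Lemma lexlt_trans m2 m1 m3 : lexlt m1 m2 -> lexlt m2 m3 -> lexlt m1 m3.
Proof.
elim: m1 m2 m3 => [|k1 m1 IH] [|k2 m2] [|k3 m3] //=.
case/orP => [lt12|/andP[/eqP-> lt12]] /orP[lt23|/andP[/eqP<- lt23]].
- by rewrite (IH m2).
- by rewrite lt12.
- by rewrite lt23.
- by rewrite eqxx (ltn_trans lt12 lt23) orbT.
Qed.

Lemma lexlt_total m a : size m = size a -> [|| lexlt m a, m == a | lexlt a m].
Proof.
elim: m a => [|k m IH] [|e a] //= [/IH].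
case/or3P => [->|/eqP->|->]; rewrite ?orbT //.
by rewrite eqseq_cons eqxx andbT lexlt_irr /=; case: (ltngtP k e).
Qed.

Lemma lexltNge m a : size m = size a -> ~~ lexlt m a -> m = a \/ lexlt a m.
Proof.
move=> sz; case/or3P: (lexlt_total sz) => [-> //|/eqP-> _|-> _]; by [left|right].
Qed.

Lemma lexlt_gt m a : lexlt m a -> ~~ lexlt a m.
Proof. by move=> lt; apply/negP => /(lexlt_trans lt); rewrite lexlt_irr. Qed.

Lemma lexlt_neq m a : lexlt m a -> m != a.
Proof. by apply: contraTneq => ->; rewrite lexlt_irr. Qed.

Lemma lexlt_raise j k m : j < size m -> 0 < k -> lexlt m (raise j k m).
Proof.
elim: m j => [|x m IH] [|j] //= lt_j k_gt0; last by rewrite IH.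
by rewrite eqxx -{1}[x]addn0 ltn_add2l k_gt0 orbT.
Qed.

Lemma lexlt_raise2 i j k l m : i < j -> j < size m -> 0 < k ->
  lexlt (raise i l m) (raise j k m).
Proof.
elim: m i j => [|x m IH] [|i] [|j] //= lt_ij lt_j k_gt0.
  by rewrite lexlt_raise.
by rewrite IH.
Qed.

Lemma lexlt_cat_same lo lo' hi : size lo = size lo' ->
  lexlt (lo ++ hi) (lo' ++ hi) = lexlt lo lo'.
Proof.
elim: lo lo' => [|x lo IH] [|y lo'] //= => [_|[sz]]; first by rewrite lexlt_irr.
by rewrite IH // eqseq_cat // eqxx andbT.
Qed.

Lemma lexlt_cat_hi lo lo' hi hi' : size lo = size lo' ->
  lexlt hi hi' -> lexlt (lo ++ hi) (lo' ++ hi').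
Proof.
by elim: lo lo' => [|x lo IH] [|y lo'] //= [sz] lt_hi; rewrite IH.
Qed.

Lemma lexlt_zeros m k : lexlt m (nseq k 0) = false.
Proof. by elim: m k => [|x m IH] [|k] //=; rewrite IH ltn0 andbF. Qed.

Lemma lexlt_zerosl m : lexlt (nseq (size m) 0) m = (0 < sumn m).
Proof.
elim: m => [|x m IH] //=; rewrite IH.
case: (posnP (sumn m)) => [s0|s_gt0] /=; last by symmetry; lia.
rewrite [X in _ == X](sumn0_zeros s0) eqxx; lia.
Qed.

(** The two vectors are cut at the last position where they differ. *)
Lemma lexlt_split a m : lexlt a m -> size m = size a ->
  exists lo h hi lo' k, [/\ a = lo ++ h :: hi, m = lo' ++ (h + k.+1) :: hi
     & size lo' = size lo].
Proof.
elim: a m => [|e a IH] [|k m] //= /orP[lt [sz]|/andP[/eqP-> lt_ek] _]; last first.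
  by exists [::], e, m, [::], (k - e.+1); split=> //=; congr (_ :: _); lia.
have [lo [h [hi [lo' [k' [-> -> sz']]]]]] := IH _ lt sz.
by exists (e :: lo), h, hi, (k :: lo'), k'; rewrite /= sz'.
Qed.

(** * Counting exponent vectors of bounded degree *)

(** All vectors of length [n] and degree at most [i], each listed once, so that
    counting is a statement about duplicate-free sequences. *)
Fixpoint mons (n i : nat) : seq (seq nat) :=
  if n is n'.+1 then [seq k :: m | k <- iota 0 i.+1, m <- mons n' (i - k)]
  else [:: [::]].

Lemma monsS n i :
  mons n.+1 i = [seq k :: m | k <- iota 0 i.+1, m <- mons n (i - k)].
Proof. by []. Qed.

Lemma mem_mons n i m : (m \in mons n i) = (size m == n) && (sumn m <= i).
Proof.
elim: n i m => [|n IH] i m.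
  by rewrite inE; case: m => //=; rewrite leq0n.
rewrite monsS; apply/allpairsPdep/andP => [[k [m' []]]|[]].
  rewrite mem_iota IH => /andP[_ lt_k] /andP[/eqP sz le_s] -> /=.
  by rewrite sz eqxx; split=> //; lia.
case: m => [|k m] // sz le_s; exists k, m; rewrite mem_iota IH.
by move: sz le_s => /= /eqP[->] le_s; split=> //; lia.
Qed.

Lemma uniq_mons n i : uniq (mons n i).
Proof.
elim: n i => [|n IH] i //.
rewrite monsS; apply: allpairs_uniq_dep; rewrite ?iota_uniq //.
by move=> [k m] [k' m'] _ _ /= [-> ->].
Qed.

Definition hf n (C : seq nat -> bool) i := count C (mons n i).

Lemma count_allpairs_dep (T : Type) (C : T -> bool) (A : Type) (B : A -> Type)
    (f : forall x, B x -> T) (s : seq A) (t : forall x, seq (B x)) :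
  count C [seq f x y | x <- s, y <- t x] =
  \sum_(x <- s) count (fun y => C (f x y)) (t x).
Proof.
elim: s => [|x s IH] /=; first by rewrite big_nil.
by rewrite big_cons count_cat count_map IH.
Qed.

Lemma hfS n C i :
  hf n.+1 C i = \sum_(k < i.+1) hf n (fun m => C (nat_of_ord k :: m)) (i - k).
Proof.
rewrite /hf monsS (count_allpairs_dep C (fun k m => k :: m)).
rewrite -(big_mkord xpredT (fun k => hf n (fun m => C (k :: m)) (i - k))).
by rewrite /index_iota subn0.
Qed.

Lemma eq_hf n C D i : (forall m, size m = n -> C m = D m) -> hf n C i = hf n D i.
Proof. by move=> eqCD; apply: eq_in_count => m; rewrite mem_mons => /andP[/eqP/eqCD]. Qed.

Lemma hf_le n C D i :
  (forall m, size m = n -> sumn m <= i -> C m -> D m) -> hf n C i <= hf n D i.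
Proof.
move=> subCD; rewrite /hf -!size_filter; apply: uniq_leq_size => [|m].
  exact: filter_uniq (uniq_mons _ _).
by rewrite !mem_filter mem_mons => /and3P[Cm /eqP sz le]; rewrite subCD ?sz ?eqxx.
Qed.

Lemma hf_lt n C D i m : (forall m, size m = n -> sumn m <= i -> C m -> D m) ->
  size m = n -> sumn m <= i -> D m -> ~~ C m -> hf n C i < hf n D i.
Proof.
move=> subCD sz le Dm nCm; rewrite /hf -!size_filter.
have : size (m :: filter C (mons n i)) <= size (filter D (mons n i)); last by [].
apply: uniq_leq_size => /= [|m'].
  by rewrite mem_filter (negPf nCm) /= filter_uniq ?uniq_mons.
rewrite inE !mem_filter => /orP[/eqP->|/andP[Cm]].
  by rewrite Dm mem_mons sz eqxx.
by rewrite mem_mons => /andP[/eqP sz' le']; rewrite subCD ?mem_mons ?sz' ?eqxx.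
Qed.

Lemma hf_mono n C i j : i <= j -> hf n C i <= hf n C j.
Proof.
move=> le_ij; rewrite /hf -!size_filter; apply: uniq_leq_size => [|m].
  exact: filter_uniq (uniq_mons _ _).
rewrite !mem_filter !mem_mons => /and3P[-> -> le] /=; exact: leq_trans le le_ij.
Qed.

Lemma hf_grow n C i j m : size m = n -> C m -> i < sumn m <= j ->
  hf n C i < hf n C j.
Proof.
move=> sz Cm /andP[lt_i le_j]; rewrite /hf -!size_filter.
have : size (m :: filter C (mons n i)) <= size (filter C (mons n j)); last by [].
apply: uniq_leq_size => /= [|m'].
  by rewrite mem_filter mem_mons Cm sz eqxx leqNgt lt_i /= filter_uniq ?uniq_mons.
rewrite inE !mem_filter => /orP[/eqP->|/andP[->]].
  by rewrite Cm mem_mons sz eqxx.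
by rewrite !mem_mons => /andP[-> le'] /=; lia.
Qed.

Lemma hf_stat n C i j : i <= j ->
  (forall m, size m = n -> C m -> sumn m <= j -> sumn m <= i) ->
  hf n C j = hf n C i.
Proof.
move=> le_ij noC; apply/eqP; rewrite eqn_leq (hf_mono n C le_ij) andbT.
rewrite /hf -!size_filter; apply: uniq_leq_size => [|m].
  exact: filter_uniq (uniq_mons _ _).
rewrite !mem_filter !mem_mons => /and3P[Cm sz le]; rewrite Cm sz /=.
by apply: noC => //; apply/eqP.
Qed.

Lemma size_le_hf n C i s : uniq s ->
  (forall m, m \in s -> [/\ size m = n, C m & sumn m <= i]) -> size s <= hf n C i.
Proof.
move=> us Cs; rewrite /hf -size_filter; apply: uniq_leq_size => // m /Cs[sz Cm le].
by rewrite mem_filter Cm mem_mons sz eqxx.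
Qed.

Lemma hf_size n C i s : uniq s ->
  (forall m, size m = n -> sumn m <= i -> C m = (m \in s)) ->
  (forall m, m \in s -> size m = n /\ sumn m <= i) -> hf n C i = size s.
Proof.
move=> us eqC szs; rewrite /hf -size_filter.
apply/perm_size/uniq_perm => // [|m]; first by rewrite filter_uniq ?uniq_mons.
rewrite mem_filter mem_mons; case: (boolP (m \in s)) => [ms|nms].
  by have [sz le] := szs _ ms; rewrite sz eqxx le eqC // ms.
case: eqP => [sz|]; last by rewrite andbF.
by case: leqP => [le|]; rewrite ?andbF ?andbT ?eqC ?(negPf nms).
Qed.

Lemma hf_gt0 n C i : 0 < hf n C i -> exists m, [/\ size m = n, C m & sumn m <= i].
Proof.
rewrite -has_count => /hasP[m]; rewrite mem_mons => /andP[/eqP sz le] Cm.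
by exists m.
Qed.

Lemma hf_split n (P C : seq nat -> bool) i :
  (forall m, size m = n -> P m -> C m) ->
  hf n C i = hf n P i + hf n (fun m => C m && ~~ P m) i.
Proof.
move=> subPC; rewrite /hf -(count_predUI P) -[LHS]addn0; congr (_ + _).
  apply: eq_in_count => m; rewrite mem_mons => /andP[/eqP sz _] /=.
  by case: (boolP (P m)) => [/(subPC _ sz)->|_] //=; rewrite andbT.
by apply/esym/eqP; rewrite -leqn0 leqNgt -has_count; apply/hasPn => m _ /=; case: (P m); rewrite ?andbF.
Qed.

(** Slicing by the first entry: the slice [k] of a cone contributes the elements
    of [B] of degree at most [i - k]. *)
Lemma hf_cone n B i :
  hf n.+1 (fun m => B (behead m)) i = \sum_(l < i.+1) hf n B l.
Proof.
rewrite hfS (reindex_inj rev_ord_inj) /=; apply: eq_bigr => k _.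
by congr (hf _ _ _); have := ltn_ord k; lia.
Qed.

Lemma sum_ltn_min c N : \sum_(k < N) (k < c) = minn c N.
Proof. by elim: N => [|N IH]; rewrite ?big_ord0 ?minn0 // big_ord_recr /= IH; lia. Qed.

Lemma hf_pure n e a i : size a = n ->
  hf n.+1 (fun m => if m is k :: m' then (m' == a) && (k < e) else false) i =
  minn e (i.+1 - sumn a).
Proof.
move=> sz_a; rewrite hfS -[RHS](minn_idPl (_ : _ <= i.+1)); last lia.
rewrite -sum_ltn_min; apply: eq_bigr => k _.
case: (ltnP k e) => [lt_ke|le_ek].
  rewrite (@eq_hf _ _ (pred1 a)); last by move=> m _; rewrite andbT.
  rewrite /hf count_uniq_mem ?uniq_mons // mem_mons sz_a eqxx /=.
  by have lt_k := ltn_ord k; congr nat_of_bool; lia.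
rewrite (@eq_hf _ _ pred0); last by move=> m _; rewrite andbF.
by rewrite /hf count_pred0; have := ltn_ord k; case: ltnP => //; lia.
Qed.

(** The Hilbert function of the lexicographic ideal of type [a]: the monomials
    outside it are the vectors that precede [a]. *)
Local Notation HL a := (hf (size a) (lexlt^~ a)).

Lemma HL_cons e a i :
  HL (e :: a) i = \sum_(l < i.+1) HL a l + minn e (i.+1 - sumn a).
Proof.
rewrite /= (@hf_split _ (fun m => lexlt (behead m) a)); last first.
  by move=> [|k m] //= _ ->.
rewrite (hf_cone _ (lexlt^~ a)); congr (_ + _); rewrite -(@hf_pure (size a)) //.
apply: eq_hf => -[|k m] //= _; case: eqP => [->|_] /=.
  by rewrite lexlt_irr andbT.
by rewrite orbF andbN.
Qed.

Lemma HL_zeros k i : HL (nseq k 0) i = 0.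
Proof.
rewrite (@eq_hf _ _ pred0) ?size_nseq => [|m _]; last by rewrite lexlt_zeros.
by rewrite /hf count_pred0.
Qed.

(** * Order ideals and their bases *)

Definition order_ideal n C :=
  forall m j, size m = n -> j < n -> C (raise j 1 m) -> C m.

(** Going up, from [raise i k m] to [raise j k m], the entry [i] is moved as a
    whole to a later position, that is, to an earlier variable; monomials that
    are outside the ideal afterwards were outside it before. *)
Definition swept n C := forall m i j k,
  size m = n -> i < j -> j < n -> nth 0 m i = 0 ->
  C (raise j k m) -> C (raise i k m).

Definition good n C := order_ideal n C /\ swept n C.

Definition base C m := `[< forall k, C (k :: m) >].

Definition rest C m := C m && ~~ base C (behead m).

Definition divides m1 m2 := forall j, nth 0 m1 j <= nth 0 m2 j.

Lemma ideal_raise n C m j k : order_ideal n C -> size m = n ->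
  C (raise j k m) -> C m.
Proof.
move=> idC sz; case: (ltnP j n) => [lt_j|le_j].
  elim: k => [|k IH]; first by rewrite raise0.
  by rewrite -add1n -raiseD => /idC; rewrite size_raise => /(_ sz lt_j)/IH.
suff -> : raise j k m = m by [].
elim: m j n sz le_j {idC} => [|x m IH] [|j] [|n] //= [sz] le_j.
by rewrite (IH _ n).
Qed.

Lemma ideal_slice n C k : order_ideal n.+1 C -> order_ideal n (fun m => C (k :: m)).
Proof. by move=> idC m j sz lt_j; apply: (idC (k :: m) j.+1); rewrite //= sz. Qed.

Lemma ideal_head n C k k' m : order_ideal n.+1 C -> size m = n -> k' <= k ->
  C (k :: m) -> C (k' :: m).
Proof.
move=> idC sz le_k; rewrite -{1}(subnKC le_k) => Ck.
by apply: (@ideal_raise _ _ _ 0 (k - k') idC); rewrite /= ?sz.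
Qed.

Lemma ideal_divides n C m1 m2 : order_ideal n C -> size m1 = n -> size m2 = n ->
  divides m1 m2 -> C m2 -> C m1.
Proof.
elim: n C m1 m2 => [|n IH] C [|k1 m1] [|k2 m2] //= idC [sz1] [sz2] le12 Cm2.
apply: (IH (fun m => C (k1 :: m)) m1 m2) => //; first exact: ideal_slice.
  by move=> j; apply: (le12 j.+1).
by apply: ideal_head idC sz2 (le12 0) Cm2.
Qed.

Lemma base_ideal n C : order_ideal n.+1 C -> order_ideal n (base C).
Proof.
move=> idC m j sz lt_j /asboolP Cm; apply/asboolP => k.
by apply: (ideal_slice idC) (Cm k).
Qed.

Lemma base_good n C : good n.+1 C -> good n (base C).
Proof.
case=> idC swC; split; first exact: base_ideal.
move=> m i j k sz lt_ij lt_j m_i /asboolP Cm; apply/asboolP => l.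
by apply: (swC (l :: m) i.+1 j.+1 k _ _ _ _ (Cm l)); rewrite /= ?sz.
Qed.

Lemma base_sub C m : base C m -> forall k, C (k :: m).
Proof. by move/asboolP. Qed.

(** Dickson's lemma.  The complement of the base is generated by finitely many
    vectors, which all leave [C] at some common height [K] of the first entry;
    above [K] the slices no longer change, and the slices up to [K] are
    finitely generated by induction. *)
Lemma dickson n C : order_ideal n C ->
  exists G : seq (seq nat), (forall g, g \in G -> size g = n /\ ~~ C g) /\
    (forall m, size m = n -> ~~ C m -> exists2 g, g \in G & divides g m).
Proof.
elim: n C => [|n IH] C idC.
  case: (boolP (C [::])) => [C0|nC0].
    by exists [::]; split=> // m /size0nil ->; rewrite C0.
  exists [:: [::]]; split=> [g|m _ _]; first by rewrite inE => /eqP->.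
  by exists [::]; rewrite ?inE // => -[].
have [G [GP Gdiv]] := IH _ (base_ideal idC).
have [K KP] : exists K, forall g, g \in G -> ~~ C (K :: g).
  have : forall g, g \in G -> size g = n /\ ~~ base C g by [].
  elim: (G) => [|g s IHs] gP; first by exists 0.
  have [|K KP] := IHs; first by move=> h hs; apply: gP; rewrite inE hs orbT.
  have [sz_g /asboolPn/existsNP[K' /negP nCK']] := gP g (mem_head _ _).
  exists (maxn K K') => h; rewrite inE => /orP[/eqP->|hs].
    by apply: contra nCK'; apply: (ideal_head idC); rewrite ?leq_maxr.
  have [sz_h _] := gP h (mem_behead (s := g :: s) hs).
  by apply: contra (KP h hs); apply: (ideal_head idC); rewrite ?leq_maxl.
have [G' [GP' Gdiv']] : exists G' : seq (seq nat),
    (forall g, g \in G' -> size g = n.+1 /\ ~~ C g) /\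
    (forall k m, k <= K -> size m = n -> ~~ C (k :: m) ->
      exists2 g, g \in G' & divides g (k :: m)).
  elim: K {KP} => [|K [G1 [G1P G1div]]]; last first.
    have [G2 [G2P G2div]] := IH _ (ideal_slice (k := K.+1) idC).
    exists (map (cons K.+1) G2 ++ G1); split=> [g|k m].
      rewrite mem_cat => /orP[/mapP[h /G2P[sz_h nCh] ->]|/G1P//].
      by rewrite /= sz_h.
    rewrite leq_eqVlt => /orP[/eqP->|lt_k] sz_m nCm.
      have [g gG2 le_g] := G2div _ sz_m nCm.
      exists (K.+1 :: g); first by rewrite mem_cat map_f.
      by case=> [|j] //=; apply: le_g.
    have [g gG1 le_g] := G1div _ _ lt_k sz_m nCm.
    by exists g; rewrite // mem_cat gG1 orbT.
  have [G2 [G2P G2div]] := IH _ (ideal_slice (k := 0) idC).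
  exists (map (cons 0) G2); split=> [g|k m].
    by move=> /mapP[h /G2P[sz_h nCh] ->]; rewrite /= sz_h.
  rewrite leqn0 => /eqP-> sz_m nCm; have [g gG2 le_g] := G2div _ sz_m nCm.
  exists (0 :: g); first by rewrite map_f.
  by case=> [|j] //=; apply: le_g.
exists G'; split=> // -[|k m] //= [sz_m] nCkm.
have [le_kK|lt_Kk] := leqP k K; first exact: Gdiv'.
have nBm : ~~ base C m by apply: contra nCkm => /base_sub.
have [g gG le_g] := Gdiv _ sz_m nBm.
have nCK : ~~ C (K :: m).
  apply: contra (KP g gG); apply: ideal_divides idC _ _ _; rewrite /= ?sz_m //.
    by have [-> _] := GP g gG.
  by case.
have [h hG' le_h] := Gdiv' K m (leqnn K) sz_m nCK.
exists h => // -[|j] /=; last exact: (le_h j.+1).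
exact: leq_trans (le_h 0) (ltnW lt_Kk).
Qed.

Lemma base_stable n C : order_ideal n.+1 C ->
  exists K, forall m, size m = n -> C (K :: m) = base C m.
Proof.
move=> idC; have [G [GP Gdiv]] := dickson idC.
exists (\max_(g <- G) head 0 g) => m sz_m; apply/idP/idP => [CK|/base_sub//].
apply/asboolP => k; apply/negPn/negP => nCk.
have [|g gG le_g] := Gdiv _ _ nCk; first by rewrite /= sz_m.
have [sz_g /negP[]] := GP g gG; apply: ideal_divides idC _ _ _ CK; rewrite /= ?sz_m //.
case=> [|j] /=; last exact: (le_g j.+1).
by rewrite nth0; apply: (@leq_bigmax_seq _ _ _ (fun g => head 0 g)).
Qed.

Lemma sumn_bound m N : (forall j, j < size m -> nth 0 m j <= N) ->
  sumn m <= size m * N.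
Proof.
elim: m => [|x m IH] //= le_N.
by rewrite mulSn leq_add ?(le_N 0) // IH // => j; apply: (le_N j.+1).
Qed.

Lemma nth_le_sumn m j : nth 0 m j <= sumn m.
Proof.
elim: m j => [|x m IH] [|j] //=; first by rewrite leq_addr.
by rewrite (leq_trans (IH j)) ?leq_addl.
Qed.

(** Sweeping is what makes the rest finite.  A vector outside the base is divisible
    by one of finitely many generators [g], and [K :: g] is outside [C] for a
    fixed [K].  Sweeping the entry [K] to position [j] bounds the entry [j] of
    the elements of the rest that are divisible by [g]. *)
Lemma rest_finite n C : good n.+1 C ->
  exists N, forall m, size m = n.+1 -> rest C m -> sumn m <= N.
Proof.
move=> [idC swC]; have [K KP] := base_stable idC.
have [G [GP Gdiv]] := dickson (base_ideal idC).
pose M := \max_(g <- G) sumn g.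
exists (K + n * (M + K)) => -[|k m] //= [sz_m] /andP[Ckm /= nBm].
have [g gG le_g] := Gdiv _ sz_m nBm; have [sz_g nBg] := GP g gG.
apply: leq_add; first rewrite leqNgt.
  apply: contra nBm => lt_Kk; rewrite -KP //.
  by apply: (ideal_head idC) Ckm => //; apply: ltnW.
rewrite -{1}sz_m; apply: sumn_bound => j lt_j.
have le_gM : nth 0 g j <= M.
  by rewrite (leq_trans (nth_le_sumn _ _)) // /M; apply: (@leq_bigmax_seq _ _ _ sumn).
apply: leq_trans (_ : nth 0 g j + K <= _); last by rewrite leq_add2r.
rewrite leqNgt; apply: contra nBg => lt_m; rewrite -KP //.
apply: (swC (0 :: g) 0 j.+1 K); rewrite //= ?sz_g -?sz_m //.
have C0m : C (0 :: m) by apply: (ideal_head idC) Ckm.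
apply: ideal_divides idC _ _ _ C0m; rewrite /= ?size_raise ?sz_g ?sz_m //.
case=> [|i] //=; rewrite nth_raise.
by case: eqP => [->|_] /=; [rewrite sz_g -sz_m lt_j ltnW | rewrite addn0].
Qed.

Lemma hf_base n C i : hf n.+1 C i =
  \sum_(l < i.+1) hf n (base C) l + hf n.+1 (rest C) i.
Proof.
rewrite -hf_cone; apply: (@hf_split n.+1 (fun m => base C (behead m))) => -[|k m] //= _ /base_sub; apply.
Qed.

(** * Macaulay and Gotzmann bounds *)

(** Macaulay's lower bound, Gotzmann's equality from degree [sumn a - 1] on, and the
    bound [sumn a] for the degrees of the minimal generators of the ideal.
    The last clause is what makes the induction work. *)
Definition macaulay n C a := [/\ size a = n,
  forall i, HL a i <= hf n C i,
  forall i, sumn a <= i.+1 -> hf n C i = HL a i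
  & forall m, size m = n -> sumn a < sumn m -> ~~ C m ->
      exists j m0, [/\ j < n, size m0 = n, m = raise j 1 m0 & ~~ C m0]].

(** [a] encodes the Hilbert polynomial of [C]. *)
Definition evtype n C a :=
  size a = n /\ exists i0, forall i, i0 <= i -> hf n C i = HL a i.

Lemma macaulay_evtype n C a : macaulay n C a -> evtype n C a.
Proof.
by case=> sz _ eqh _; split=> //; exists (sumn a) => i le; apply/eqh/ltnW.
Qed.

(** Sets of vectors that precede a given one are nested, so two different types
    have different numbers of elements in all large degrees. *)
Lemma evtype_uniq n C a a' : evtype n C a -> evtype n C a' -> a = a'.
Proof.
move=> [sz [i0 eqh]] [sz' [i0' eqh']].
suff nlt b b' j0 : size b = n -> size b' = n ->
    (forall i, j0 <= i -> HL b i = HL b' i) -> ~~ lexlt b b'.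
  have eqHL i : maxn i0 i0' <= i -> HL a i = HL a' i.
    by rewrite geq_max => /andP[/eqh<- /eqh'<-].
  case/or3P: (lexlt_total (etrans sz (esym sz'))) => [|/eqP//|].
    by rewrite (negPf (nlt _ _ _ sz sz' eqHL)).
  have eqHL' i le_i := esym (eqHL i le_i).
  by rewrite (negPf (nlt _ _ _ sz' sz eqHL')).
move=> szb szb' eqHL; apply/negP => lt.
have le := leq_maxl j0 (sumn b).
have := eqHL _ le; rewrite szb szb'; apply/eqP; rewrite ltn_eqF //.
apply: (@hf_lt _ _ _ _ b) => //; rewrite ?leq_maxr ?lexlt_irr //.
by move=> m _ _ /lexlt_trans; apply.
Qed.

Definition excess n B a i := \sum_(l < i.+1) (hf n B l - HL a l).

(** The number [phi i] measures how far [C] exceeds, up to degree [i], the cone over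
    the lexicographic set of the type of its base. *)
Section Step.
Variables (n : nat) (C : seq nat -> bool) (a : seq nat).
Hypotheses (goodC : good n.+1 C) (macB : macaulay n (base C) a).
Let s := sumn a.
Let phi i := excess n (base C) a i + hf n.+1 (rest C) i.

Lemma hf_phi i : hf n.+1 C i = \sum_(l < i.+1) HL a l + phi i.
Proof.
case: macB => sz le_h eq_h _.
rewrite hf_base addnA; congr (_ + _); rewrite -big_split /=.
by apply: eq_bigr => l _; rewrite subnKC.
Qed.

Lemma excess_mono i j : i <= j -> excess n (base C) a i <= excess n (base C) a j.
Proof.
move=> le_ij; rewrite /excess -(subnKC le_ij) -addSn.
by rewrite big_split_ord /= leq_addr.
Qed.

Lemma excess_stable i : s <= i -> excess n (base C) a i = excess n (base C) a i.-1.
Proof.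
case: macB => sz le_h eq_h _; case: i => [|i] // le_s.
by rewrite /excess big_ord_recr /= eq_h ?subnn ?addn0 // ltnW.
Qed.

Lemma phi_mono i j : i <= j -> phi i <= phi j.
Proof. by move=> le_ij; rewrite leq_add ?excess_mono ?hf_mono. Qed.

(** Either the first entry can be lowered, or it is 0 and the other entries are
    divisible by an element outside the base of smaller degree, because the
    generators outside the base have degree at most [s]. *)
Lemma rest_pred m : size m = n.+1 -> rest C m -> s < sumn m ->
  exists m0, [/\ size m0 = n.+1, rest C m0 & sumn m = (sumn m0).+1].
Proof.
case: macB goodC => sz _ _ gen [idC _].
case: m => [|[|k] m] //= [sz_m] /andP[Cm /= nBm] lt_s; last first.
  exists (k :: m); rewrite /= sz_m /rest /= nBm andbT; split=> //.
  by apply: (ideal_head idC) Cm.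
have [j [m0 [lt_j sz0 em nB0]]] := gen _ sz_m lt_s nBm.
exists (0 :: m0); rewrite /= sz0 /rest /= nB0 andbT; split=> //; last first.
  by rewrite em sumn_raise ?sz0 // !add0n addn1.
by apply: (idC (0 :: m0) j.+1); rewrite /= -?em ?sz0.
Qed.

Lemma rest_gap i : s <= i ->
  (forall m, size m = n.+1 -> rest C m -> sumn m != i) ->
  forall m, size m = n.+1 -> rest C m -> sumn m < i.
Proof.
move=> le_s noi m; move: {2}(sumn m) (leqnn (sumn m)) => d.
elim: d m => [|d IH] m le_d sz_m Rm.
  by have := noi m sz_m Rm; move: le_d; lia.
case: (ltngtP (sumn m) i) => [//|gt_i|eq_i]; last first.
  by have := noi m sz_m Rm; rewrite eq_i eqxx.
have [m0 [sz0 R0 e0]] := rest_pred sz_m Rm (leq_ltn_trans le_s gt_i).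
have := IH m0 _ sz0 R0; lia.
Qed.

(** Since the rest has no gaps from degree [s] on, [phi] increases in each of these
    degrees until it reaches its final value [e]. *)
Lemma rest_total : exists e, [/\ forall i, phi i <= e,
  forall i, minn e (i.+1 - s) <= phi i & exists i, phi i = e].
Proof.
have [N NP] := rest_finite goodC.
have phiN i : maxn N s <= i -> phi i = phi (maxn N s).
  elim: i => [|i IH]; first by rewrite leqn0 => /eqP->.
  rewrite leq_eqVlt => /orP[/eqP->//|le_i]; rewrite -(IH le_i) /phi.
  rewrite excess_stable /=; last by rewrite -ltnS; move: le_i; lia.
  congr (_ + _); apply: hf_stat => // m sz Rm _.
  by have := NP m sz Rm; move: le_i; lia.
exists (phi (maxn N s)).
have le_e i : phi i <= phi (maxn N s).
  case: (leqP (maxn N s) i) => [/phiN->//|lt_i]; exact: phi_mono (ltnW lt_i).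
split=> //; last by exists (maxn N s).
suff P k i : i.+1 = s + k -> minn (phi (maxn N s)) k <= phi i.
  move=> i; case: (leqP s i.+1) => [le_s|lt_s].
    by apply: P; rewrite subnKC.
  by rewrite (eqP (ltnW lt_s : i.+1 - s == 0)) minn0.
elim: k i => [|k IH] i ei; first by rewrite minn0.
have le_si : s <= i by lia.
case: (EM (exists m, [/\ size m = n.+1, rest C m & sumn m = i])) => [[m [sz Rm em]]|no].
  case: i ei le_si em => [|i] ei le_si em.
    have -> : k = 0 by lia.
    suff: 0 < phi 0 by lia.
    rewrite /phi ltn_addl // (leq_trans _ (@size_le_hf _ _ _ [:: m] _ _)) //.
    by move=> m'; rewrite inE => /eqP->; rewrite em.
  have lt_phi : phi i < phi i.+1.
    rewrite /phi -addnS leq_add ?excess_mono //.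
    by apply: (@hf_grow _ _ _ _ m); rewrite ?em // leqnn.
  by have := IH i; lia.
have gap := rest_gap le_si (fun m sz Rm => introN eqP (fun em => no (ex_intro _ m (And3 sz Rm em)))).
suff -> : phi i = phi (maxn N s) by lia.
case: (leqP (maxn N s) i) => [/phiN//|lt_i].
symmetry; rewrite /phi; congr (_ + _); last first.
  by apply: hf_stat (ltnW lt_i) _ => m sz Rm _; apply/ltnW/gap.
elim: (maxn N s) lt_i => [|j IHj] //.
rewrite ltnS leq_eqVlt => /orP[/eqP<-|lt_ij].
  by rewrite excess_stable // ltnW.
by rewrite excess_stable /= ?IHj //; lia.
Qed.

Lemma macaulay_step e : (forall i, phi i <= e) ->
  (forall i, minn e (i.+1 - s) <= phi i) -> macaulay n.+1 C (e :: a).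
Proof.
move=> le_e ge_e; have [sz le_h eq_h gen] := macB.
have phi_e i : s + e <= i.+1 -> phi i = e by move: (le_e i) (ge_e i); lia.
split=> [|i|i le_i|m sz_m lt_m nCm]; first by rewrite /= sz.
- by rewrite HL_cons hf_phi leq_add2l.
- rewrite HL_cons hf_phi phi_e; last by move: le_i; rewrite /= -/s; lia.
  by congr (_ + _); move: le_i; rewrite /= -/s; lia.
have noR m' : size m' = n.+1 -> s + e <= sumn m' -> ~~ rest C m'.
  move=> sz' le'; apply/negP => Rm'.
  case d_m' : (sumn m') => [|d].
    have := le_e 0; have -> : e = 0 by lia.
    rewrite leqn0 addn_eq0 => /andP[_ /eqP h0].
    suff: size [:: m'] <= hf n.+1 (rest C) 0 by rewrite h0.
    by apply: size_le_hf => // x; rewrite inE => /eqP->; rewrite d_m'.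
  have: phi d < phi d.+1.
    rewrite /phi -addnS leq_add ?excess_mono //.
    by apply: (@hf_grow _ _ _ _ m'); rewrite ?d_m' // leqnn.
  by rewrite !phi_e ?ltnn //; lia.
case: m sz_m lt_m nCm => [|k m] //= [sz_m] lt_m nCm.
have nBm : ~~ base C m by apply: contra nCm => /base_sub.
case: k lt_m nCm => [|k] lt_m nCm.
  have [|j [m0 [lt_j sz0 em nB0]]] := gen m sz_m _ nBm; first by lia.
  exists j.+1, (0 :: m0); rewrite /= sz0 em ltnS; split=> //.
  have := noR (0 :: m0); rewrite /rest /= nB0 andbT; apply; first by rewrite sz0.
  by move: lt_m; rewrite em sumn_raise ?sz0 //; lia.
exists 0, (k :: m); rewrite /= sz_m addn1; split=> //.
have := noR (k :: m); rewrite /rest /= nBm andbT; apply; first by rewrite sz_m.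
by move: lt_m; lia.
Qed.

End Step.

(** The theorems of Macaulay and Gotzmann, for all sets that arise from proper
    Borel-fixed ideals. *)
Theorem gotzmann n C m1 : good n C -> size m1 = n -> ~~ C m1 ->
  exists a, macaulay n C a.
Proof.
elim: n C m1 => [|n IH] C m1 goodC sz1 nC1.
  have C0 i : hf 0 C i = 0 by move: nC1; rewrite (size0nil sz1) /hf /= => /negPf->.
  exists [::]; split=> // m /size0nil -> //.
case: m1 sz1 nC1 => [|k m1] //= [sz1] nC1.
have [|a macB] := IH (base C) m1 (base_good goodC) sz1.
  by apply: contra nC1 => /base_sub.
have [e [le_e ge_e _]] := rest_total goodC macB.
by exists (e :: a); apply: macaulay_step.
Qed.

Lemma evtype_proper n C a : evtype n C a -> exists2 m, size m = n & ~~ C m.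
Proof.
move=> [sz [i0 eqh]]; apply: contrapT => noC.
have allC m : size m = n -> C m.
  by move=> szm; apply/negPn/negP => nC; apply: noC; exists m.
have := eqh (maxn i0 (sumn a)) (leq_maxl _ _); apply/eqP; rewrite sz gtn_eqF //.
by apply: (@hf_lt _ _ _ _ a); rewrite ?leq_maxr ?lexlt_irr ?allC // => m /allC.
Qed.

Lemma good_macaulay n C a : good n C -> evtype n C a -> macaulay n C a.
Proof.
move=> goodC evC; have [m1 sz1 nC1] := evtype_proper evC.
have [a' macC] := gotzmann goodC sz1 nC1.
by rewrite (evtype_uniq evC (macaulay_evtype macC)).
Qed.

Lemma base_type n C e a : good n.+1 C -> evtype n.+1 C (e :: a) ->
  macaulay n (base C) a /\
  [/\ forall i, excess n (base C) a i + hf n.+1 (rest C) i <= e,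
      forall i, minn e (i.+1 - sumn a) <=
                excess n (base C) a i + hf n.+1 (rest C) i
    & exists i, excess n (base C) a i + hf n.+1 (rest C) i = e].
Proof.
move=> goodC evC; have [m1 sz1 nC1] := evtype_proper evC.
case: m1 sz1 nC1 => [|k m1] //= [sz1] nC1.
have [|a' macB] := gotzmann (base_good goodC) sz1.
  by apply: contra nC1 => /base_sub.
have [e' [le_e ge_e ex_e]] := rest_total goodC macB.
have macC := macaulay_step macB le_e ge_e.
by have [-> ->] := evtype_uniq evC (macaulay_evtype macC).
Qed.

(** * Uniqueness of the lexicographic ideal *)

Lemma good_slice n C k : good n.+1 C -> good n (fun m => C (k :: m)).
Proof.
move=> [idC swC]; split; first exact: ideal_slice.
move=> m i j l sz lt_ij lt_j m_i Cm.
by apply: (swC (k :: m) i.+1 j.+1 l); rewrite /= ?sz.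
Qed.

Lemma base_or_rest n C m : size m = n.+1 -> C m = base C (behead m) || rest C m.
Proof.
case: m => [|k m] //= _; rewrite /rest /=.
case: (boolP (base C m)) => [/base_sub->//|_]; by rewrite andbT.
Qed.

Lemma hf_rec n C d : hf n C d =
  (if d is d'.+1 then hf n C d' else 0) +
  hf n (fun m => C m && (sumn m == d)) d.
Proof.
rewrite (@hf_split n (fun m => C m && (sumn m < d)) C d); last by move=> m _ /andP[].
congr (_ + _).
  case: d => [|d].
    rewrite (@eq_hf _ _ pred0); last by move=> m _; rewrite ltn0 andbF.
    by rewrite /hf count_pred0.
  rewrite (@hf_stat _ _ d); [|by []|by move=> m _ /andP[_]].
  apply: eq_in_count => m; rewrite mem_mons => /andP[_ le].
  by rewrite ltnS le andbT.
apply: eq_in_count => m; rewrite mem_mons => /andP[_ le].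
by case: (C m) => //=; rewrite -leqNgt eqn_leq le.
Qed.

Lemma hf_const_size n C e s : (forall i, hf n C i <= e) -> uniq s ->
  (forall m, m \in s -> size m = n /\ C m) -> size s <= e.
Proof.
move=> le_e us Cs; apply: leq_trans (le_e (\max_(m <- s) sumn m)).
apply: size_le_hf => // m ms; have [sz Cm] := Cs m ms; split=> //.
exact: (@leq_bigmax_seq _ _ _ sumn).
Qed.

(** The second alternative describes the minimal generators of the lexicographic
    ideal of type [a] other than [a] itself: they increase one entry [h] of [a]
    and have only zeros below. *)
Lemma mingen a m : lexlt a m -> size m = size a ->
  (exists j m0, [/\ j < size a, size m0 = size a, m = raise j 1 m0 & ~~ lexlt m0 a])
  \/ exists lo h hi, [/\ a = lo ++ h :: hi, m = nseq (size lo) 0 ++ h.+1 :: hi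
       & 0 < sumn lo].
Proof.
move=> lt_am sz; have [lo [h [hi [lo' [k [ea em sz']]]]]] := lexlt_split lt_am sz.
have gt_hi l x : size l = size lo -> ~~ lexlt (l ++ (h + x.+1) :: hi) a.
  move=> szl; rewrite ea lexlt_gt // lexlt_cat_hi //= eqxx orbC; lia.
have sz_a : size a = size lo + (size hi).+1 by rewrite ea size_cat.
case: (posnP (sumn lo')) => [/sumn0_zeros z'|/raise_gt0P[j [l0 [lt_j sz0 e0]]]]; last first.
  left; exists j, (l0 ++ (h + k.+1) :: hi); rewrite em e0 raise_cat_l ?sz0 //.
  rewrite gt_hi ?sz0 ?sz' // size_cat sz0 sz' sz_a; split=> //; move: lt_j; rewrite sz'; lia.
case: k em gt_hi => [|k] em gt_hi; last first.
  left; exists (size lo), (lo' ++ (h + k.+1) :: hi); rewrite gt_hi // em sz_a; split=> //.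
  - lia.
  - by rewrite size_cat sz'.
  - by rewrite -sz' -[size lo']addn0 raise_cat_r /= -addnA addn1.
case: (posnP (sumn lo)) => [/sumn0_zeros z|lo_gt0]; last first.
  by right; exists lo, h, hi; rewrite em z' sz' addn1.
left; exists (size lo), a; rewrite lexlt_irr sz_a; split=> //; first by lia.
by rewrite em z' sz' ea -z -[X in raise X]addn0 raise_cat_r.
Qed.

Lemma nth_zeros n i : nth 0 (nseq n 0) i = 0.
Proof. by rewrite nth_nseq if_same. Qed.

(** If the entries of [a] below [h] are a single 1, then sweeping it to the position
    of [h] turns [a] into a minimal generator of the same degree. *)
Lemma swept_gen n C lo h hi : swept n C -> size (lo ++ h :: hi) = n -> sumn lo = 1 ->
  C (nseq (size lo) 0 ++ h.+1 :: hi) -> C (lo ++ h :: hi).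
Proof.
move=> swC sz s1; have [|j [l0 [lt_j sz0 e0]]] := @raise_gt0P lo; first by rewrite s1.
have z0 : l0 = nseq (size lo) 0.
  rewrite -sz0; apply: sumn0_zeros; move: s1; rewrite e0 sumn_raise ?sz0 //; lia.
have -> : lo ++ h :: hi = raise j 1 (nseq (size lo) 0 ++ h :: hi).
  by rewrite raise_cat_l ?size_nseq // -z0 -e0.
have -> : nseq (size lo) 0 ++ h.+1 :: hi =
          raise (size lo) 1 (nseq (size lo) 0 ++ h :: hi).
  by rewrite -[X in raise X](size_nseq (size lo) 0) -[X in raise X]addn0 raise_cat_r /= addn1.
apply: swC => //; first by rewrite -sz !size_cat size_nseq.
  by rewrite -sz size_cat /=; lia.
by rewrite nth_cat size_nseq lt_j nth_zeros.
Qed.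

Section Rest.
Variables (n : nat) (C : seq nat -> bool) (a : seq nat).
Hypotheses (goodC : good n.+1 C) (sz_a : size a = n).
Hypothesis baseC : forall m, size m = n -> base C m = lexlt m a.

Lemma rest_sub k m : size m = n -> C (k :: m) -> ~~ lexlt m a -> rest C (k :: m).
Proof. by move=> sz Ckm ltm; rewrite /rest Ckm /= baseC. Qed.

Lemma rest_lower k m : size m = n -> rest C (k.+1 :: m) -> rest C (k :: m).
Proof.
move=> sz /andP[Ckm nB]; rewrite /rest /= nB andbT.
by apply: (ideal_head (proj1 goodC)) Ckm.
Qed.

Lemma rest_gen k m : size m = n -> rest C (k :: m) ->
  [\/ m = a,
      exists j m0, [/\ j < n, size m0 = n, m = raise j 1 m0 & rest C (k :: m0)]
    | exists lo h hi, [/\ a = lo ++ h :: hi, m = nseq (size lo) 0 ++ h.+1 :: hi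
         & 0 < sumn lo]].
Proof.
move=> sz /andP[Ckm]; rewrite /= baseC // => nlt.
have [->|lt_am] := lexltNge (etrans sz (esym sz_a)) nlt; first by constructor 1.
have [|[j [m0 [lt_j sz0 em nlt0]]]|] := mingen lt_am.
- by rewrite sz.
- constructor 2; exists j, m0; rewrite -sz_a sz0; split=> //.
  apply: rest_sub => //; first by rewrite sz0.
  by apply: (ideal_raise (proj1 (good_slice k goodC))) (_ : C (k :: raise j 1 m0));
     rewrite ?sz0 -?em.
by constructor 3.
Qed.

Lemma rest_gen_swept lo h hi : a = lo ++ h :: hi -> sumn lo = 1 ->
  C (0 :: (nseq (size lo) 0 ++ h.+1 :: hi)) -> rest C (0 :: a).
Proof.
move=> ea s1 Cgen; apply: rest_sub; rewrite ?lexlt_irr // ea.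
by apply: (swept_gen (proj2 (good_slice 0 goodC))); rewrite -?ea.
Qed.

Lemma rest_shift j : j < n -> C (0 :: raise j 1 a) -> rest C (1 :: a).
Proof.
move=> lt_j Cj; apply: rest_sub; rewrite ?lexlt_irr //.
by apply: (proj2 goodC (0 :: a) 0 j.+1 1); rewrite /= ?sz_a.
Qed.

End Rest.

Lemma excess0 n B a l : macaulay n B a ->
  excess n B a l = 0 -> hf n B l = HL a l.
Proof.
case=> _ le_h _ _ /eqP; rewrite /excess big_ord_recr /= addn_eq0 => /andP[_].
by rewrite subn_eq0 => le; apply/eqP; rewrite eqn_leq le le_h.
Qed.

(** Equality of the Hilbert functions forces the base to be lexicographic and leaves
    exactly one element of the rest in each of the degrees from [sumn a] to
    [sumn a + e - 1].  The first of them is [0 :: a], because any other minimal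
    generator of that degree is obtained from it by sweeping.  Each later one is
    a multiple of the preceding one, and again sweeping rules out all multiples
    but [i :: a]. *)
Lemma lex_unique n C a : good n C -> macaulay n C a ->
  (forall i, hf n C i = HL a i) -> forall m, size m = n -> C m = lexlt m a.
Proof.
elim: n C a => [|n IH] C a goodC macC eqh m sz_m.
  have a0 : a = [::] by case: macC => /size0nil.
  have := eqh 0; rewrite (size0nil sz_m) a0 /hf /= => /eqP.
  by case: (C [::]).
have [sz_a _ _ _] := macC.
case: a sz_a macC eqh => [|e a] //= [sz_a] macC eqh.
have [macB [le_e ge_e _]] := base_type goodC (macaulay_evtype macC).
have tot i : excess n (base C) a i + hf n.+1 (rest C) i = minn e (i.+1 - sumn a).
  by apply: (@addnI (\sum_(l < i.+1) HL a l)); rewrite -HL_cons /= -eqh (hf_phi macB).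
have eqB i : hf n (base C) i = HL a i.
  case: (leqP (sumn a) i.+1) => [le|lt]; first by case: macB => _ _ ->.
  apply: (excess0 macB); have := tot i; lia.
have baseC := IH _ _ (base_good goodC) macB eqB.
have restC i : hf n.+1 (rest C) i = minn e (i.+1 - sumn a).
  rewrite -tot /excess big1 // => l _; by rewrite eqB subnn.
pose lvl d := hf n.+1 (fun m => rest C m && (sumn m == d)) d.
have lvlE d : lvl d = (sumn a <= d) && (d < sumn a + e).
  have := hf_rec n.+1 (rest C) d; rewrite -/(lvl d).
  case: d => [|d]; rewrite !restC; lia.
have lvl_mem k m' : size m' = n -> rest C (k :: m') ->
    sumn a <= k + sumn m' < sumn a + e.
  move=> sz' Rm; suff: 0 < lvl (k + sumn m') by rewrite lvlE lt0b.
  apply: (@size_le_hf _ _ _ [:: k :: m']) => // x; rewrite inE => /eqP->.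
  by rewrite /= sz' Rm /= ?eqxx.
have lvl_uniq k m' l m2 : size m' = n -> size m2 = n -> rest C (k :: m') ->
    rest C (l :: m2) -> k + sumn m' = l + sumn m2 -> k :: m' = l :: m2.
  move=> sz' sz2 R1 R2 eqd; apply/eqP/negPn/negP => neq.
  suff: 2 <= lvl (k + sumn m') by rewrite lvlE leqNgt ltnS leq_b1.
  apply: (@size_le_hf _ _ _ [:: k :: m'; l :: m2]).
    by rewrite /= inE neq.
  move=> x; rewrite !inE => /orP[]/eqP->; by rewrite /= ?sz' ?sz2 ?R1 ?R2 ?eqd /= ?eqxx.
have lvl_form i : forall k m', size m' = n -> rest C (k :: m') ->
    k + sumn m' = sumn a + i -> k = i /\ m' = a.
  elim: i => [|i IHi] [|k] m' sz' Rm deg; last first.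
  - by have [|-> ->] := IHi k m' sz' (rest_lower goodC sz' Rm); first lia.
  - case: (rest_gen goodC sz_a baseC sz' Rm) => [em|[j [m0 [lt_j sz0 em R0]]]|].
    + by move: deg; rewrite em; lia.
    + have [|i0 e0] := IHi 0 m0 sz0 R0.
        by move: deg; rewrite em sumn_raise ?sz0 //; lia.
      have C1 : C (0 :: raise j 1 a) by rewrite -e0 -em; case/andP: Rm.
      have R1 := rest_shift goodC sz_a baseC lt_j C1.
      have [] // : 0 :: m' = 1 :: a.
      apply: lvl_uniq => //; rewrite em e0 sumn_raise ?sz_a //; lia.
    + move=> [lo [h [hi [ea em lo_gt0]]]]; move: deg.
      by rewrite em ea !sumn_cat sumn_zeros /=; lia.
  - by have := lvl_mem _ _ sz' (rest_lower goodC sz' Rm); lia.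
  case: (rest_gen goodC sz_a baseC sz' Rm) => [->//|[j [m0 [lt_j sz0 em R0]]]|].
    have := lvl_mem _ _ sz0 R0; move: deg; rewrite em sumn_raise ?sz0 //; lia.
  move=> [lo [h [hi [ea em lo_gt0]]]].
  have s1 : sumn lo = 1.
    by move: deg; rewrite em ea !sumn_cat sumn_zeros /=; lia.
  have Cg : C (0 :: (nseq (size lo) 0 ++ h.+1 :: hi)) by rewrite -em; case/andP: Rm.
  have R1 := rest_gen_swept goodC sz_a baseC ea s1 Cg.
  have [] // : 0 :: m' = 0 :: a by apply: lvl_uniq => //; lia.
case: m sz_m => [|k m] //= [sz_m].
rewrite (@base_or_rest n) /= ?sz_m // baseC //.
case: (boolP (lexlt m a)) => //= nlt.
apply/idP/andP => [Rm|[/eqP-> lt_k]].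
  have := lvl_mem _ _ sz_m Rm => /andP[le_d lt_d].
  have [|_ em] := lvl_form (k + sumn m - sumn a) _ _ sz_m Rm; first by lia.
  by rewrite em eqxx; split=> //; move: lt_d; rewrite em; lia.
have : 0 < lvl (sumn a + k) by rewrite lvlE; lia.
move=> /hf_gt0[[|k' m'] []] //= [sz'] /andP[Rm /eqP deg] _.
by have [<- <-] := lvl_form k _ _ sz' Rm deg.
Qed.

Lemma excess0_lex n B a : good n B -> macaulay n B a ->
  (forall i, excess n B a i = 0) -> forall m, size m = n -> B m = lexlt m a.
Proof.
by move=> goodB macB ex0; apply: lex_unique => // i; apply: (excess0 macB).
Qed.

Lemma lex_excess0 n B a i : size a = n ->
  (forall m, size m = n -> B m = lexlt m a) -> excess n B a i = 0.
Proof.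
move=> sz eqB; rewrite /excess big1 // => l _.
by rewrite sz (eq_hf _ eqB) subnn.
Qed.

Lemma type0_lex n C a : good n.+1 C -> evtype n.+1 C (0 :: a) ->
  forall m, size m = n.+1 -> C m = lexlt m (0 :: a).
Proof.
move=> goodC evC; have [macB [le_e _ _]] := base_type goodC evC.
apply: lex_unique (good_macaulay goodC evC) _ => // i.
by rewrite HL_cons (hf_phi macB) min0n; have := le_e i; lia.
Qed.

(** * Ideals with at most one alternative to the lexicographic one *)

Definition unit n t := raise t 1 (nseq n 0).

Lemma size_unit n t : size (unit n t) = n.
Proof. by rewrite size_raise size_nseq. Qed.

Lemma sumn_unit n t : t < n -> sumn (unit n t) = 1.
Proof. by move=> lt_t; rewrite sumn_raise ?size_nseq ?sumn_zeros. Qed.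

Lemma nth_unit n t i : nth 0 (unit n t) i = (i == t) && (i < n).
Proof. by rewrite nth_raise size_nseq nth_zeros add0n; case: (_ && _). Qed.

Lemma unit_inj n t1 t2 : t1 < n -> unit n t1 = unit n t2 -> t1 = t2.
Proof.
move=> lt_t /(congr1 (fun m => nth 0 m t1)); rewrite !nth_unit eqxx lt_t andbT /=.
by case: eqP.
Qed.

Lemma unit_cat t z : nseq t 0 ++ 1 :: nseq z 0 = unit (t + z.+1) t.
Proof.
rewrite /unit nseqD -[t in raise t](size_nseq t 0) -[X in raise X]addn0.
by rewrite raise_cat_r.
Qed.

Lemma unit_divides m t : 0 < nth 0 m t -> divides (unit (size m) t) m.
Proof.
move=> m_t i; rewrite nth_unit; case: eqP => [->|] //=.
exact: leq_trans (leq_b1 _) m_t.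
Qed.

Lemma ideal_unit n C m t : order_ideal n C -> size m = n -> 0 < nth 0 m t ->
  C m -> C (unit n t).
Proof.
move=> idC sz m_t; apply: (ideal_divides idC _ sz); first by rewrite size_unit.
by rewrite -sz; apply: unit_divides.
Qed.

Lemma swept_unit n C i j : swept n C -> i <= j -> j < n ->
  C (unit n j) -> C (unit n i).
Proof.
rewrite leq_eqVlt => swC /orP[/eqP->//|lt_ij] lt_j.
by apply: swC => //; rewrite ?size_nseq ?nth_zeros.
Qed.

(** In the ideal of the lexicographic cone of type [0 :: a] the multiples [k :: a]
    with [k < e2] and [k :: u] with [k < e1] are removed. *)
Definition two_rows a u e1 e2 (m : seq nat) : bool :=
  if m is k :: m' then
    [|| lexlt m' a, (m' == a) && (k < e2) | (m' == u) && (k < e1)]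
  else false.

(** ** Finite length *)

Lemma points_hf n C e : evtype n.+1 C (e :: nseq n 0) ->
  (forall i, hf n.+1 C i <= e) /\ exists i, hf n.+1 C i = e.
Proof.
case=> _ [i0 eqh].
have eqe i : maxn i0 e <= i -> hf n.+1 C i = e.
  rewrite geq_max => /andP[/eqh -> le_e].
  rewrite HL_cons big1 ?sumn_zeros => [|l _]; last by rewrite HL_zeros.
  by rewrite subn0 add0n; apply/minn_idPl/leqW.
split=> [i|]; last by exists (maxn i0 e); apply: eqe.
by rewrite -(eqe (maxn i (maxn i0 e))) ?hf_mono ?leq_maxl ?leq_maxr.
Qed.

(** If only the first variable is outside the ideal, then only its powers are. *)
Lemma points_lex n C e : good n.+1 C -> evtype n.+1 C (e :: nseq n 0) ->
  (0 < n -> ~~ C (0 :: unit n 0)) ->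
  forall m, size m = n.+1 -> C m = lexlt m (e :: nseq n 0).
Proof.
move=> goodC evC nC1; have [le_e [i0 ei0]] := points_hf evC.
have col k m : size m = n -> C (k :: m) -> m = nseq n 0.
  move=> sz Ckm; suff s0 : sumn m = 0 by rewrite (sumn0_zeros s0) sz.
  apply/eqP; apply: contraT; rewrite -lt0n => /raise_gt0P[j [m0 [lt_j sz0 em]]].
  have n_gt0 : 0 < n by rewrite -sz (leq_ltn_trans (leq0n j) lt_j).
  case/negP: (nC1 n_gt0).
  have C0m : C (0 :: m) by apply: ideal_head (proj1 goodC) sz _ Ckm.
  have Cu : C (0 :: unit n j).
    apply: (ideal_unit (proj1 (good_slice 0 goodC)) sz _ C0m).
    by rewrite em nth_raise eqxx sz0 lt_j addn1.
  apply: (swept_unit (proj2 (good_slice 0 goodC)) _ _ Cu) => //.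
  by rewrite -sz.
case=> [|k m] //= [sz]; rewrite lexlt_zeros /=.
apply/idP/andP => [Ckm|[/eqP-> lt_k]].
  have em := col _ _ sz Ckm; split; first by rewrite em.
  have := @hf_const_size _ _ e [seq x :: m | x <- iota 0 k.+1] le_e.
  rewrite size_map size_iota; apply.
    by rewrite map_inj_uniq ?iota_uniq // => x y [].
  move=> m' /mapP[x]; rewrite mem_iota => /andP[_ le_x] ->; rewrite /= sz.
  by split=> //; apply: ideal_head (proj1 goodC) sz _ Ckm.
apply: contraT => nCk; suff: e <= k by rewrite leqNgt lt_k.
rewrite -ei0; apply: leq_trans (geq_minl k (i0.+1 - sumn (nseq n 0))).
rewrite -(@hf_pure n) ?size_nseq //; apply: hf_le => -[|x m'] //= [sz'] _ Cx.
have em := col _ _ sz' Cx; rewrite em eqxx ltnNge; apply: contra nCk => le_k.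
by apply: ideal_head (proj1 goodC) _ le_k _; rewrite ?size_nseq // -em.
Qed.

Section Points.
Variables (n e : nat) (C : seq nat -> bool).
Hypotheses (n_gt0 : 0 < n) (goodC : good n.+1 C).
Hypothesis evC : evtype n.+1 C (e :: nseq n 0).

Lemma points_three : C (0 :: unit n 0) ->
  forall m, m \in [:: nseq n.+1 0; 1 :: nseq n 0; 0 :: unit n 0] ->
    size m = n.+1 /\ C m.
Proof.
move=> C01; have [idC swC] := goodC.
have C10 : C (1 :: nseq n 0).
  by apply: (swC (0 :: nseq n 0) 0 1 1); rewrite /= ?size_nseq.
have C0 : C (0 :: nseq n 0) by apply: (ideal_head idC) C10; rewrite ?size_nseq.
by move=> m; rewrite !inE => /or3P[]/eqP->; split; rewrite /= ?size_unit ?size_nseq.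
Qed.

Lemma points_uniq : uniq [:: nseq n.+1 0; 1 :: nseq n 0; 0 :: unit n 0].
Proof. by case: n n_gt0 => // n' _; rewrite /= !inE !eqseq_cons /= !andbF. Qed.

Lemma points_small_lex : e <= 2 ->
  forall m, size m = n.+1 -> C m = lexlt m (e :: nseq n 0).
Proof.
move=> le2; apply: points_lex => // _; apply/negP => /points_three C3.
have [le_e _] := points_hf evC.
by have := leq_trans (hf_const_size le_e points_uniq C3) le2.
Qed.

Lemma points3_two_rows : e = 3 ->
  (forall m, size m = n.+1 -> C m = lexlt m (e :: nseq n 0)) \/
  (forall m, size m = n.+1 -> C m = two_rows (nseq n 0) (unit n 0) 1 2 m).
Proof.
move=> e3; have [le_e _] := points_hf evC.
case: (boolP (C (0 :: unit n 0))) => [C1|nC1]; last by left; apply: points_lex.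
right=> m sz; have C3 := points_three C1.
transitivity (m \in [:: nseq n.+1 0; 1 :: nseq n 0; 0 :: unit n 0]); last first.
  case: m sz => [|k m] //= [sz]; rewrite !inE !eqseq_cons lexlt_zeros.
  by case: k => [|[|k]] //=; rewrite ?andbT ?andbF ?orbF.
apply/idP/idP => [Cm|/C3[]//]; apply: contraT => nm.
have := @hf_const_size _ _ e [:: m, nseq n.+1 0, 1 :: nseq n 0 & [:: 0 :: unit n 0]] le_e.
rewrite e3 /=; apply; first by rewrite nm; apply: points_uniq.
by move=> m'; rewrite inE => /orP[/eqP->|/C3].
Qed.

End Points.

(** The hypothesis on [C] fails only in characteristic 2, where sweeping does not
    exclude the ideal of two squares. *)
Lemma points4_plane C : good 2 C -> evtype 2 C [:: 4; 0] ->
  (C [:: 1; 1] -> C [:: 2; 0]) ->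
  (forall m, size m = 2 -> C m = lexlt m [:: 4; 0]) \/
  (forall m, size m = 2 -> C m = two_rows [:: 0] [:: 1] 1 3 m).
Proof.
move=> goodC evC Cchar; have [le_e [i0 ei0]] := points_hf (n := 1) evC.
have [idC swC] := goodC.
case: (boolP (C [:: 0; 1])) => [C01|nC01]; last by left; apply: (points_lex goodC evC).
have C3 := points_three (n := 1) isT goodC C01.
have C20 : C [:: 2; 0].
  apply: contraT => nC20.
  suff: hf 2 C i0 <= size [:: [:: 0; 0]; [:: 1; 0]; [:: 0; 1]] by rewrite ei0.
  rewrite /hf -size_filter; apply: uniq_leq_size => [|m].
    by rewrite filter_uniq ?uniq_mons.
  rewrite mem_filter mem_mons => /and3P[Cm /eqP sz _].
  case: m sz Cm => [|x [|y []]] //= _ Cxy; rewrite !inE !eqseq_cons !eqxx !andbT.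
  case: y Cxy => [|[|y]] Cxy /=; rewrite ?andbT ?andbF ?orbF.
  - case: x Cxy => [|[|x]] // Cx; case/negP: nC20.
    exact: (@ideal_head 1 C x.+2 2 [:: 0]).
  - case: x Cxy => [|x] // Cx; case/negP: nC20; apply: Cchar.
    exact: (@ideal_head 1 C x.+1 1 [:: 1]).
  - have C0y : C [:: 0; y.+2] by apply: (@ideal_head 1 C x 0 [:: y.+2]).
    have C02 : C [:: 0; 2] by apply: (@ideal_raise 2 C [:: 0; 2] 1 y).
    case/negP: nC20; exact: (swC [:: 0; 0] 0 1 2).
right=> m sz; pose s4 := [:: [:: 2; 0]; [:: 0; 0]; [:: 1; 0]; [:: 0; 1]].
have C4 m' : m' \in s4 -> size m' = 2 /\ C m'.
  by rewrite inE => /orP[/eqP->|/C3].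
transitivity (m \in s4); last first.
  case: m sz => [|x [|y []]] //= _; rewrite !inE !eqseq_cons !eqxx !andbT.
  by case: x => [|[|[|x]]]; case: y => [|[|y]].
apply/idP/idP => [Cm|/C4[]//]; apply: contraT => nm.
have := @hf_const_size _ _ 4 (m :: s4) le_e; rewrite /= nm; apply => //.
by move=> m'; rewrite inE => /orP[/eqP->|/C4].
Qed.

(** ** One or two points on a lexicographic cone *)

(** The entries of [a] below its last nonzero entry [w], at position [q], have sum at
    most 1, that is, at most one positive part differs from the largest one. *)
Section OneExtra.
Variables (n z w e : nat) (lo : seq nat) (C : seq nat -> bool).
Let a := lo ++ w :: nseq z.+1 0.
Let q := size lo.
Hypotheses (sz_a : size a = n) (w_gt0 : 0 < w) (lo_le1 : sumn lo <= 1).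
Hypotheses (goodC : good n.+1 C) (evC : evtype n.+1 C (e :: a)).
Hypothesis baseC : forall m, size m = n -> base C m = lexlt m a.

Lemma n_eq : n = q + z.+2.
Proof. by rewrite -sz_a size_cat /= size_nseq. Qed.

Lemma rest_le i : hf n.+1 (rest C) i <= e.
Proof.
have [_ [le_e _ _]] := base_type goodC evC.
exact: leq_trans (leq_addl _ _) (le_e i).
Qed.

Lemma rest_reached : exists i, hf n.+1 (rest C) i = e.
Proof.
have [_ [_ _ [i ei]]] := base_type goodC evC.
by exists i; rewrite -ei (lex_excess0 _ sz_a baseC).
Qed.

Lemma lt_lex_gen lo' h hi :
  lexlt (lo' ++ h :: hi) (nseq (size lo') 0 ++ h.+1 :: hi).
Proof. by apply: lexlt_cat_hi; rewrite ?size_nseq //= eqxx ltnSn orbT. Qed.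

Lemma a_rcons : a = rcons lo w ++ 0 :: nseq z 0.
Proof. by rewrite cat_rcons. Qed.

Lemma unit_q : unit n q.+1 = nseq (size (rcons lo w)) 0 ++ 1 :: nseq z 0.
Proof. by rewrite unit_cat size_rcons n_eq addSnnS. Qed.

Lemma lt_lex_unit : lexlt a (unit n q.+1).
Proof. by rewrite unit_q a_rcons lt_lex_gen. Qed.

Lemma rest_unit : C (0 :: unit n q.+1) -> rest C (0 :: unit n q.+1).
Proof.
move=> C0u; apply: (rest_sub baseC) => //; first by rewrite size_unit.
exact: lexlt_gt lt_lex_unit.
Qed.

(** Of the generators other than [a], those up to position [q] have the degree of
    [a] and are excluded by sweeping; the others are variables, and sweeping
    leads from each of them to the last one, at position [q + 1]. *)
Lemma gen_shape lo' h hi : a = lo' ++ h :: hi -> 0 < sumn lo' ->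
  C (0 :: (nseq (size lo') 0 ++ h.+1 :: hi)) ->
  sumn lo' <= sumn lo /\ rest C (0 :: a) \/
  [/\ q < size lo', size lo' < n,
      nseq (size lo') 0 ++ h.+1 :: hi = unit n (size lo')
    & rest C (0 :: unit n q.+1)].
Proof.
move=> ea lo_gt0 Cgen; case: (leqP (size lo') q) => [le_q|lt_q].
  suff le_lo : sumn lo' <= sumn lo.
    left; split=> //; apply: (rest_gen_swept goodC sz_a baseC ea _ Cgen); lia.
  have <- : take (size lo') lo = lo'.
    rewrite -(takel_cat (w :: nseq z.+1 0) le_q).
    by rewrite -/a ea take_size_cat.
  by rewrite -{2}(cat_take_drop (size lo') lo) sumn_cat leq_addr.
right; have sz_lo' : size lo' < n by rewrite -sz_a ea size_cat /=; lia.
have ehi : h :: hi = nseq (n - size lo') 0.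
  have := congr1 (drop (size lo')) ea; rewrite drop_size_cat // => <-.
  rewrite /a -cat_rcons drop_cat size_rcons ltnS leqNgt lt_q /= -/q -[0 :: nseq z 0]/(nseq z.+1 0).
  rewrite drop_nseq n_eq; congr nseq; lia.
have eu : nseq (size lo') 0 ++ h.+1 :: hi = unit n (size lo').
  have en : n - size lo' = (n - (size lo').+1).+1 by lia.
  by move: ehi; rewrite en => -[-> ->]; rewrite unit_cat; congr unit; lia.
split=> //; apply/rest_unit/(swept_unit (proj2 (good_slice 0 goodC)) lt_q) => //.
by rewrite -eu.
Qed.

Lemma rest_cases k m : size m = n -> rest C (k :: m) ->
  rest C (0 :: a) \/ 2 <= sumn lo + w /\ rest C (0 :: unit n q.+1).
Proof.
move=> sz /andP[Ckm]; rewrite /= baseC // => nlt.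
have C0m : C (0 :: m) by apply: (ideal_head (proj1 goodC)) Ckm.
have ideal0 := proj1 (good_slice 0 goodC).
have rest0a : C (0 :: a) -> rest C (0 :: a).
  by move=> C0a; apply: (rest_sub baseC); rewrite ?lexlt_irr.
have [em|lt_am] := lexltNge (etrans sz (esym sz_a)) nlt.
  by left; apply: rest0a; rewrite -em.
have [lo' [h [hi [lo2 [k' [ea em sz2]]]]]] := lexlt_split lt_am (etrans sz (esym sz_a)).
have Cgen : C (0 :: (nseq (size lo') 0 ++ h.+1 :: hi)).
  apply: (ideal_divides ideal0 _ sz _ C0m); first by rewrite size_cat size_nseq -sz_a ea size_cat.
  move=> i; rewrite em !nth_cat size_nseq sz2; case: ltnP => _; first by rewrite nth_zeros.
  by case: (i - size lo') => [|j] /=; rewrite // addnS ltnS leq_addr.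
case: (posnP (sumn lo')) => [/sumn0_zeros z0|lo_gt0].
  left; apply/rest0a/(ideal_divides ideal0 sz_a _ _ Cgen).
    by rewrite size_cat size_nseq -sz_a ea size_cat.
  move=> i; rewrite ea {1}z0 !nth_cat size_nseq; case: ltnP => // _.
  by case: (i - size lo') => [|j] /=.
case: (gen_shape ea lo_gt0 Cgen) => [[_]|[lt_q lt_n _ Ru]]; first by left.
case: (leqP 2 (sumn lo + w)) => [le2|lt2]; [by right | left].
apply: (rest_gen_swept goodC sz_a baseC a_rcons); first by rewrite sumn_rcons; lia.
by rewrite -unit_q; case/andP: Ru.
Qed.

Lemma two_rest m1 m2 : e <= 1 -> size m1 = n.+1 -> size m2 = n.+1 ->
  rest C m1 -> rest C m2 -> m1 = m2.
Proof.
move=> le_e1 sz1 sz2 R1 R2; apply/eqP; apply: contraT => neq.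
have := @hf_const_size n.+1 _ e [:: m1; m2] rest_le.
rewrite /= inE neq => /(_ isT) le; suff: 2 <= e by lia.
by apply: le => m; rewrite !inE => /orP[]/eqP->.
Qed.

Lemma three_rest m1 m2 m3 : e <= 2 -> size m1 = n.+1 -> size m2 = n.+1 ->
  size m3 = n.+1 -> rest C m1 -> rest C m2 -> rest C m3 ->
  m1 != m2 -> m3 = m1 \/ m3 = m2.
Proof.
move=> le_e2 sz1 sz2 sz3 R1 R2 R3 neq.
case: (eqVneq m3 m1) => [|n31]; first by left.
case: (eqVneq m3 m2) => [|n32]; first by right.
have := @hf_const_size n.+1 _ e [:: m3; m1; m2] rest_le.
rewrite /= !inE negb_or n31 n32 neq => /(_ isT) le; suff: 3 <= e by lia.
by apply: le => m; rewrite !inE => /or3P[]/eqP->.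
Qed.

Lemma one_extra_point : e = 1 ->
  (forall m, size m = n.+1 -> C m = lexlt m (e :: a)) \/
  2 <= sumn lo + w /\
  (forall m, size m = n.+1 -> C m = two_rows a (unit n q.+1) 1 0 m).
Proof.
move=> e1; have [i] := rest_reached; rewrite {1}e1 => hi.
have [|[|k m] [//= [sz] Rkm _]] := @hf_gt0 n.+1 (rest C) i; first by rewrite hi.
have le1 : e <= 1 by rewrite e1.
have szu := size_unit n q.+1.
case: (rest_cases sz Rkm) => [R0|[le2 R0]]; [left|right; split=> //] => -[|k' m'] //= [sz'].
  rewrite (@base_or_rest n) /= ?sz' // baseC // e1 ltnS leqn0; congr (_ || _).
  apply/idP/andP => [R'|[/eqP-> /eqP->]] //.
  by have [-> ->] := @two_rest (k' :: m') (0 :: a) le1 (congr1 S sz') (congr1 S sz_a) R' R0.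
rewrite (@base_or_rest n) /= ?sz' // baseC // ltn0 andbF /= ltnS leqn0; congr (_ || _).
apply/idP/andP => [R'|[/eqP-> /eqP->]] //.
by have [-> ->] := @two_rest (k' :: m') (0 :: unit n q.+1) le1 (congr1 S sz') (congr1 S szu) R' R0.
Qed.

Lemma two_extra_points : e = 2 -> sumn lo + w = 1 ->
  (forall m, size m = n.+1 -> C m = lexlt m (e :: a)) \/
  (forall m, size m = n.+1 -> C m = two_rows a (unit n q.+1) 1 1 m).
Proof.
move=> e2 s1; have [i] := rest_reached; rewrite {1}e2 => hi.
have ltau := lt_lex_unit; have szu := size_unit n q.+1.
have R0a : rest C (0 :: a).
  have [|[|k m] [//= [sz] Rkm _]] := @hf_gt0 n.+1 (rest C) i; first by rewrite hi.
  by case: (rest_cases sz Rkm) => // -[]; rewrite s1.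
have le2 : e <= 2 by rewrite e2.
have sz0a : size (0 :: a) = n.+1 by rewrite /= sz_a.
have [k [m [sz Rm ne]]] : exists k m, [/\ size m = n, rest C (k :: m) & 0 :: a != k :: m].
  apply: contrapT => no; suff: hf n.+1 (rest C) i <= 1 by rewrite hi.
  apply: leq_trans (_ : hf n.+1 (pred1 (0 :: a)) i <= 1); last first.
    by rewrite /hf count_uniq_mem ?uniq_mons // leq_b1.
  apply: hf_le => -[|k m] // [sz] _ Rm; rewrite inE eq_sym; apply/negPn/negP => ne.
  by apply: no; exists k, m.
have three k' m' : size m' = n -> rest C (k' :: m') -> k' :: m' = 0 :: a \/ k' :: m' = k :: m.
  by move=> sz' R'; apply: three_rest; rewrite //= ?sz ?sz'.
have form : k :: m = 1 :: a \/ k :: m = 0 :: unit n q.+1.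
  case: k Rm ne three => [|k] Rm ne three; last first.
    case: (three k m sz (rest_lower goodC sz Rm)) => [[-> ->]|[]]; first by left.
    by move/n_Sn.
  right; case: (rest_gen goodC sz_a baseC sz Rm) => [em|[j [m0 [lt_j sz0 em R0]]]|].
  - by move: ne; rewrite em eqxx.
  - case: (three 0 m0 sz0 R0) => [[e0]|[e0]]; last first.
      have := sumn_raise 1 (_ : j < size m0); rewrite -em e0 sz => /(_ lt_j).
      by rewrite addn1 => /n_Sn.
    have R1 : rest C (1 :: a).
      apply: (rest_shift goodC sz_a baseC lt_j).
      by rewrite -e0 -em; case/andP: Rm.
    by case: (three 1 a sz_a R1).
  - move=> [lo' [h [hi' [ea em lo_gt0]]]].
    have Cg : C (0 :: (nseq (size lo') 0 ++ h.+1 :: hi')) by rewrite -em; case/andP: Rm.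
    case: (gen_shape ea lo_gt0 Cg) => [[le_lo _]|[_ _ _ Ru]]; first by lia.
    case: (three 0 _ szu Ru) => [[eu]|[->]//].
    by have := lt_lex_unit; rewrite eu lexlt_irr.
case: form => ekm; [left|right] => -[|k' m'] //= [sz'].
  rewrite (@base_or_rest n) /= ?sz' // baseC // e2; congr (_ || _).
  apply/idP/andP => [R'|[/eqP->]].
    by case: (three k' m' sz' R'); rewrite ?ekm => -[-> ->].
  by case: k' => [|[|k']] // _; rewrite -ekm.
rewrite (@base_or_rest n) /= ?sz' // baseC // !ltnS !leqn0; congr (_ || _).
apply/idP/orP => [R'|[/andP[/eqP-> /eqP->]|/andP[/eqP-> /eqP->]]] //; last by rewrite -ekm.
by case: (three k' m' sz' R'); rewrite ?ekm => -[-> ->]; rewrite !eqxx; [left|right].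
Qed.

End OneExtra.

(** ** Ideals whose base is not lexicographic *)

Lemma HL_points w n i : hf n.+1 (lexlt^~ (w :: nseq n 0)) i = minn w i.+1.
Proof.
have := HL_cons w (nseq n 0) i; rewrite /= size_nseq sumn_zeros subn0 => ->.
by rewrite big1 // => l _; have := HL_zeros n l; rewrite size_nseq.
Qed.

Lemma excessS n B a i :
  excess n B a i.+1 = excess n B a i + (hf n B i.+1 - HL a i.+1).
Proof. by rewrite /excess big_ord_recr. Qed.

Lemma excess_ge n B a i : hf n B i - HL a i <= excess n B a i.
Proof. by rewrite /excess big_ord_recr leq_addl. Qed.

Lemma excess_ge2 n B a i : HL a i < hf n B i -> HL a i.+1 < hf n B i.+1 ->
  1 < excess n B a i.+1.
Proof.
by move=> lt1 lt2; rewrite excessS; have := excess_ge n B a i; lia.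
Qed.

(** The excess is at least 1 both in degree 1 and in degree 2: a third element appears
    in degree 1, and Macaulay's bound in degree 3 forces a fourth one in
    degree at most 2. *)
Lemma excess_points n B w : 0 < n -> 3 < w -> good n.+1 B ->
  macaulay n.+1 B (w :: nseq n 0) -> B (0 :: unit n 0) ->
  1 < excess n.+1 B (w :: nseq n 0) 2.
Proof.
move=> n_gt0 w_gt3 goodB macB B1; have evB := macaulay_evtype macB.
have B3 := points_three n_gt0 goodB B1; have u3 := points_uniq n_gt0.
have deg3 m : m \in [:: nseq n.+1 0; 1 :: nseq n 0; 0 :: unit n 0] -> sumn m <= 1.
  by rewrite !inE => /or3P[]/eqP->; rewrite /= ?sumn_unit ?sumn_zeros.
apply: excess_ge2; rewrite /= size_nseq HL_points.
  apply: leq_trans (_ : 3 <= _); first by rewrite ltnS geq_min leqnn orbT.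
  apply: (size_le_hf u3) => m ms; have [sz Bm] := B3 m ms; split=> //; exact: deg3.
apply: leq_trans (_ : 4 <= _); first by rewrite ltnS geq_min leqnn orbT.
suff [m [sz Bm le2 nm]] : exists m, [/\ size m = n.+1, B m, sumn m <= 2 &
    m \notin [:: nseq n.+1 0; 1 :: nseq n 0; 0 :: unit n 0]].
  apply: (@size_le_hf _ _ _ (m :: [:: nseq n.+1 0; 1 :: nseq n 0; 0 :: unit n 0])).
    by rewrite cons_uniq nm.
  move=> m'; rewrite inE => /orP[/eqP->//|ms]; have [sz' Bm'] := B3 m' ms.
  by split=> //; apply: leq_trans (deg3 _ ms) _.
apply: contrapT => no.
have in3 m : size m = n.+1 -> B m -> sumn m <= 3 ->
    m \in [:: nseq n.+1 0; 1 :: nseq n 0; 0 :: unit n 0].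
  move=> sz Bm le3; apply: contraT => nm; case: no.
  case: (leqP (sumn m) 2) => [le2|gt2]; first by exists m.
  have [|j [m0 [lt_j sz0 em]]] := @raise_gt0P m; first by lia.
  have dm : sumn m = (sumn m0).+1 by rewrite em sumn_raise ?sz0 // addn1.
  exists m0; rewrite sz0; split=> //; last 1 first.
  - by apply/negP => /deg3; lia.
  - by apply: (proj1 goodB m0 j); rewrite -?em -?sz ?sz0.
  - by lia.
have [_ le_h _ _] := macB; have := le_h 3; rewrite /= size_nseq HL_points.
apply/negP; rewrite -ltnNge (_ : minn w 4 = 4); last by lia.
rewrite ltnS -[3]/(size [:: nseq n.+1 0; 1 :: nseq n 0; 0 :: unit n 0]).
rewrite /hf -size_filter; apply: uniq_leq_size; first by rewrite filter_uniq ?uniq_mons.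
by move=> m; rewrite mem_filter mem_mons => /and3P[Bm /eqP sz le]; apply: in3.
Qed.

(** For finite length this is [excess_points].  Otherwise the first entry of the type
    is 0, where the lexicographic set is the only one, or 1.  In that case
    an excess in the base of [B] gives an excess of [B] in two consecutive
    degrees, and so does, unless [w = 2], the choice of the last linear
    generator as the rest of [B]. *)
Lemma excess_le1_lex n z w lo B : size (lo ++ w :: nseq z.+1 0) = n -> 0 < w ->
  sumn lo <= 1 -> good n B -> macaulay n B (lo ++ w :: nseq z.+1 0) ->
  ~ (lo = [::] /\ w = 3) -> ~ (head 0 lo = 1 /\ w = 2) ->
  (forall i, excess n B (lo ++ w :: nseq z.+1 0) i <= 1) ->
  forall m, size m = n -> B m = lexlt m (lo ++ w :: nseq z.+1 0).
Proof.
case: n => [|n]; first by rewrite size_cat /=; lia.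
case: lo => [|x lo] /= [sz_a] w_gt0 lo_le1 goodB macB not3 not2 ex_le1.
  move: sz_a; rewrite size_nseq => sz_a; rewrite -[0 :: nseq z 0]/(nseq z.+1 0) in macB ex_le1 *.
  rewrite sz_a in macB ex_le1 *.
  have n_gt0 : 0 < n by rewrite -sz_a.
  have evB := macaulay_evtype macB.
  case: (leqP w 2) => [le2|gt2]; first exact: points_small_lex.
  apply: points_lex => // _; apply/negP => B1.
  have w_gt3 : 3 < w by case: (ltngtP w 3) gt2 => // ew _; case: not3.
  by have := excess_points n_gt0 w_gt3 goodB macB B1; rewrite ltnNge ex_le1.
set a := lo ++ w :: nseq z.+1 0 in sz_a macB ex_le1 *.
have {not3} evB := macaulay_evtype macB.
case: x lo_le1 not2 macB ex_le1 evB => [|[|x]] lo_le1 not2 macB ex_le1 evB.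
- exact: type0_lex.
- have [macB' [le_e ge_e _]] := base_type goodB evB.
  have lo0 : sumn lo = 0 by lia.
  have s_a : sumn a = w by rewrite sumn_cat lo0 /= sumn_zeros; lia.
  case: (EM (exists l, HL a l < hf n (base B) l)) => [[l lt_l]|no].
    have lt_lw : l.+1 < w.
      rewrite ltnNge; apply/negP => le_w; have [_ _ eqh _] := macB'.
      by have := eqh l; rewrite s_a le_w => /(_ isT) el; rewrite el ltnn in lt_l.
    have ex1 i : l <= i -> 0 < excess n (base B) a i.
      move=> le_i; have := excess_mono n B a le_i.
      have := excess_ge n (base B) a l; lia.
    have gt_h i : l <= i -> i < w -> HL (1 :: a) i < hf n.+1 B i.
      move=> le_i lt_w; rewrite HL_cons (hf_phi macB') s_a /=.
      by have := ex1 i le_i; lia.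
    have [w' ew] : exists w', w = w'.+2 by exists (w - 2); lia.
    suff: 1 < excess n.+1 B (1 :: a) w'.+1 by rewrite ltnNge ex_le1.
    by apply: excess_ge2; apply: gt_h; lia.
  have baseB : forall m, size m = n -> base B m = lexlt m a.
    apply: excess0_lex (base_good goodB) macB' _ => i.
    rewrite /excess big1 // => l _; apply/eqP; rewrite subn_eq0 leqNgt.
    by apply/negP => lt; apply: no; exists l.
  have lo_le1' : sumn lo <= 1 by rewrite lo0.
  case: (one_extra_point sz_a w_gt0 lo_le1' goodB evB baseB erefl) => // -[w_ge2 eqB].
  have w_gt2 : 2 < w by case: (ltngtP w 2) => // [|ew]; [lia | case: not2].
  have gt_h i : 0 < i -> i < w -> HL (1 :: a) i < hf n.+1 B i.
    move=> i_gt0 lt_w; rewrite HL_cons (hf_phi macB') s_a /=.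
    suff: 0 < hf n.+1 (rest B) i by lia.
    have szu := size_unit n (size lo).+1.
    apply: (@size_le_hf _ _ _ [:: 0 :: unit n (size lo).+1]) => // m; rewrite inE => /eqP->.
    rewrite /= szu; split=> //.
      apply: (rest_unit sz_a baseB).
      by rewrite eqB /= ?szu // eqxx !orbT.
    rewrite sumn_unit ?add0n // -sz_a size_cat /= size_nseq; lia.
  suff: 1 < excess n.+1 B (1 :: a) 2 by rewrite ltnNge ex_le1.
  by apply: excess_ge2; apply: gt_h; lia.
by lia.
Qed.

Theorem one_point n z w lo C : size (lo ++ w :: nseq z.+1 0) = n -> 0 < w ->
  sumn lo <= 1 -> good n.+1 C -> evtype n.+1 C (1 :: lo ++ w :: nseq z.+1 0) ->
  ~ (lo = [::] /\ w = 3) -> ~ (head 0 lo = 1 /\ w = 2) ->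
  (forall m, size m = n.+1 -> C m = lexlt m (1 :: lo ++ w :: nseq z.+1 0)) \/
  2 <= sumn lo + w /\ (forall m, size m = n.+1 ->
    C m = two_rows (lo ++ w :: nseq z.+1 0) (unit n (size lo).+1) 1 0 m).
Proof.
move=> sz_a w_gt0 lo_le1 goodC evC not3 not2.
have [macB [le_e _ _]] := base_type goodC evC.
apply: one_extra_point => //; apply: excess_le1_lex => //; first exact: base_good.
by move=> i; apply: leq_trans (le_e i); apply: leq_addr.
Qed.

Theorem two_points n z q C : size (nseq q 0 ++ 1 :: nseq z.+1 0) = n ->
  good n.+1 C -> evtype n.+1 C (2 :: nseq q 0 ++ 1 :: nseq z.+1 0) ->
  (forall m, size m = n.+1 -> C m = lexlt m (2 :: nseq q 0 ++ 1 :: nseq z.+1 0)) \/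
  (forall m, size m = n.+1 ->
    C m = two_rows (nseq q 0 ++ 1 :: nseq z.+1 0) (unit n q.+1) 1 1 m).
Proof.
move=> sz_a goodC evC; have [macB _] := base_type goodC evC.
have := @two_extra_points n z 1 2 (nseq q 0) C sz_a isT; rewrite size_nseq sumn_zeros.
apply=> //.
have evB := macaulay_evtype macB; have goodB := base_good goodC.
case: n sz_a goodC evC macB evB goodB => [|n] sz_a goodC evC macB evB goodB.
  by move: sz_a; rewrite size_cat /=; lia.
case: q sz_a evC macB evB => [|q] /= [sz_a] evC macB evB; last exact: type0_lex.
move: sz_a evB; rewrite size_nseq -[0 :: nseq z 0]/(nseq z.+1 0) => en evB.
by subst n; apply: (points_small_lex _ goodB evB).
Qed.

(** * Families of strongly stable ideals *)

(** Strongly stable ideals: a part of an exponent may be moved, not only the whole. *)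
Definition stable n C := order_ideal n C /\
  forall m i j, size m = n -> i < j -> j < n -> C (raise j 1 m) -> C (raise i 1 m).

Lemma hf_two_rows n a u e1 e2 i : size a = n -> size u = n -> lexlt a u ->
  hf n.+1 (two_rows a u e1 e2) i = \sum_(l < i.+1) HL a l +
    minn e2 (i.+1 - sumn a) + minn e1 (i.+1 - sumn u).
Proof.
move=> sz_a sz_u lt_au.
pose row c e m := if m is k :: m' then (m' == c) && (k < e) else false.
rewrite (@hf_split n.+1 (fun m => lexlt (behead m) a)); last by move=> [|k m] //= _ ->.
rewrite (hf_cone n (lexlt^~ a)) -addnA sz_a; congr (_ + _).
rewrite (@hf_split _ (row a e2)); last first.
  by move=> [|k m] //= _ /andP[/eqP-> ->]; rewrite eqxx lexlt_irr.
rewrite hf_pure //; congr (_ + _); rewrite -(@hf_pure n e1 u) //.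
apply: eq_hf => -[|k m] //= _; case: (eqVneq m u) => [->|ne] /=; last first.
  by rewrite orbF; case: (lexlt m a); rewrite //= andbT andbN.
by rewrite (negPf (lexlt_gt lt_au)) /= eq_sym (negPf (lexlt_neq lt_au)) /= !andbT.
Qed.

Lemma two_rows_type n a u e1 e2 : size a = n -> size u = n -> lexlt a u ->
  evtype n.+1 (two_rows a u e1 e2) (e1 + e2 :: a).
Proof.
move=> sz_a sz_u lt_au; split; first by rewrite /= sz_a.
exists (e1 + e2 + sumn a + sumn u) => i le_i.
rewrite (hf_two_rows _ _ _ sz_a) // HL_cons -addnA; congr (_ + _); lia.
Qed.

Lemma lex_type a : evtype (size a) (lexlt^~ a) a.
Proof. by split=> //; exists 0. Qed.

Lemma lex_stable a : stable (size a) (lexlt^~ a).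
Proof.
split=> [m j sz lt_j|m i j sz lt_ij lt_j]; apply: lexlt_trans.
  by apply: lexlt_raise; rewrite ?sz.
by apply: lexlt_raise2; rewrite ?sz.
Qed.

(** Lowering one step below [k :: u] inside the first entries gives vectors that
    precede [a]; the critical case lowers the entry that was increased in [u],
    and its largest result is [v] followed by [h :: hi].  If this is [a] itself
    then the row of [a] has to be at least as long as that of [u], and strictly
    longer if the step goes to the first variable of the cone. *)
Lemma stable_two_rows lo h hi e1 e2 :
  (lo = [::] /\ e1 < e2) \/
  (0 < size lo /\ let v := unit (size lo) (size lo).-1 in
     lexlt v lo \/ v = lo /\ e1 <= e2) ->
  stable (size (lo ++ h :: hi)).+1
    (two_rows (lo ++ h :: hi) (nseq (size lo) 0 ++ h.+1 :: hi) e1 e2).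
Proof.
set a := lo ++ h :: hi; set u := nseq (size lo) 0 ++ h.+1 :: hi => cond.
have key k m j : size m = size a -> j < size a ->
    two_rows a u e1 e2 (k :: raise j 1 m) ->
  [/\ two_rows a u e1 e2 (k :: m), two_rows a u e1 e2 (k.+1 :: m) &
      forall i, i < j -> two_rows a u e1 e2 (k :: raise i 1 m)].
  move=> sz lt_j; have lt_m : lexlt m (raise j 1 m) by rewrite lexlt_raise ?sz.
  have lt_i i : i < j -> lexlt (raise i 1 m) (raise j 1 m).
    by move=> lt_ij; rewrite lexlt_raise2 ?sz.
  case/or3P => [lt|/andP[/eqP<- lt_k]|/andP[/eqP eu lt_k]].
  - split=> [||i /lt_i lt']; rewrite /= ?(lexlt_trans lt_m lt) //.
    by rewrite (lexlt_trans lt' lt).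
  - by split=> [||i /lt_i lt']; rewrite /= ?lt_m ?lt'.
  have szu : size u = size a by rewrite !size_cat size_nseq.
  case: (ltngtP j (size lo)) => [lt_jlo|gt_j|ej].
  - have := congr1 (fun s => nth 0 s j) eu.
    by rewrite nth_raise eqxx sz lt_j addn1 /u nth_cat size_nseq lt_jlo nth_zeros.
  - have [j' ej'] : exists j', j = size lo + j'.+1 by exists (j - size lo).-1; lia.
    have em : m = take (size lo) m ++ drop (size lo) m by rewrite cat_take_drop.
    have sz_t : size (take (size lo) m) = size lo.
      by rewrite size_takel // sz size_cat leq_addr.
    case ed : (drop (size lo) m) em => [|h' hi'] em.
      by move: sz; rewrite em cats0 sz_t size_cat /=; lia.
    move: eu; rewrite {1}em ej' -{1}sz_t raise_cat_r /= => /eqP.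
    rewrite eqseq_cat ?sz_t ?size_nseq // => /andP[_ /eqP[_ ehi]].
    have lt_j' : j' < size hi'.
      by move: lt_j; rewrite -sz em size_cat sz_t /=; lia.
    have lt_hi : lexlt hi' hi.
      by rewrite -ehi lexlt_raise.
    have lt_ma : lexlt m a by rewrite em lexlt_cat_hi //= lt_hi.
    split=> [||i lt_ij]; rewrite /= ?lt_ma //.
    suff -> : lexlt (raise i 1 m) a by [].
    case: (ltnP i (size lo)) => [lt_ilo|le_i].
      by rewrite em raise_cat_l ?sz_t // lexlt_cat_hi ?size_raise //= lt_hi.
    rewrite em -(subnKC le_i) -{1}sz_t raise_cat_r; apply: lexlt_cat_hi => //.
    case ei : (i - size lo) => [|i'] /=; first by rewrite lt_hi.
    by rewrite -ehi lexlt_raise2 //; lia.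
  have em : m = nseq (size lo) 0 ++ h :: hi.
    have em : m = take (size lo) m ++ drop (size lo) m by rewrite cat_take_drop.
    have sz_t : size (take (size lo) m) = size lo.
      by rewrite size_takel // sz size_cat leq_addr.
    case ed : (drop (size lo) m) em => [|h' hi'] em.
      by move: sz; rewrite em cats0 sz_t size_cat /=; lia.
    move: eu; rewrite {1}em ej -{1}sz_t -[X in raise X]addn0 raise_cat_r /= => /eqP.
    rewrite eqseq_cat ?sz_t ?size_nseq // => /andP[/eqP et /eqP[eh ehi]].
    by rewrite {1}em et -ehi; congr (_ ++ _ :: _); lia.
  case: cond => [[lo0 lt_e]|[lo_gt0]].
    have ema : m = a by rewrite em /a lo0.
    split; rewrite /= ?ema ?eqxx.
    - by rewrite (leq_trans lt_k (ltnW lt_e)) orbT.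
    - by rewrite (leq_ltn_trans lt_k lt_e) orbT.
    - by move=> i; rewrite ej lo0.
  set v := unit _ _ => /= cond.
  have le_v m' : lexlt m' v -> lexlt m' lo.
    by case: cond => [lt /lexlt_trans|[-> _]]; [apply|].
  have lt_ma : lexlt m a.
    rewrite em /a lexlt_cat_same ?size_nseq //; apply: le_v.
    by apply: lexlt_raise; rewrite ?size_nseq //; lia.
  split=> [||i lt_ij]; rewrite /= ?lt_ma //.
  rewrite em raise_cat_l ?size_nseq; last by rewrite -ej.
  rewrite -/(unit (size lo) i) /a lexlt_cat_same ?size_unit // eqseq_cat ?size_unit //.
  rewrite eqxx andbT; case: (ltngtP i (size lo).-1) => [lt_i'|gt_i|ei].
  - by rewrite le_v // /v lexlt_raise2 ?size_nseq //; lia.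
  - by lia.
  rewrite ei -/v; case: cond => [-> //|[-> le_e]].
  by rewrite eqxx (leq_trans lt_k le_e) orbT.
have step k m : two_rows a u e1 e2 (k.+1 :: m) -> two_rows a u e1 e2 (k :: m).
  by case/or3P => /= [->|/andP[-> /ltnW->]|/andP[-> /ltnW->]]; rewrite ?orbT.
split=> [m [|j]|m i [|j]] //; case: m => [|k m] // [sz] lt.
- by rewrite /= addn1; apply: step.
- by move=> /(key k m j sz lt)[].
move=> lt_j /(key k m j sz lt_j)[_ Tk1 Ti].
by case: i lt => [|i] lt_ij; [rewrite /= addn1 | apply: Ti].
Qed.

Lemma cone_stable n B : stable n B -> stable n.+1 (fun m => B (behead m)).
Proof.
case=> idB stB; split=> [[|k m] [|j]|[|k m] i [|j]] //= [sz] lt_j; first exact: idB.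
move=> lt_jn Bj; case: i lt_j => [|i] lt_ij /=; last exact: stB lt_jn Bj.
exact: idB Bj.
Qed.

(** The Hilbert function of the base exceeds the lexicographic one by 1 in degree 1
    and agrees with it in all other degrees, so a cone with empty rest already
    has a part 0. *)
Lemma cone_two_rows_type n a u e1 e2 : size a = n -> size u = n -> lexlt a u ->
  (forall l, minn e2 (l.+1 - sumn a) + minn e1 (l.+1 - sumn u) =
             minn (e1 + e2) (l.+1 - sumn a) + (l == 1)) ->
  evtype n.+2 (fun m => two_rows a u e1 e2 (behead m)) [:: 1, e1 + e2 & a].
Proof.
move=> sz_a sz_u lt_au special; split; first by rewrite /= sz_a.
exists (e1 + e2 + sumn a).+1 => i le_i.
rewrite (hf_cone n.+1 (two_rows a u e1 e2)) HL_cons.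
rewrite (eq_bigr (fun l : 'I_i.+1 => HL (e1 + e2 :: a) l + (l == 1 :> nat))).
  rewrite big_split /=; congr (_ + _).
  case: i le_i => // i le_i; rewrite (bigD1 (inord 1 : 'I_i.+2)) //= inordK // eqxx.
  rewrite big1; first by lia.
  by move=> l /eqP ne; case: eqP => // el; case: ne; apply/val_inj; rewrite /= inordK.
by move=> l _; rewrite (hf_two_rows _ _ _ sz_a) // HL_cons -!addnA special.
Qed.

(** * Monomial ideals and Borel-fixed ideals *)

Import GRing.Theory.
Local Open Scope ring_scope.

Section Monomials.
Variable n : nat.
Implicit Types mu : 'X_{1..n.+1}.

(** Exponents are listed from the last variable to the first one. *)
Definition mon (l : seq nat) : 'X_{1..n.+1} :=
  [multinom nth 0%N l (n - i)%N | i < n.+1].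

Definition expo (mu : 'X_{1..n.+1}) : seq nat :=
  mkseq (fun j => mu (inord (n - j))) n.+1.

Lemma size_expo mu : size (expo mu) = n.+1.
Proof. by rewrite size_mkseq. Qed.

Lemma nth_expo mu (i : 'I_n.+1) : nth 0%N (expo mu) (n - i) = mu i.
Proof.
rewrite nth_mkseq ?ltnS ?leq_subr // subKn; last by rewrite -ltnS.
by rewrite inord_val.
Qed.

Lemma expoK : cancel expo mon.
Proof. by move=> mu; apply/mnmP => i; rewrite mnmE nth_expo. Qed.

Lemma monK l : size l = n.+1 -> expo (mon l) = l.
Proof.
move=> sz; apply: (@eq_from_nth _ 0%N); rewrite size_expo // => j lt_j.
by rewrite nth_mkseq // mnmE inordK ?subKn //; lia.
Qed.

Lemma mdeg_mon l : size l = n.+1 -> mdeg (mon l) = sumn l.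
Proof.
move=> sz; rewrite mdegE (reindex_inj rev_ord_inj) /= sumnE (big_nth 0%N) sz big_mkord.
apply: eq_bigr => i _; rewrite mnmE /=; congr nth; have := ltn_ord i; lia.
Qed.

Lemma mon_raise l j k : size l = n.+1 -> (j < n.+1)%N ->
  mon (raise j k l) = (mon l + U_(inord (n - j)) *+ k)%MM.
Proof.
move=> sz lt_j; apply/mnmP => i; rewrite mnmDE mulmnE mnm1E !mnmE nth_raise sz.
have lt_i := ltn_ord i; congr addn.
have -> : (n - i < n.+1)%N by lia.
rewrite andbT -val_eqE /= inordK; last by lia.
have -> : (n - i == j)%N = (n - j == i)%N by lia.
by case: (n - j == i)%N; rewrite ?mul1n ?mul0n.
Qed.

Lemma expoD mu1 mu2 : divides (expo mu2) (expo (mu1 + mu2)%MM).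
Proof.
move=> j; case: (ltnP j n.+1) => [lt_j|le_j]; last by rewrite !nth_default ?size_expo.
by rewrite !nth_mkseq // mnmDE leq_addl.
Qed.

End Monomials.

Section MonomialIdeals.
Variables (K : fieldType) (n : nat).
Local Notation S := {mpoly K[n.+1]}.
Implicit Types (I : S -> Prop) (mu : 'X_{1..n.+1}).

Definition mono_closed I := forall f mu, I f -> mu \in msupp f -> I 'X_[mu].

Definition mono_ideal C (f : S) := forall mu, mu \in msupp f -> ~~ C (behead (expo mu)).

(** The exponent of the last variable is set to 0, since that variable can be
    cancelled in a saturated ideal. *)
Definition staircase I l := ~~ `[< I 'X_[mon n (0%N :: l)] >].

Lemma ideal_scale I c f : is_ideal I -> I f -> I (c *: f).
Proof. by case=> _ _ idM If; rewrite -mul_mpolyC; apply: idM. Qed.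

Lemma ideal_sum I (T : eqType) (s : seq T) (F : T -> S) : is_ideal I ->
  (forall x, x \in s -> I (F x)) -> I (\sum_(x <- s) F x).
Proof.
case=> id0 idD _; elim: s => [|x s IH] Fs; first by rewrite big_nil.
rewrite big_cons; apply: idD; first by apply: Fs; rewrite mem_head.
by apply: IH => y ys; apply: Fs; rewrite inE ys orbT.
Qed.

Lemma mono_closedP I f : is_ideal I -> mono_closed I ->
  I f <-> forall mu, mu \in msupp f -> I 'X_[mu].
Proof.
move=> idI mcI; split=> [If mu|Im]; first exact: mcI.
by rewrite [f]mpolyE; apply: ideal_sum => // mu /Im; apply: ideal_scale.
Qed.

Definition dmx (i : 'I_n.+1) (t : K) : 'M[K]_n.+1 :=
  \matrix_(k, l) (if k == l then (if k == i then t else 1) else 0).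

Lemma dmx_act i t mu : mx_act (dmx i t) 'X_[mu] = t ^+ mu i *: 'X_[mu].
Proof.
rewrite /mx_act comp_mpolyX [in RHS]mpolyXE_id.
have E (j : 'I_n.+1) : tnth [tuple \sum_(k < n.+1) dmx i t k j *: ('X_k : S) | j < n.+1] j =
    (if j == i then t else 1) *: 'X_j.
  rewrite tnth_mktuple (bigD1 j) //= big1 => [|k /negPf ne]; last first.
    by rewrite mxE ne scale0r.
  by rewrite mxE eqxx addr0.
rewrite (eq_bigr (fun j : 'I_n.+1 =>
    (if j == i then t ^+ mu i else 1) *: ('X_j ^+ mu j : S))); last first.
  move=> j _; rewrite E exprZn; case: eqP => [->//|_]; by rewrite expr1n.
rewrite scaler_prod; congr (_ *: _).
by rewrite -big_mkcond big_pred1_eq.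
Qed.

Lemma dmx_upper i t : upper_triangular (dmx i t).
Proof. by move=> k l lt; rewrite mxE; case: eqP lt => // ->; rewrite ltnn. Qed.

Lemma dmx_unit i t : t != 0 -> dmx i t \in unitmx.
Proof.
move=> t0; rewrite unitmxE.
have -> : dmx i t = diag_mx (\row_k (if k == i then t else 1)).
  by apply/matrixP => k l; rewrite !mxE; case: eqP => [->|_] //=; rewrite ?mulr1n.
rewrite det_diag unitfE; apply/prodf_neq0 => k _; rewrite mxE.
by case: (k == i); rewrite // oner_eq0.
Qed.

Lemma exists_separating (c d : nat) : infinite_field K -> c != d :> nat ->
  exists2 t : K, t != 0 & t ^+ c != t ^+ d.
Proof.
move=> infK; wlog lt_ab : c d / (c < d)%N => [W|_].
  case: (ltngtP c d) => // lt _; first by apply: W; rewrite // neq_ltn lt.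
  have [|t t0 ne] := W d c lt; first by rewrite neq_ltn lt.
  by exists t; rewrite // eq_sym.
pose P : {poly K} := 'X * ('X^d - 'X^c).
have P0 : P != 0.
  rewrite mulf_neq0 ?polyX_eq0 //; apply/eqP => /(congr1 (fun q : {poly K} => q`_d)).
  rewrite coefB !coefXn eqxx coef0 (gtn_eqF lt_ab) subr0 => /eqP.
  by rewrite oner_eq0.
have [s sP] : exists s : seq K, forall t, root P t -> t \in s.
  pose bound := size P; apply: contrapT => no.
  have big k : exists s : seq K, [/\ uniq s, all (root P) s & size s = k].
    elim: k => [|k [s [us rs szs]]]; first by exists [::].
    apply: contrapT => nos; apply: no; exists s => t rt; apply: contraT => nt.
    by case: nos; exists (t :: s); rewrite /= nt us rt rs szs.
  have [s [us rs szs]] := big (size P).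
  by have := max_poly_roots P0 rs us; rewrite szs ltnn.
have [t ts] := infK s; have : ~~ root P t by apply: contra ts => /sP.
rewrite rootE hornerM hornerD hornerN !hornerXn hornerX mulf_eq0 negb_or subr_eq0.
by case/andP => t0; rewrite eq_sym => ne; exists t.
Qed.

Lemma borel_sub I g f : borel_fixed I -> g \in unitmx -> upper_triangular g ->
  I f -> I (mx_act g f).
Proof. by move=> bI gu gt If; apply/(bI g gu gt); exists f. Qed.

(** A monomial [mu'] other than [mu] is removed from [f] by subtracting a multiple of
    [f] from its image under a diagonal matrix on which the two monomials take
    different values; the number of monomials decreases. *)
Lemma borel_mono_closed I : infinite_field K -> is_ideal I -> borel_fixed I ->
  mono_closed I.
Proof.
move=> infK idI bI f mu; have [k le_k] := ubnP (size (msupp f)).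
elim: k f le_k => // k IH f le_k If mf.
have fm : f@_mu != 0 by rewrite -mcoeff_msupp.
case: (EM (exists2 mu', mu' \in msupp f & mu' != mu)) => [[mu' m'f ne]|no]; last first.
  have ef : f = f@_mu *: 'X_[mu].
    rewrite {1}[f]mpolyE (bigD1_seq mu) ?msupp_uniq //= big_seq_cond big1 ?addr0 //.
    move=> mu' /andP[m'f ne]; by case: no; exists mu'.
  have -> : 'X_[mu] = (f@_mu)^-1 *: f by rewrite {2}ef scalerA mulVf // scale1r.
  exact: ideal_scale.
have [i ne_i] : exists i, mu' i != mu i.
  apply/existsP; apply: contraR ne; rewrite negb_exists => /forallP eqm.
  by apply/eqP/mnmP => i; apply/eqP; have := eqm i; rewrite negbK.
have [t t0 ne_t] := exists_separating infK ne_i.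
pose f' := mx_act (dmx i t) f - t ^+ mu' i *: f.
have f'E mu2 : f'@_mu2 = (t ^+ mu2 i - t ^+ mu' i) * f@_mu2.
  rewrite mcoeffB mcoeffZ mulrBl; congr (_ - _).
  rewrite /mx_act comp_mpolyEX raddf_sum /=.
  under eq_bigr => mu3 _.
    rewrite -[_ \mPo _]/(mx_act (dmx i t) 'X_[mu3]) dmx_act scalerA.
    rewrite mcoeffZ mcoeffX.
    over.
  rewrite /=; case: (boolP (mu2 \in msupp f)) => [m2f|m2f].
    rewrite (bigD1_seq mu2) ?msupp_uniq //= eqxx mulr1 big1 ?addr0; last first.
      by move=> mu3 /negPf->; rewrite mulr0.
    exact: mulrC.
  rewrite (memN_msupp_eq0 m2f) mulr0 big_seq_cond big1 // => mu3 /andP[m3f _].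
  by case: eqP m2f => [<-|_]; rewrite ?m3f ?mulr0.
apply: (IH f').
- have sub : {subset mu' :: msupp f' <= msupp f}.
    move=> mu2; rewrite inE => /orP[/eqP->//|].
    by rewrite !mcoeff_msupp f'E mulf_eq0 negb_or => /andP[].
  have := uniq_leq_size _ sub; rewrite /= msupp_uniq mcoeff_msupp f'E subrr mul0r eqxx /=.
  by move=> /(_ isT); move: le_k; lia.
- have [_ idD _] := idI; apply: idD; last by rewrite -scaleNr; apply: ideal_scale.
  by apply: borel_sub => //; [apply: dmx_unit | apply: dmx_upper].
by rewrite mcoeff_msupp f'E mulf_neq0 // subr_eq0 eq_sym.
Qed.

Definition emx (i j : 'I_n.+1) : 'M[K]_n.+1 := 1%:M + delta_mx i j.

Lemma emx_upper (i j : 'I_n.+1) : (i < j)%N -> upper_triangular (emx i j).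
Proof.
move=> lt_ij k l lt; rewrite !mxE.
have -> : (k == l) = false by apply/eqP => e; rewrite e ltnn in lt.
rewrite add0r; case: eqP => [ek|//]; case: eqP => [el|//].
by move: lt; rewrite ek el; move: lt_ij; lia.
Qed.

Lemma upper_unit (g : 'M[K]_n.+1) : upper_triangular g ->
  (g \in unitmx) = [forall i, g i i != 0].
Proof.
move=> gt; rewrite unitmxE -det_tr det_trig; last first.
  by apply/is_trig_mxP => i j lt; rewrite mxE gt.
rewrite unitfE; apply/prodf_neq0/forallP => [nz i|nz i _]; first by have := nz i isT; rewrite mxE.
by rewrite mxE.
Qed.

Lemma emx_unit (i j : 'I_n.+1) : (i < j)%N -> emx i j \in unitmx.
Proof.
move=> lt_ij; rewrite upper_unit; last exact: emx_upper.
apply/forallP => k; rewrite !mxE eqxx.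
have -> : (k == i) && (k == j) = false.
  by apply/andP => -[/eqP ek /eqP el]; move: lt_ij; rewrite -ek -el ltnn.
by rewrite addr0 oner_eq0.
Qed.

Lemma emx_act (i j : 'I_n.+1) mu r : (i < j)%N -> mu j = 0%N ->
  mx_act (emx i j) 'X_[mu + U_(j) *+ r] =
  \sum_(k < r.+1) 'X_[mu + U_(i) *+ (r - k) + U_(j) *+ k] *+ 'C(r, k).
Proof.
move=> lt_ij mj.
have ne_ij : i != j by rewrite -val_eqE neq_ltn lt_ij.
have E (l : 'I_n.+1) : tnth [tuple \sum_(k < n.+1) emx i j k l *: ('X_k : S) | l < n.+1] l =
    if l == j then 'X_i + 'X_j else 'X_l.
  rewrite tnth_mktuple; case: eqP => [->|/eqP ne].
    rewrite (bigD1 i) //= (bigD1 j) ?(eq_sym j) //= big1 => [|k /andP[ki kj]].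
      by rewrite !mxE eqxx (negPf ne_ij) (eq_sym j) (negPf ne_ij) !eqxx add0r addr0 /= !scale1r addr0 scale1r.
    by rewrite !mxE (negPf kj) (negPf ki) add0r scale0r.
  rewrite (bigD1 l) //= big1 => [|k kl].
    by rewrite !mxE !eqxx (negPf ne) andbF !addr0 scale1r.
  by rewrite !mxE (negPf kl) (negPf ne) andbF addr0 scale0r.
rewrite /mx_act comp_mpolyX (bigD1 j) //= E eqxx mnmDE mj mulmnE mnm1E eqxx mul1n add0n.
rewrite (eq_bigr (fun l : 'I_n.+1 => 'X_l ^+ mu l : S)); last first.
  move=> l ne; rewrite E (negPf ne) mnmDE mulmnE mnm1E eq_sym (negPf ne) mul0n addn0 //.
have -> : \prod_(l < n.+1 | l != j) ('X_l ^+ mu l : S) = 'X_[mu].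
  by rewrite [RHS]mpolyXE_id [RHS](bigD1 j) //= mj expr0 mul1r.
rewrite exprDn mulr_suml; apply: eq_bigr => k _.
by rewrite mulrnAl !mpolyXn -mpolyXD -mpolyXD; congr ('X_[_] *+ _); rewrite addmC addmA.
Qed.

(** Expand [('X_i + 'X_j) ^+ r] and use that the ideal is monomial. *)
Lemma borel_move I (i j : 'I_n.+1) mu r k : infinite_field K -> is_ideal I ->
  borel_fixed I -> (i < j)%N -> mu j = 0%N -> (k <= r)%N -> 'C(r, k)%:R != 0 :> K ->
  I 'X_[mu + U_(j) *+ r] -> I 'X_[mu + U_(i) *+ (r - k) + U_(j) *+ k].
Proof.
move=> infK idI bI lt_ij mj le_k bin_k Im.
have := borel_sub bI (emx_unit lt_ij) (emx_upper lt_ij) Im.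
rewrite emx_act // => /(borel_mono_closed infK idI bI); apply.
rewrite mcoeff_msupp raddf_sum /= (bigD1 (inord k : 'I_r.+1)) //= inordK // big1.
  by rewrite mcoeffMn mcoeffX eqxx addr0.
move=> l; rewrite -val_eqE /= inordK // => ne_l; rewrite mcoeffMn mcoeffX.
case: eqP => [/mnmP/(_ j)|]; last by rewrite mul0rn.
rewrite !mnmDE !mulmnE !mnm1E eqxx !mul1n -val_eqE /= (ltn_eqF lt_ij) !mul0n.
by move: ne_l; lia.
Qed.

End MonomialIdeals.

Section Staircase.
Variables (K : fieldType) (n : nat).
Local Notation S := {mpoly K[n.+1]}.
Implicit Types (I : S -> Prop) (mu : 'X_{1..n.+1}).

Lemma mono_idealX C mu : mono_ideal C ('X_[mu] : S) <-> ~~ C (behead (expo mu)).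
Proof.
split=> [|nC nu]; first by apply; rewrite msuppX mem_head.
by rewrite msuppX inE => /eqP->.
Qed.

Lemma ideal_mulX I mu nu : is_ideal I -> I 'X_[mu] -> I 'X_[mu + nu].
Proof. by case=> _ _ idM Imu; rewrite addmC mpolyXD; apply: idM. Qed.

Section Borel.
Variable I : S -> Prop.
Hypotheses (infK : infinite_field K) (idI : is_ideal I) (bI : borel_fixed I).
Hypothesis satI : saturated I.

(** Moving the whole exponent of the last variable to the other variables shows that
    a power of the irrelevant ideal multiplies the monomial into the ideal. *)
Lemma saturated_last mu : I 'X_[mu + U_(ord_max)] -> I 'X_[mu].
Proof.
move=> Imu; set r := mu ord_max.
pose mu0 : 'X_{1..n.+1} := [multinom (if i == ord_max then 0%N else mu i) | i < n.+1].
have emu : mu = (mu0 + U_(ord_max) *+ r)%MM.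
  apply/mnmP => i; rewrite mnmDE mulmnE mnm1E mnmE eq_sym.
  by case: eqP => [<-|_]; rewrite ?mul1n ?mul0n ?addn0.
have mu0n : mu0 ord_max = 0%N by rewrite mnmE eqxx.
have Ipow (i : 'I_n.+1) : I 'X_[mu + U_(i) *+ r.+1].
  have Imu' : I 'X_[mu0 + U_(ord_max) *+ r.+1].
    by rewrite mulmSr addmA -emu.
  case: (ltnP i n) => [lt_in|le_n]; last first.
    have -> : i = ord_max by apply/val_inj/eqP; rewrite eqn_leq -ltnS ltn_ord.
    by rewrite mulmS addmA; apply: ideal_mulX.
  have := @borel_move K n I i ord_max mu0 r.+1 0 infK idI bI lt_in mu0n isT.
  rewrite bin0 oner_eq0 => /(_ isT Imu'); rewrite subn0 mulm0n addm0 => Ii.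
  by rewrite emu -addmA [(_ *+ r + _)%MM]addmC addmA; apply: ideal_mulX.
apply: (satI (k := (n.+1 * r.+1)%N)) => nu dnu.
have [i le_i] : exists i, (r.+1 <= nu i)%N.
  apply/existsP; apply: contraT; rewrite negb_exists => /forallP small.
  have : (mdeg nu <= n.+1 * r)%N.
    rewrite mdegE -[n.+1 in X in (_ <= X)%N]card_ord -sum_nat_const.
    by apply: leq_sum => i _; have := small i; rewrite -leqNgt.
  by rewrite dnu leq_pmul2l // ltnn.
have -> : nu = (nu - U_(i) *+ r.+1 + U_(i) *+ r.+1)%MM.
  rewrite submK //; apply/mnm_lepP => j; rewrite mulmnE mnm1E.
  by case: eqP => [<-|_]; rewrite ?mul1n ?mul0n.
rewrite -mpolyXD -addmA addmC [(_ *+ _ + _)%MM]addmC; exact: ideal_mulX.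
Qed.

Lemma mon_cons k l : size l = n -> mon n (k :: l) = (mon n (0%N :: l) + U_(ord_max) *+ k)%MM.
Proof.
move=> sz; rewrite -[k :: l]/(raise 0 k (0%N :: l)) mon_raise /= ?sz // subn0.
by congr (_ + U_(_) *+ _)%MM; apply/val_inj; rewrite /= inordK.
Qed.

Lemma staircaseP k l : size l = n -> I 'X_[mon n (k :: l)] <-> ~~ staircase I l.
Proof.
move=> sz; rewrite negbK; split=> [|/asboolP I0].
  move=> Ik; apply/asboolP; elim: k Ik => // k IH.
  by rewrite mon_cons // mulmSr addmA => /saturated_last; rewrite -mon_cons.
by rewrite mon_cons //; apply: ideal_mulX.
Qed.

Lemma staircase_mono f : I f <-> mono_ideal (staircase I) f.
Proof.
rewrite (mono_closedP _ idI (borel_mono_closed infK idI bI)).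
suff E mu : I 'X_[mu] <-> ~~ staircase I (behead (expo mu)).
  by split=> If mu /If; rewrite ?E // -E.
rewrite -{1}[mu]expoK; case: (expo mu) (size_expo mu) => [|k l] //= [sz].
exact: staircaseP.
Qed.

Lemma staircase_good : good n (staircase I).
Proof.
split=> [l j sz lt_j|l i j k sz lt_ij lt_j l_i]; apply: contraTT.
  rewrite -!(staircaseP 0) ?size_raise // => I0.
  rewrite -[0%N :: raise j 1 l]/(raise j.+1 1 (0%N :: l)) mon_raise //= ?sz //.
  exact: ideal_mulX.
rewrite -!(staircaseP 0) ?size_raise //.
rewrite -[0%N :: raise i k l]/(raise i.+1 k (0%N :: l)).
rewrite -[0%N :: raise j k l]/(raise j.+1 k (0%N :: l)).
rewrite !mon_raise /= ?sz //; last by lia.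
move=> Ii; set mu := mon n (0%N :: l) in Ii *.
have := @borel_move K n I (inord (n - j.+1)) (inord (n - i.+1)) mu k 0 infK idI bI.
rewrite bin0 oner_eq0 subn0 mulm0n addm0 => H; apply: H => //.
  rewrite !inordK; lia.
rewrite mnmE inordK; last by lia.
by rewrite subKn //=; lia.
Qed.

End Borel.

(** ** Hilbert functions of monomial ideals *)

(** The monomials outside the ideal give a basis of the quotient.  For an arbitrary
    basis, the matrix of its coefficients at these monomials has independent
    rows and full row space, hence is square. *)
Lemma mono_hilbert I C i h : (forall f, I f <-> mono_ideal C f) ->
  quotient_dim I i h <-> h = hf n C i.
Proof.
move=> IE.
pose ms := [seq mon n ((i - sumn l)%N :: l) | l <- filter C (mons n i)].
have szms : size ms = hf n C i by rewrite size_map size_filter.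
have expo_ms l : l \in filter C (mons n i) ->
    expo (mon n ((i - sumn l)%N :: l)) = (i - sumn l)%N :: l.
  by rewrite mem_filter mem_mons => /and3P[_ /eqP sz _]; rewrite monK //= sz.
have ums : uniq ms.
  rewrite map_inj_in_uniq ?filter_uniq ?uniq_mons // => l1 l2 l1s l2s.
  by move=> /(congr1 (fun mu => behead (expo mu))); rewrite !expo_ms.
have msP mu : mdeg mu = i -> (mu \in ms) = C (behead (expo mu)).
  move=> dmu; have dexpo : sumn (expo mu) = i by rewrite -(mdeg_mon (size_expo mu)) expoK.
  case em : (expo mu) => [|k l]; first by have := size_expo mu; rewrite em.
  have sz : size l = n by have := size_expo mu; rewrite em => -[].
  rewrite em /= in dexpo; apply/mapP/idP => [[l' l's emu]|Cl].
    have := expo_ms _ l's; rewrite -emu em => -[_ ->].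
    by move: l's; rewrite mem_filter => /andP[].
  exists l; first by rewrite mem_filter mem_mons Cl sz eqxx /=; lia.
  by rewrite -[mu]expoK em; congr (mon n (_ :: _)); lia.
have dms mu : mu \in ms -> mdeg mu = i.
  move=> /mapP[l]; rewrite mem_filter mem_mons => /and3P[_ /eqP sz le] ->.
  by rewrite mdeg_mon /= ?sz //; lia.
pose M (t : 'I_(hf n C i)) := nth 0%MM ms t.
have M_in t : M t \in ms by rewrite mem_nth // szms.
have M_inj : injective M.
  by move=> s t /eqP; rewrite nth_uniq ?szms // => /eqP/val_inj.
have IM f : f \is i.-homog -> I f <-> forall t, f@_(M t) = 0.
  move=> /dhomogP hf_; rewrite IE; split=> [If t|f0 mu muf].
    apply/eqP; rewrite mcoeff_eq0; apply/negP => muf.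
    by have := If _ muf; rewrite -msP ?M_in //; apply: dms.
  rewrite -msP; last by apply: hf_.
  apply/negP => mums; have lt_mu : (index mu ms < hf n C i)%N by rewrite -szms index_mem.
  have := f0 (Ordinal lt_mu); rewrite /M /= nth_index // => /eqP.
  by rewrite mcoeff_eq0 muf.
have homogX t : ('X_[M t] : S) \is i.-homog.
  by apply/dhomogP => mu; rewrite msuppX inE => /eqP->; apply: dms.
have homogS k (c : 'I_k -> K) (e : 'I_k -> S) : (forall t, e t \is i.-homog) ->
    \sum_(t < k) c t *: e t \is i.-homog.
  by move=> he; apply: rpred_sum => t _; apply: rpredZ.
split=> [[e [he span indep]]|->]; last first.
  exists (fun t => 'X_[M t]); split=> //= [f hom_f|c].
    exists (fun t => f@_(M t)); apply/IM; first by rewrite rpredB ?homogS.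
    move=> t; rewrite mcoeffB raddf_sum /= (bigD1 t) //= mcoeffZ mcoeffX eqxx mulr1.
    rewrite big1 ?addr0 ?subrr // => s ne; rewrite mcoeffZ mcoeffX.
    by rewrite (inj_eq M_inj) (negPf ne) mulr0.
  move=> /IM c0 t; have := c0 (homogS _ _ _ homogX) t.
  rewrite raddf_sum /= (bigD1 t) //= mcoeffZ mcoeffX eqxx mulr1 big1 ?addr0 // => s ne.
  by rewrite mcoeffZ mcoeffX (inj_eq M_inj) (negPf ne) mulr0.
pose A := \matrix_(k < h, t < hf n C i) (e k)@_(M t).
have AE (c : 'rV_h) t : (c *m A) 0 t = (\sum_(k < h) c 0 k *: e k)@_(M t).
  by rewrite mxE raddf_sum; apply: eq_bigr => k _ /=; rewrite mcoeffZ mxE.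
have rfree : row_free A.
  apply/inj_row_free => c cA0; apply/rowP => k; rewrite mxE.
  apply: (indep (fun k => c 0 k)); apply/IM; first exact: homogS.
  by move=> t; rewrite -AE cA0 mxE.
have rfull : row_full A.
  rewrite -sub1mx; apply/row_subP => t; rewrite rowE mulmx1.
  have [c /IM cP] := span 'X_[M t] (homogX t).
  apply/submxP; exists (\row_k c k); apply/rowP => s; rewrite AE.
  have := cP _ s; rewrite mcoeffB mcoeffX => /(_ _)/eqP; rewrite subr_eq0 => H.
  under eq_bigr => k _ do rewrite mxE.
  rewrite -(eqP (H _)); last by rewrite rpredB ?homogS.
  by rewrite mxE eqxx (inj_eq M_inj) eq_sym.
by rewrite -(eqP (rfree : \rank A == h)) -[RHS](eqP (rfull : \rank A == _)).
Qed.

(** ** Strongly stable ideals are Borel-fixed *)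

Lemma mono_ideal_ideal C : order_ideal n C -> is_ideal (@mono_ideal K n C).
Proof.
move=> idC; split=> [mu|f g If Ig mu|f g Ig mu].
- by rewrite msupp0.
- by move=> /msuppD_le; rewrite mem_cat => /orP[/If|/Ig].
move=> /msuppM_le/allpairsP[[m1 m2] /= [_ m2g ->]].
have szb (nu : 'X_{1..n.+1}) : size (behead (expo nu)) = n by rewrite size_behead size_expo.
apply: contra (Ig _ m2g); apply: (ideal_divides idC (szb _) (szb _)).
by move=> j; rewrite !nth_behead; apply: expoD.
Qed.

Lemma mono_ideal_homogeneous C : order_ideal n C ->
  homogeneous_ideal (@mono_ideal K n C).
Proof.
move=> idC; split=> [|f d If mu]; first exact: mono_ideal_ideal.
rewrite pihomogE mcoeff_msupp raddf_sum /= => nz; apply: If.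
apply: contraNT nz => nmu; rewrite big_seq_cond big1 // => nu /andP[nuf _].
rewrite mcoeffZ mcoeffX; case: eqP nmu => [<-|_]; first by rewrite nuf.
by rewrite mulr0.
Qed.

Lemma expo_add (i : 'I_n.+1) mu : expo (mu + U_(i))%MM = raise (n - i) 1 (expo mu).
Proof.
rewrite -[RHS](@monK n) ?size_raise ?size_expo //; congr expo.
rewrite mon_raise ?size_expo ?ltnS ?leq_subr // expoK mulm1n; congr (_ + U_(_))%MM.
by apply/val_inj; rewrite /= inordK ?subKn //; have := ltn_ord i; lia.
Qed.

Lemma mono_ideal_saturated C : saturated (@mono_ideal K n C).
Proof.
move=> f k fk mu muf; have := fk (U_(ord_max) *+ k)%MM.
rewrite mdegMn mdeg1 mul1n => /(_ erefl (U_(ord_max) *+ k + mu)%MM).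
rewrite mcoeff_msupp (mulrC 'X_[_]) mcoeffMX -mcoeff_msupp => /(_ muf).
rewrite addmC.
suff -> : behead (expo (mu + U_(ord_max) *+ k)%MM) = behead (expo mu) by [].
elim: k {fk} => [|k IH]; first by rewrite mulm0n addm0.
by rewrite mulmSr addmA expo_add /= subnn -[RHS]IH; case: (expo _).
Qed.

Lemma mx_act_var (g : 'M[K]_n.+1) j : mx_act g 'X_j = \sum_(i < n.+1) g i j *: 'X_i.
Proof. by rewrite /mx_act comp_mpolyXU -tnth_nth tnth_mktuple. Qed.

Lemma mx_actM (g : 'M[K]_n.+1) f1 f2 : mx_act g (f1 * f2) = mx_act g f1 * mx_act g f2.
Proof. by rewrite /mx_act rmorphM. Qed.

Lemma mx_act_comp (g h : 'M[K]_n.+1) f : mx_act g (mx_act h f) = mx_act (g *m h) f.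
Proof.
rewrite {2}/mx_act [in LHS]comp_mpolyEX [RHS]comp_mpolyEX {1}/mx_act raddf_sum /=.
apply: eq_bigr => mu _; rewrite comp_mpolyZ; congr (_ *: _).
rewrite !comp_mpolyX rmorph_prod; apply: eq_bigr => j _; rewrite /= rmorphXn /=.
congr (_ ^+ _); rewrite !tnth_mktuple raddf_sum /=.
under eq_bigr => i _ do
  rewrite comp_mpolyZ -[_ \mPo _]/(mx_act g 'X_i) mx_act_var scaler_sumr.
rewrite exchange_big; apply: eq_bigr => k _ /=; rewrite mxE scaler_suml.
by apply: eq_bigr => i _; rewrite scalerA mulrC.
Qed.

Lemma mx_act1 f : mx_act 1%:M f = f :> S.
Proof.
rewrite /mx_act -[RHS]comp_mpoly_id; congr (_ \mPo _).
apply: eq_from_tnth => j; rewrite !tnth_mktuple (bigD1 j) //= mxE eqxx scale1r.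
by rewrite big1 ?addr0 // => i /negPf ne; rewrite mxE ne scale0r.
Qed.

Lemma upper_inv (g : 'M[K]_n.+1) : g \in unitmx -> upper_triangular g ->
  upper_triangular (invmx g).
Proof.
move=> gu gt i j; have := gu; rewrite upper_unit // => /forallP gii.
have [k le_k] := ubnP j; elim: k j le_k => // k IH j le_k lt_ji.
have := congr1 (fun A : 'M_n.+1 => A i j) (mulVmx gu); rewrite !mxE (bigD1 j) //=.
have -> : (i == j) = false by apply/eqP => e; rewrite e ltnn in lt_ji.
rewrite big1 ?addr0 => [/eqP|l ne].
  by rewrite mulf_eq0 (negPf (gii j)) orbF => /eqP.
case: (ltngtP j l) ne => [lt_jl|lt_lj|/val_inj->]; last by rewrite eqxx.
  by rewrite gt ?mulr0.
by rewrite IH ?mul0r //; [move: le_k; lia | exact: ltn_trans lt_ji].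
Qed.

Lemma preserved_borel I :
  (forall g, g \in unitmx -> upper_triangular g -> forall f, I f -> I (mx_act g f)) ->
  borel_fixed I.
Proof.
move=> pres g gu gt f; split=> [[f0 If0 ->]|If]; first exact: pres.
exists (mx_act (invmx g) f); last by rewrite mx_act_comp mulmxV // mx_act1.
by apply: pres; rewrite ?unitmx_inv //; apply: upper_inv.
Qed.

(** One variable of [mu] at a time: it is sent to a combination of earlier variables,
    and replacing it by an earlier one stays in the ideal. *)
Lemma stable_act C (g : 'M[K]_n.+1) mu nu : stable n C -> upper_triangular g ->
  mono_ideal C ('X_[nu + mu] : S) -> mono_ideal C ('X_[nu] * mx_act g 'X_[mu]).
Proof.
move=> stC gt; have idI := mono_ideal_ideal (proj1 stC).
have [d] := ubnP (mdeg mu); elim: d mu nu => // d IH mu nu le_d Imu.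
case: (eqVneq mu 0%MM) => [mu0|mu_n0].
  rewrite mu0 mpolyX0 /mx_act comp_mpoly1 mulr1; by rewrite mu0 addm0 in Imu.
have [j mu_j] : exists j, mu j != 0%N.
  apply/existsP; apply: contraR mu_n0; rewrite negb_exists => /forallP mu0.
  by apply/eqP/mnmP => i; rewrite mnm0E; apply/eqP; have := mu0 i; rewrite negbK.
set mu' := (mu - U_(j))%MM.
have emu : mu = (U_(j) + mu')%MM.
  rewrite addmC submK //; apply/mnm_lepP => i; rewrite mnm1E.
  by case: eqP => [<-|] //; rewrite lt0n.
rewrite emu mpolyXD mx_actM mx_act_var mulr_suml mulr_sumr.
apply: ideal_sum => [|i _]; first exact: idI. rewrite -scalerAl -scalerAr.
case: (ltnP j i) => [/gt->|le_ij]; first by rewrite scale0r; case: idI.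
apply: (ideal_scale _ idI); rewrite mulrA -mpolyXD; apply: IH.
  by move: le_d; rewrite emu mdegD mdeg1; lia.
move/mono_idealX: Imu => nC; apply/mono_idealX; apply: contra nC.
rewrite emu addmA -[(nu + U_(i) + _)%MM]addmA [(U_(i) + _)%MM]addmC.
rewrite -[(nu + U_(j) + _)%MM]addmA [(U_(j) + _)%MM]addmC !addmA !expo_add.
case: (ltngtP i j) le_ij => // [lt_ij _|/val_inj->//].
have [_ stC'] := cone_stable stC; apply: stC'; rewrite ?size_expo //.
  by have := ltn_ord j; lia.
by have := ltn_ord i; lia.
Qed.

Lemma stable_borel C : stable n C -> borel_fixed (@mono_ideal K n C).
Proof.
move=> stC; apply: preserved_borel => g _ gt f If.
rewrite /mx_act comp_mpolyEX.
apply: (@ideal_sum K n) => [|mu muf].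
  exact: mono_ideal_ideal (proj1 stC).
apply: (ideal_scale _ (mono_ideal_ideal (proj1 stC))).
rewrite -[_ \mPo _]mul1r -mpolyX0; apply: stable_act => //.
by rewrite add0m; apply/mono_idealX/If.
Qed.

End Staircase.

(** * Gotzmann partitions *)

Local Open Scope nat_scope.

(** The decreasing sequence with [nth 0 a i] parts equal to [i]. *)
Fixpoint parts (a : seq nat) : seq nat :=
  if a is e :: a' then map S (parts a') ++ nseq e 0 else [::].

Lemma size_parts a : size (parts a) = sumn a.
Proof. by elim: a => //= e a IH; rewrite size_cat size_map size_nseq IH addnC. Qed.

Lemma count_parts a i : count_mem i (parts a) = nth 0 a i.
Proof.
elim: a i => [|e a IH] [|i] //=; rewrite count_cat count_nseq count_map /=.
  by rewrite (@eq_count _ _ pred0) ?count_pred0 ?mul1n.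
by rewrite (@eq_count _ _ (pred1 i)) ?IH ?mul0n ?addn0.
Qed.

Lemma geq_trans : transitive geq.
Proof. by move=> x y z /= le1 le2; apply: leq_trans le2 le1. Qed.

Lemma sorted_parts a : sorted geq (parts a).
Proof.
rewrite sorted_pairwise; last exact: geq_trans.
elim: a => //= e a IH; rewrite pairwise_cat pairwise_map IH /=; apply/andP; split.
  by apply/allrelP => x y _; rewrite mem_nseq => /andP[_ /eqP->].
by elim: e => //= e ->; rewrite andbT; apply/allP => x; rewrite mem_nseq => /andP[_ /eqP->].
Qed.

Lemma parts_counts b n : sorted geq b -> all (fun x => x < n) b ->
  parts (mkseq (fun i => count_mem i b) n) = b.
Proof.
move=> sb lt_b; apply: (@sorted_eq _ geq) (sorted_parts _) sb _.
- exact: geq_trans.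
- by move=> x y /andP[le1 le2]; apply/eqP; rewrite eqn_leq; apply/andP.
apply/allP => i _ /=; rewrite count_parts.
case: (ltnP i n) => [lt_i|le_i]; first by rewrite nth_mkseq.
rewrite nth_default ?size_mkseq // eq_sym; apply/eqP/count_memPn.
by apply/negP => /(allP lt_b); rewrite ltnNge le_i.
Qed.

Lemma parts_zeros k : parts (nseq k 0) = [::].
Proof. by elim: k => //= k ->. Qed.

Lemma parts_cat a1 a2 :
  parts (a1 ++ a2) = map (addn (size a1)) (parts a2) ++ parts a1.
Proof.
elim: a1 => [|e a1 IH] /=; first by rewrite cats0 map_id_in.
by rewrite IH map_cat -catA -map_comp.
Qed.

(** The number of monomials of degree at most [l - j] in [c] variables.  Prolonging
    the binomial coefficient by 0 for small [l] makes the formula for the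
    Hilbert function of the lexicographic ideal valid in every degree. *)
Definition strip c j l := if j <= l then 'C(l - j + c, c) else 0.

Lemma sum_strip c j i : \sum_(l < i.+1) strip c j l = strip c.+1 j i.
Proof.
elim: i => [|i IH]; first by rewrite big_ord1 /strip; case: j => [|j]; rewrite /= ?subn0 ?add0n ?binn.
rewrite big_ord_recr /= IH /strip; case: (leqP j i) => [le_j|lt_i].
  by rewrite leqW // subSn // !addSn !addnS [RHS]binS.
case: (leqP j i.+1) => // le_j; have -> : j = i.+1 by lia.
by rewrite subnn !add0n !binn.
Qed.

Lemma HL_parts a i :
  HL a i = \sum_(0 <= j < size (parts a)) strip (nth 0 (parts a) j) j i.
Proof.
elim: a i => [|e a IH] i; first by rewrite big_geq.
rewrite HL_cons /= size_cat size_map size_nseq (@big_cat_nat _ _ _ (size (parts a))) ?leq_addr //=.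
congr (_ + _).
  under eq_bigr => l _ do rewrite IH big_mkord.
  rewrite exchange_big big_mkord; apply: eq_bigr => j _.
  by rewrite sum_strip nth_cat size_map ltn_ord (nth_map 0).
rewrite -{1}[size (parts a)]add0n big_addn addKn big_mkord size_parts.
rewrite -[LHS](minn_idPl (_ : _ <= e)) ?geq_minl // -sum_ltn_min.
apply: eq_bigr => j _; rewrite nth_cat size_map size_parts.
have -> : (j + sumn a < sumn a) = false by lia.
rewrite addnK.
rewrite nth_nseq ltn_ord /strip bin0; have lt_j := ltn_ord j.
by case: (leqP (j + sumn a) i) => le_j; lia.
Qed.

Import Order.TTheory GRing.Theory Num.Theory.
Local Open Scope ring_scope.

Lemma binom_poly_prod (c : int) (d : nat) :
  \prod_(k < d) ('X + ((c - k%:Z)%:~R)%:P : {poly rat}) =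
  \prod_(x <- [seq - ((c - (k : nat)%:Z)%:~R : rat) | k <- iota 0 d]) ('X - x%:P).
Proof.
rewrite big_map -(big_mkord xpredT (fun k : nat => 'X + ((c - k%:Z)%:~R)%:P)).
rewrite /index_iota subn0; apply: eq_bigr => k _.
by rewrite polyCN opprK.
Qed.

Lemma coef_binom_poly (c : int) (d d1 : nat) : (d <= d1)%N ->
  (binom_poly c d)`_d1 = if d == d1 then (d`!%:R)^-1 else 0.
Proof.
move=> le_d; rewrite coefZ binom_poly_prod.
set P := \prod_(x <- _) _; have szP : size P = d.+1.
  by rewrite size_prod_XsubC size_map size_iota.
case: (ltngtP d d1) le_d => // [lt_d|<-] _.
  by rewrite nth_default ?mulr0 // szP.
have : P \is monic by apply: monic_prod_XsubC.
by move/monicP; rewrite /lead_coef szP => ->; rewrite mulr1.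
Qed.

(** All summands of degree [part b 1] have positive leading coefficient. *)
Lemma gotzmann_head p b : gotzmann_partition p b -> (part b 1 <= (size p).-1)%N.
Proof.
case=> sz_b sb ->; set q := \sum_(_ <= _ < _) _.
have le_b1 j : (1 <= j < (size b).+1)%N -> (part b j <= part b 1)%N.
  move=> /andP[j_gt0 lt_j]; rewrite /part /=; have j1 : (j.-1 < size b)%N by lia.
  case: b sb sz_b j1 {q lt_j} => // x b sb _; case: (j.-1) => [|i] //= lt_i.
  by have /allP := order_path_min geq_trans sb; apply; apply: mem_nth.
have qE : q`_(part b 1) = \sum_(1 <= j < (size b).+1)
    (if part b j == part b 1 then ((part b 1)`!%:R)^-1 else 0).
  rewrite coef_sum big_nat [RHS]big_nat; apply: eq_bigr => j /le_b1 le_j.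
  by rewrite coef_binom_poly //; case: eqP => [->|].
have inv_gt0 : (0 : rat) < ((part b 1)`!%:R)^-1 by rewrite invr_gt0 ltr0n fact_gt0.
have : q`_(part b 1) != 0.
  rewrite qE big_ltn // eqxx gt_eqF // ltr_wpDr // big_nat sumr_ge0 // => j _.
  by case: ifP => // _; apply: ltW.
apply: contraR; rewrite -ltnNge => lt; apply/eqP/nth_default.
by move: lt; case: (size q).
Qed.

Lemma binom_poly_eval (c j i : nat) : (j < i)%N ->
  (binom_poly (c%:Z - j.+1%:Z + 1) c).[i%:R] = (strip c j i)%:R.
Proof.
move=> lt_ji; rewrite /strip ltnW // hornerZ horner_prod.
set N := (i - j + c)%N.
have -> : \prod_(k < c) ('X + ((c%:Z - j.+1%:Z + 1 - k%:Z)%:~R)%:P).[i%:R] =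
    (N ^_ c)%:R :> rat.
  rewrite ffact_prod natr_prod; apply: eq_bigr => k _.
  rewrite hornerD hornerX hornerC !pmulrn -intrD; congr (_%:~R).
  by have := ltn_ord k; rewrite /N; lia.
rewrite -bin_ffact natrM mulrCA mulVf ?mulr1 // pnatr_eq0 -lt0n fact_gt0 //.
Qed.

Lemma gotzmann_eval p b (i : nat) : gotzmann_partition p b -> (size b < i)%N ->
  p.[i%:R] = (\sum_(0 <= j < size b) strip (nth 0%N b j) j i)%:R.
Proof.
case=> _ _ -> lt_i; rewrite horner_sum natr_sum big_add1 /= !big_nat.
apply: eq_bigr => j /andP[_ lt_j]; rewrite /part /=.
by apply: binom_poly_eval; apply: ltn_trans lt_i.
Qed.

(** * Points of the Hilbert scheme *)

Local Open Scope ring_scope.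

Section HilbertPoints.
Variables (K : fieldType) (n : nat) (p : {poly rat}) (a : seq nat).
Local Notation S := {mpoly K[n.+1]}.
Local Notation point := (@borel_fixed_point K n p).
Hypotheses (infK : infinite_field K) (sz_a : size a = n).
Hypothesis pE : forall i : nat, (sumn a < i)%N -> p.[i%:R] = (HL a i)%:R.

Lemma mono_point C : order_ideal n C -> borel_fixed (@mono_ideal K n C) ->
  evtype n C a -> point (@mono_ideal K n C).
Proof.
move=> idC bC [_ [i0 eqh]]; split=> //.
- exact: mono_ideal_homogeneous.
- exact: mono_ideal_saturated.
exists (maxn i0 (sumn a).+1) => i; rewrite geq_max => /andP[/eqh eqi lt_i].
exists (hf n C i); first by apply/(mono_hilbert _ _ (fun f => iff_refl _)).
by rewrite pE // eqi.
Qed.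

Lemma stable_point C : stable n C -> evtype n C a -> point (@mono_ideal K n C).
Proof.
move=> stC evC; apply: mono_point => //; first exact: proj1 stC.
exact: stable_borel.
Qed.

Lemma point_staircase (I : S -> Prop) : point I ->
  [/\ good n (staircase I), evtype n (staircase I) a
    & forall f, I f <-> mono_ideal (staircase I) f].
Proof.
case=> [[idI _] satI [i0 hI] bI]; have IE := staircase_mono infK idI bI satI.
split=> //; first exact: staircase_good.
split=> //; exists (maxn i0 (sumn a).+1) => i; rewrite geq_max => /andP[/hI[h hq hp] lt_i].
apply/eqP; rewrite -(eqr_nat rat) -pE // hp.
by move/(mono_hilbert _ _ IE): hq => ->.
Qed.

Lemma mono_same C D : (forall l, size l = n -> C l = D l) ->
  same_set (@mono_ideal K n C) (mono_ideal D).
Proof.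
move=> eqCD f; have sz mu : size (behead (expo (n := n) mu)) = n.
  by rewrite size_behead size_expo.
by split=> H mu /H; rewrite eqCD.
Qed.

Lemma mono_diff C D l : size l = n -> C l != D l ->
  ~ same_set (@mono_ideal K n C) (mono_ideal D).
Proof.
move=> sz ne eqI; have := eqI 'X_[mon n (0%N :: l)].
rewrite !mono_idealX monK /= ?sz // => -[CD DC].
by case/eqP: ne; apply/idP/idP => H; apply: contraLR H; [apply: DC | apply: CD].
Qed.

Lemma same_set_trans (I J L : S -> Prop) : same_set I J -> same_set J L -> same_set I L.
Proof. by move=> e1 e2 f; rewrite e1. Qed.

Lemma same_set_sym (I J : S -> Prop) : same_set I J -> same_set J I.
Proof. by move=> e f; rewrite e. Qed.

Lemma exactly_two_points C1 C2 l : stable n C1 -> stable n C2 ->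
  evtype n C1 a -> evtype n C2 a -> size l = n -> C1 l != C2 l ->
  (forall I, point I -> (forall m, size m = n -> staircase I m = C1 m) \/
     (forall m, size m = n -> staircase I m = C2 m)) ->
  exactly_two_ideals point.
Proof.
move=> st1 st2 ev1 ev2 sz ne only.
exists (@mono_ideal K n C1), (@mono_ideal K n C2); split=> [|||L pL].
- exact: stable_point.
- exact: stable_point.
- exact: mono_diff ne.
have [_ _ LE] := point_staircase pL.
by case: (only L pL) => /mono_same eqL; [left|right]; apply: same_set_trans eqL.
Qed.

Lemma unique_not_two C1 :
  (forall I, point I -> forall m, size m = n -> staircase I m = C1 m) ->
  ~ exactly_two_ideals point.
Proof.
move=> only [I [J [pI pJ nIJ _]]]; apply: nIJ.
have [_ _ IE] := point_staircase pI; have [_ _ JE] := point_staircase pJ.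
have eqI := mono_same (only I pI); have eqJ := mono_same (only J pJ).
by move=> f; rewrite IE eqI -eqJ -JE.
Qed.

Lemma three_not_two C1 C2 C3 l12 l13 l23 :
  point (@mono_ideal K n C1) -> point (@mono_ideal K n C2) ->
  point (@mono_ideal K n C3) ->
  size l12 = n -> size l13 = n -> size l23 = n ->
  C1 l12 != C2 l12 -> C1 l13 != C3 l13 -> C2 l23 != C3 l23 ->
  ~ exactly_two_ideals point.
Proof.
move=> p1 p2 p3 s12 s13 s23 /(mono_diff s12) n12 /(mono_diff s13) n13.
move=> /(mono_diff s23) n23 [I [J [_ _ _ only]]].
have join L1 L2 L : same_set (L1 : S -> Prop) L -> same_set L2 L -> same_set L1 L2.
  by move=> e1 e2; apply: same_set_trans e1 (same_set_sym e2).
case: (only _ p1) => e1; case: (only _ p2) => e2; case: (only _ p3) => e3;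
by [ case: n12; apply: join e1 e2 | case: n13; apply: join e1 e3
   | case: n23; apply: join e2 e3 ].
Qed.

End HilbertPoints.

(** ** Characteristic of the field and the plane *)

(** The coefficient 2 of the mixed term of the square of a sum is invertible. *)
Lemma point_odd (K : fieldType) (p : {poly rat}) (I : {mpoly K[3]} -> Prop) :
  infinite_field K -> borel_fixed_point p I -> 2%N \notin [pchar K] ->
  staircase I [:: 1; 1]%N -> staircase I [:: 2; 0]%N.
Proof.
move=> infK [[idI _] satI _ bI] ch; apply: contraTT.
rewrite -!(staircaseP infK idI bI satI 0) // => I20.
have e20 : mon 2 [:: 0; 2; 0]%N = (0 + U_(inord 1) *+ 2)%MM.
  apply/mnmP => -[i lt_i]; rewrite mnmE mnmDE mulmnE mnm1E mnm0E -val_eqE /= inordK //.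
  by case: i lt_i => [|[|[|]]].
have := @borel_move K 2 I ord0 (inord 1) 0%MM 2 1 infK idI bI.
rewrite inordK // -e20 mnm0E => H.
have -> : mon 2 [:: 0; 1; 1]%N = (0 + U_(ord0) *+ (2 - 1) + U_(inord 1) *+ 1)%MM.
  apply/mnmP => -[i lt_i]; rewrite mnmE !mnmDE !mulmnE !mnm1E mnm0E -!val_eqE /= inordK //.
  by case: i lt_i => [|[|[|]]].
by apply: H => //; rewrite bin1; move: ch; rewrite inE.
Qed.

Definition square l := (nth 0%N l 0 < 2)%N && (nth 0%N l 1 < 2)%N.

Lemma square_ideal : order_ideal 2 square.
Proof.
move=> [|x [|y []]] // [|[|]] // _ _; rewrite /square /= => /andP[lt_x lt_y].
  by rewrite lt_y (leq_ltn_trans _ lt_x) ?leq_addr.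
by rewrite lt_x (leq_ltn_trans _ lt_y) ?leq_addr.
Qed.

Lemma square_expo mu : square (behead (@expo 2 mu)) =
  (mu (inord 1) < 2)%N && (mu ord0 < 2)%N.
Proof.
have e1 : nth 0%N (expo mu) 1 = mu (inord 1).
  by have := nth_expo mu (inord 1); rewrite inordK.
have e0 : nth 0%N (expo mu) 2 = mu ord0 by have := nth_expo mu ord0.
by rewrite /square !nth_behead e1 e0.
Qed.

(** By Frobenius a square of a linear form is a combination of squares of variables. *)
Lemma square_borel (K : fieldType) : 2%N \in [pchar K] ->
  borel_fixed (@mono_ideal K 2 square).
Proof.
move=> chK; have idI := mono_ideal_ideal K square_ideal.
have ch : 2%N \in [pchar {mpoly K[3]}].
  by rewrite inE /= -mpolyC_nat (pcharf0 chK) mpolyC0.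
apply: preserved_borel => g _ gt f If.
rewrite /mx_act comp_mpolyEX; apply: (@ideal_sum K 2) => // mu muf.
apply: (ideal_scale _ idI); rewrite -[_ \mPo _]/(mx_act g 'X_[mu]).
have [j le_j mu_j] : exists2 j : 'I_3, (j <= 1)%N & (2 <= mu j)%N.
  have := If _ muf; rewrite square_expo negb_and -!leqNgt => /orP[le2|le2].
    by exists (inord 1); rewrite ?inordK.
  by exists ord0.
have -> : mu = (mu - U_(j) *+ 2 + U_(j) *+ 2)%MM.
  rewrite submK //; apply/mnm_lepP => i; rewrite mulmnE mnm1E.
  by case: eqP => [<-|_]; rewrite ?mul1n ?mul0n.
rewrite mpolyXD -mpolyXn mx_actM expr2 mx_actM -expr2.
case: (idI) => id0 _ idM; apply: idM; rewrite mx_act_var.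
rewrite -[_ ^+ 2]/(pFrobenius_aut ch _) rmorph_sum.
apply: (@ideal_sum K 2) => // i _; rewrite /= pFrobenius_autE exprZn.
case: (ltnP j i) => [/gt->|le_ij]; first by rewrite expr0n scale0r.
apply: (ideal_scale _ idI); rewrite mpolyXn; apply/mono_idealX.
rewrite square_expo !mulmnE !mnm1E negb_and -!leqNgt -!val_eqE /= inordK //.
by case: i le_ij (leq_trans le_ij le_j) => -[|[|]].
Qed.

(** * The classification *)

Local Open Scope nat_scope.

Lemma last_nonzero (l : seq nat) : 0 < sumn l ->
  exists lo w z, l = lo ++ w :: nseq z 0 /\ 0 < w.
Proof.
elim: l => [|x l IH] //= s_gt0; case: (posnP (sumn l)) => [s0|/IH[lo [w [z [-> w_gt0]]]]].
  by exists [::], x, (size l); rewrite /= -(sumn0_zeros s0); split=> //; lia.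
by exists (x :: lo), w, z.
Qed.

Lemma two_rows_gt a u e1 e2 k m : lexlt a m ->
  two_rows a u e1 e2 (k :: m) = (m == u) && (k < e1).
Proof.
by move=> lt; rewrite /= (negPf (lexlt_gt lt)) eq_sym (negPf (lexlt_neq lt)).
Qed.

Lemma lex_gt a e k m : lexlt a m -> lexlt (k :: m) (e :: a) = false.
Proof.
by move=> lt; rewrite /= (negPf (lexlt_gt lt)) eq_sym (negPf (lexlt_neq lt)).
Qed.

Lemma unit_last q : unit q.+1 q = nseq q 0 ++ [:: 1].
Proof. by rewrite (unit_cat q 0) addn1. Qed.

Lemma unit_lt_rcons lo w : 0 < w -> 2 <= sumn lo + w ->
  lexlt (unit (size lo).+1 (size lo)) (rcons lo w).
Proof.
move=> w_gt0 ge2; rewrite unit_last -cats1.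
case: w w_gt0 ge2 => [|[|w]] // _ ge2; last by rewrite lexlt_cat_hi ?size_nseq.
by rewrite lexlt_cat_same ?size_nseq // lexlt_zerosl; lia.
Qed.

Lemma split_stable lo w h hi e1 e2 : 0 < w ->
  2 <= sumn lo + w \/ e1 <= e2 ->
  stable (size (rcons lo w ++ h :: hi)).+1
    (two_rows (rcons lo w ++ h :: hi) (nseq (size lo).+1 0 ++ h.+1 :: hi) e1 e2).
Proof.
move=> w_gt0 cond; rewrite -(size_rcons lo w); apply: stable_two_rows; right.
rewrite size_rcons; split=> //=.
case: (leqP 2 (sumn lo + w)) cond => [ge2 _|lt2 [//|le_e]].
- by left; apply: unit_lt_rcons.
right; split=> //; rewrite unit_last -cats1 {2}(sumn0_zeros (_ : sumn lo = 0)); last by lia.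
by congr (_ ++ [:: _]); lia.
Qed.

(** Besides [a], the generator that may be altered is a variable. *)
Lemma linear_stable n lo w z e1 e2 : size (lo ++ w :: nseq z.+1 0) = n -> 0 < w ->
  2 <= sumn lo + w \/ e1 <= e2 ->
  stable n.+1 (two_rows (lo ++ w :: nseq z.+1 0) (unit n (size lo).+1) e1 e2).
Proof.
move=> sz w_gt0 cond; rewrite (unit_q sz) size_rcons a_rcons -sz.
by have := split_stable 0 (nseq z 0) w_gt0 cond; rewrite cat_rcons.
Qed.

Lemma top_stable (a : seq nat) x e1 e2 : e1 < e2 ->
  stable (size (x :: a)).+1 (two_rows (x :: a) (x.+1 :: a) e1 e2).
Proof. by move=> lt_e; apply: (@stable_two_rows [::]); left. Qed.

(** The monomials of degree at most 1 in three variables. *)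
Definition star n : seq (seq nat) := [:: nseq n 0; unit n 0; unit n 1; unit n 2].

Lemma uniq_star n : 2 < n -> uniq (star n).
Proof. by case: n => [|[|[|n]]] //= _; rewrite !inE !eqseq_cons /= !andbF. Qed.

Lemma star_stable n : 2 < n -> stable n (mem (star n)).
Proof.
move=> n_gt2.
have low m j : size m = n -> j < n -> raise j 1 m \in star n -> m = nseq n 0.
  move=> sz lt_j ms; rewrite -sz; apply: sumn0_zeros.
  have: sumn (raise j 1 m) <= 1.
    by move: ms; rewrite !inE => /or4P[]/eqP->; rewrite ?sumn_zeros // sumn_unit //; lia.
  by rewrite sumn_raise ?sz; lia.
have unit_star j : j < n -> (unit n j \in star n) = (j <= 2).
  move=> lt_j; rewrite !inE; apply/idP/idP; last first.
    by case: j lt_j => [|[|[|j]]] //; rewrite eqxx ?orbT.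
  case/or4P => /eqP; try by move/(unit_inj lt_j)->.
  by move/(congr1 sumn); rewrite sumn_unit ?sumn_zeros.
split=> [m j sz lt_j /(low _ _ sz lt_j)->|m i j sz lt_ij lt_j ms]; first exact: mem_head.
have em := low _ _ sz lt_j ms.
have uj : unit n j \in star n by rewrite /unit -em.
have : unit n i \in star n.
  by move: uj; rewrite !unit_star //; lia.
by rewrite /unit -em.
Qed.

Lemma star_type n : 1 < n -> evtype n.+1 (mem (star n.+1)) (4 :: nseq n 0).
Proof.
move=> n_gt1; split; first by rewrite /= size_nseq.
exists 3 => i le_i; rewrite /= size_nseq HL_points.
rewrite (@hf_size n.+1 _ i (star n.+1)) ?uniq_star //; first by rewrite /=; lia.
move=> m; rewrite !inE => /or4P[]/eqP->;
  by rewrite ?size_nseq ?size_unit ?sumn_zeros ?sumn_unit //; lia.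
Qed.

Lemma square_type : evtype 2 square [:: 4; 0].
Proof.
split=> //; exists 3 => i le_i; rewrite (HL_points 4 1 i).
rewrite (@hf_size 2 _ i [:: [:: 0; 0]; [:: 1; 0]; [:: 0; 1]; [:: 1; 1]]) //.
- by rewrite /=; lia.
- by case=> [|[|[|x]] [|[|[|y]] []]] //= _ _; rewrite /square /= ?andbF.
by move=> m; rewrite !inE => /or4P[]/eqP->; rewrite /=; lia.
Qed.

Section Cases.
Variables (K : fieldType) (n e : nat) (p : {poly rat}) (a : seq nat).
Local Notation point := (@borel_fixed_point K n.+1 p).
Hypotheses (infK : infinite_field K) (sz_a : size a = n).
Hypothesis pE : forall i : nat, (sumn (e :: a) < i)%N ->
  (p.[i%:R] = (HL (e :: a) i)%:R)%R.

Let sz_ea : size (e :: a) = n.+1.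
Proof. by rewrite /= sz_a. Qed.

Let lex_st : stable n.+1 (lexlt^~ (e :: a)).
Proof. by rewrite -sz_ea; apply: lex_stable. Qed.

Let lex_ev : evtype n.+1 (lexlt^~ (e :: a)) (e :: a).
Proof. by rewrite -sz_ea; apply: lex_type. Qed.

Let goodI (I : {mpoly K[n.+2]} -> Prop) : point I ->
  good n.+1 (staircase I) /\ evtype n.+1 (staircase I) (e :: a).
Proof. by move=> pI; have [] := point_staircase infK sz_ea pE pI. Qed.

Let stP C : stable n.+1 C -> evtype n.+1 C (e :: a) -> point (@mono_ideal K n.+1 C).
Proof. exact: stable_point. Qed.

Lemma no_zero_part : e = 0 -> ~ exactly_two_ideals point.
Proof.
move=> e0; apply: (unique_not_two infK sz_ea pE (C1 := lexlt^~ (e :: a))) => I /goodI[gI].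
by rewrite e0 => evI m; apply: type0_lex.
Qed.

Lemma two_rows_typeE u e1 e2 : size u = n -> lexlt a u -> e1 + e2 = e ->
  evtype n.+1 (two_rows a u e1 e2) (e :: a).
Proof. by move=> sz_u lt <-; apply: two_rows_type. Qed.

(** The lexicographic ideal contains all multiples of [u] and of [u']. *)
Lemma three_rows u e1 e2 u' e1' e2' l23 : size u = n -> lexlt a u ->
  size u' = n -> lexlt a u' -> 0 < e1 -> 0 < e1' -> e1 + e2 = e -> e1' + e2' = e ->
  stable n.+1 (two_rows a u e1 e2) -> stable n.+1 (two_rows a u' e1' e2') ->
  size l23 = n.+1 -> two_rows a u e1 e2 l23 != two_rows a u' e1' e2' l23 ->
  ~ exactly_two_ideals point.
Proof.
move=> szu ltu szu' ltu' e_gt0 e'_gt0 ee ee' st st' sz23 ne.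
apply: (@three_not_two K n.+1 p (lexlt^~ (e :: a)) (two_rows a u e1 e2)
  (two_rows a u' e1' e2') (0 :: u) (0 :: u') l23) => //.
- exact: stP.
- by apply: stP => //; apply: two_rows_typeE.
- by apply: stP => //; apply: two_rows_typeE.
- by rewrite /= szu.
- by rewrite /= szu'.
- by rewrite lex_gt // two_rows_gt // eqxx e_gt0.
- by rewrite lex_gt // two_rows_gt // eqxx e'_gt0.
Qed.

(** ** Finite schemes *)

Section Finite.
Hypotheses (a0 : a = nseq n 0) (n_gt0 : 0 < n).

Let lt0 (u : seq nat) : size u = n -> 0 < sumn u -> lexlt a u.
Proof. by move=> szu s_gt0; rewrite a0 -szu lexlt_zerosl. Qed.

Lemma finite_small : e <= 2 -> ~ exactly_two_ideals point.
Proof.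
move=> le2; apply: (unique_not_two infK sz_ea pE (C1 := lexlt^~ (e :: a))) => I /goodI[gI].
by rewrite a0 => evI; apply: points_small_lex.
Qed.

Let szu1 : size (unit n 0) = n. Proof. exact: size_unit. Qed.
Let ltu1 : lexlt a (unit n 0).
Proof. by apply: lt0; rewrite ?sumn_unit. Qed.

Lemma unit_top_stable e1 e2 : e1 < e2 -> stable n.+1 (two_rows a (unit n 0) e1 e2).
Proof.
rewrite a0; case: n n_gt0 => // n' _ lt.
by have := top_stable (nseq n' 0) 0 lt; rewrite /= size_nseq.
Qed.

Lemma finite3 : e = 3 -> exactly_two_ideals point.
Proof.
move=> e3; apply: (@exactly_two_points _ _ _ _ infK sz_ea pE (lexlt^~ (e :: a))
    (two_rows a (unit n 0) 1 2) (0 :: unit n 0)) => //.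
- exact: unit_top_stable.
- exact: two_rows_typeE.
- by rewrite /= szu1.
- by rewrite lex_gt // two_rows_gt // eqxx.
move=> I /goodI[gI]; rewrite a0 => evI; exact: points3_two_rows.
Qed.

Lemma finite5 : 5 <= e -> ~ exactly_two_ideals point.
Proof.
move=> ge5; apply: (@three_rows (unit n 0) 1 (e - 1) (unit n 0) 2 (e - 2) (1 :: unit n 0)) => //.
- by lia.
- by lia.
- by apply: unit_top_stable; lia.
- by apply: unit_top_stable; lia.
- by rewrite /= szu1.
by rewrite !two_rows_gt // eqxx.
Qed.

Lemma finite4_space : e = 4 -> 1 < n -> ~ exactly_two_ideals point.
Proof.
move=> e4 n_gt1.
have lt1 : lexlt a (unit n 1) by apply: lt0; rewrite ?size_unit ?sumn_unit.
have n1 : unit n 1 != unit n 0 by apply/eqP => /(unit_inj n_gt1).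
apply: (@three_not_two K n.+1 p (lexlt^~ (e :: a)) (two_rows a (unit n 0) 1 3)
  (mem (star n.+1)) (0 :: unit n 0) (0 :: unit n 1) (0 :: unit n 1)) => //.
- exact: stP.
- by apply: stP; [apply: unit_top_stable | apply: two_rows_typeE].
- apply: stP; [exact: star_stable | rewrite e4 a0; exact: star_type].
- by rewrite /= szu1.
- by rewrite /= size_unit.
- by rewrite /= size_unit.
- by rewrite lex_gt // two_rows_gt // eqxx.
- by rewrite lex_gt // !inE eqxx !orbT.
- by rewrite two_rows_gt // (negPf n1) !inE eqxx !orbT.
Qed.

End Finite.

(** ** Positive dimension *)

Section Positive.
Variables (z w : nat) (lo : seq nat).
Hypotheses (ea : a = lo ++ w :: nseq z.+1 0) (w_gt0 : 0 < w).
Let q := size lo.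
Let ell := unit n q.+1.

Let sz_cat : size (lo ++ w :: nseq z.+1 0) = n.
Proof. by rewrite -ea. Qed.

Let szl : size ell = n. Proof. exact: size_unit. Qed.

Let ltl : lexlt a ell.
Proof. by rewrite ea; apply: lt_lex_unit. Qed.

Let ell_stable e1 e2 : 2 <= sumn lo + w \/ e1 <= e2 -> stable n.+1 (two_rows a ell e1 e2).
Proof. by move=> cond; rewrite ea; apply: linear_stable. Qed.

Lemma one_point_two : e = 1 -> sumn lo <= 1 -> 2 <= sumn lo + w ->
  ~ (lo = [::] /\ w = 3) -> ~ (head 0 lo = 1 /\ w = 2) ->
  exactly_two_ideals point.
Proof.
move=> e1 lo_le1 s_ge2 not3 not2.
apply: (@exactly_two_points _ _ _ _ infK sz_ea pE (lexlt^~ (e :: a))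
    (two_rows a ell 1 0) (0 :: ell)) => //.
- by apply: ell_stable; left.
- exact: two_rows_typeE.
- by rewrite /= szl.
- by rewrite lex_gt // two_rows_gt // eqxx.
move=> I /goodI[gI]; rewrite e1 ea => evI.
by case: (one_point sz_cat w_gt0 lo_le1 gI evI not3 not2) => [|[_]]; [left|right].
Qed.

Lemma linear_one_point : e = 1 -> sumn lo + w = 1 -> ~ exactly_two_ideals point.
Proof.
move=> e1 s1; apply: (unique_not_two infK sz_ea pE (C1 := lexlt^~ (e :: a))) => I /goodI[gI].
rewrite e1 ea => evI; have lo_le1 : sumn lo <= 1 by lia.
by case: (one_point sz_cat w_gt0 lo_le1 gI evI) => //; lia.
Qed.

Lemma linear_two_points : e = 2 -> sumn lo + w = 1 -> exactly_two_ideals point.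
Proof.
move=> e2 s1; have lo0 : lo = nseq q 0 by apply: sumn0_zeros; lia.
have w1 : w = 1 by lia.
apply: (@exactly_two_points _ _ _ _ infK sz_ea pE (lexlt^~ (e :: a))
    (two_rows a ell 1 1) (0 :: ell)) => //.
- by apply: ell_stable; right.
- exact: two_rows_typeE.
- by rewrite /= szl.
- by rewrite lex_gt // two_rows_gt // eqxx.
move=> I /goodI[gI]; rewrite e2 ea w1 lo0 => evI.
by apply: (two_points _ gI evI); rewrite -lo0 -w1.
Qed.

(** Rows of length 0, 1 and 2 over the last linear generator. *)
Lemma many_points : 2 <= e -> 2 <= sumn lo + w -> ~ exactly_two_ideals point.
Proof.
move=> ge2 s_ge2.
apply: (@three_rows ell 1 (e - 1) ell 2 (e - 2) (1 :: ell)) => //.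
- by lia.
- by lia.
- by apply: ell_stable; left.
- by apply: ell_stable; left.
- by rewrite /= szl.
by rewrite !two_rows_gt // eqxx.
Qed.

(** The third ideal loses a multiple of the generator [a] by a variable of the base. *)
Lemma linear_many_points : 3 <= e -> sumn lo + w = 1 -> ~ exactly_two_ideals point.
Proof.
move=> ge3 s1.
have [x [a0 ea0]] : exists x a0, a = x :: a0.
  by rewrite ea; case: (lo) => [|x l]; [exists w, (nseq z.+1 0) | exists x, (l ++ w :: nseq z.+1 0)].
have szu : size (x.+1 :: a0) = n by rewrite -sz_a ea0.
have ltu : lexlt a (x.+1 :: a0) by rewrite ea0 /= eqxx ltnSn orbT.
have ne : ell != x.+1 :: a0.
  apply/eqP => /(congr1 sumn) /=; rewrite sumn_unit; last first.
    by rewrite -sz_cat size_cat /= size_nseq; lia.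
  have := congr1 sumn ea; rewrite ea0 sumn_cat /= sumn_zeros; lia.
apply: (@three_rows ell 1 (e - 1) (x.+1 :: a0) 1 (e - 1) (0 :: ell)) => //.
- by lia.
- by lia.
- by apply: ell_stable; right; lia.
- by rewrite -sz_a ea0; apply: top_stable; lia.
- by rewrite /= szl.
by rewrite !two_rows_gt // eqxx (negPf ne).
Qed.

(** The last nonzero entry of [lo] gives a third generator whose removal is allowed. *)
Lemma one_point_mixed : e = 1 -> 2 <= sumn lo -> ~ exactly_two_ideals point.
Proof.
move=> e1 lo_ge2; have [|lo1 [x [k [elo x_gt0]]]] := @last_nonzero lo; first by lia.
have [h [hi [ehi whi]]] : exists h hi, nseq k 0 ++ w :: nseq z.+1 0 = h :: hi /\
    0 < nth 0 (h.+1 :: hi) k.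
  case: k {elo} => [|k]; first by exists w, (nseq z.+1 0).
  exists 0, (nseq k 0 ++ w :: nseq z.+1 0); split=> //=.
  by rewrite nth_cat size_nseq ltnn subnn.
have ea1 : a = rcons lo1 x ++ h :: hi by rewrite ea elo cat_rcons -catA /= -ehi.
pose u := nseq (size lo1).+1 0 ++ h.+1 :: hi.
have szu : size u = n by rewrite -sz_a ea1 !size_cat size_nseq size_rcons.
have ltu : lexlt a u.
  by rewrite ea1 /u -(size_rcons lo1 x); apply: lt_lex_gen.
have s_ge2 : 2 <= sumn lo + w by lia.
have eq_q : q = (size lo1).+1 + k by rewrite /q elo size_cat /= size_nseq addnS.
have ne : ell != u.
  apply/eqP => /(congr1 (fun l => nth 0 l q)); rewrite nth_unit.
  have lt_q : (q < (size lo1).+1) = false by rewrite eq_q; lia.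
  have sub_q : q - (size lo1).+1 = k by rewrite eq_q; lia.
  rewrite /u nth_cat size_nseq lt_q sub_q => nz.
  by move: whi; rewrite -nz; case: eqP => //; lia.
apply: (@three_rows ell 1 0 u 1 0 (0 :: ell)) => //.
- by apply: ell_stable; left.
- rewrite -sz_a ea1; apply: split_stable => //; left.
  by move: lo_ge2; rewrite elo sumn_cat /= sumn_zeros addn0.
- by rewrite /= szl.
by rewrite !two_rows_gt // eqxx (negPf ne).
Qed.

(** At height 1 above the last linear generator, [C] differs from both ideals with
    lexicographic base. *)
Lemma cone_three (C : seq nat -> bool) : e = 1 -> 2 <= sumn lo + w ->
  stable n.+1 C -> evtype n.+1 C (e :: a) -> C (1 :: ell) ->
  ~ exactly_two_ideals point.
Proof.
move=> e1 s_ge2 stC evC Cl.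
apply: (@three_not_two K n.+1 p (lexlt^~ (e :: a)) (two_rows a ell 1 0) C
  (0 :: ell) (1 :: ell) (1 :: ell)) => //.
- exact: stP.
- by apply: stP; [apply: ell_stable; left | apply: two_rows_typeE].
- exact: stP.
- by rewrite /= szl.
- by rewrite /= szl.
- by rewrite /= szl.
- by rewrite lex_gt // two_rows_gt // eqxx.
- by rewrite lex_gt // Cl.
by rewrite two_rows_gt // Cl ltnn andbF.
Qed.

(** The cone over three points that do not lie on a line, a degenerate twisted
    cubic. *)
Lemma one_point_cubic : e = 1 -> lo = [::] -> w = 3 -> ~ exactly_two_ideals point.
Proof.
move=> e1 lo0 w3; have s_ge2 : 2 <= sumn lo + w by rewrite w3; lia.
have en : n = z.+2 by rewrite -sz_cat lo0 /= size_nseq.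
pose D := two_rows (nseq z.+1 0) (unit z.+1 0) 1 2.
have lt0 : lexlt (nseq z.+1 0) (unit z.+1 0) by rewrite /= addn1 eqxx orbT.
have stD : stable z.+2 D.
  have := @top_stable (nseq z 0) 0 1 2 isT; by rewrite /= size_nseq.
apply: (@cone_three (fun m => D (behead m))) => //.
- by rewrite en; apply: cone_stable.
- rewrite e1 ea lo0 w3 en; apply: (@cone_two_rows_type _ _ _ 1 2) => //.
  + by rewrite size_nseq.
  + by rewrite size_unit.
  + by move=> l; rewrite sumn_zeros sumn_unit //; lia.
have Dl : D (0 :: unit z.+1 0) by rewrite /D two_rows_gt // eqxx.
by rewrite /ell /q lo0 en.
Qed.

(** The cone over a quadric with an embedded point that leaves its linear span. *)
Lemma one_point_skew : e = 1 -> sumn lo = 1 -> head 0 lo = 1 -> w = 2 ->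
  ~ exactly_two_ideals point.
Proof.
move=> e1 lo1 hd w2; have s_ge2 : 2 <= sumn lo + w by lia.
have [lo' elo] : exists lo', lo = 1 :: lo'.
  by case: (lo) hd => [|x lo'] //= ->; exists lo'.
pose a1 := lo' ++ w :: nseq z.+1 0; have ea1 : a = 1 :: a1 by rewrite ea elo.
have lo'0 : sumn lo' = 0 by move: lo1; rewrite elo /=; lia.
have sz1 : size a1 = n.-1 by rewrite -sz_a ea1.
have en : n = n.-1.+1 by rewrite -sz_a ea1.
have s1 : sumn a1 = 2 by rewrite sumn_cat lo'0 /= sumn_zeros w2.
pose ell1 := unit n.-1 (size lo').+1; have szl1 : size ell1 = n.-1 := size_unit _ _.
have lt_l1 : (size lo').+1 < n.-1 by rewrite -sz1 size_cat /= size_nseq; lia.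
have ltl1 : lexlt a1 ell1 by apply: lt_lex_unit.
pose D := two_rows a1 ell1 1 0.
have stD : stable n.-1.+1 D by apply: linear_stable => //; left; lia.
have eell : ell = 0 :: ell1 by rewrite /ell /q elo /= en.
apply: (@cone_three (fun m => D (behead m))) => //.
- by rewrite en; apply: cone_stable.
- rewrite e1 ea1 en; apply: (@cone_two_rows_type _ _ _ 1 0) => // l.
  by rewrite s1 sumn_unit //; lia.
have Dl : D (0 :: ell1) by rewrite /D two_rows_gt // eqxx.
by rewrite eell.
Qed.

End Positive.
End Cases.

Local Open Scope nat_scope.

Section Plane.
Variables (K : fieldType) (p : {poly rat}).
Hypothesis infK : infinite_field K.
Hypothesis pE : forall i : nat, (sumn [:: 4; 0] < i)%N ->
  (p.[i%:R] = (HL [:: 4; 0]%N i)%:R)%R.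

Lemma plane4_odd : 2 \notin [pchar K]%R -> exactly_two_ideals (@borel_fixed_point K 2 p).
Proof.
move=> ch; apply: (@exactly_two_points _ _ _ _ infK (erefl : size [:: 4; 0] = 2) pE
    (lexlt^~ [:: 4; 0]) (two_rows [:: 0] [:: 1] 1 3) [:: 0; 1]) => //.
- exact: (lex_stable [:: 4; 0]).
- exact: (@top_stable [::] 0 1 3).
- exact: (lex_type [:: 4; 0]).
- exact: (@two_rows_type 1 [:: 0] [:: 1] 1 3).
move=> I pI; have [gI evI _] := point_staircase infK (erefl : size [:: 4; 0] = 2) pE pI.
by apply: points4_plane => //; apply: point_odd pI ch.
Qed.

Lemma plane4_even : 2 \in [pchar K]%R -> ~ exactly_two_ideals (@borel_fixed_point K 2 p).
Proof.
move=> ch; apply: (@three_not_two K 2 p (lexlt^~ [:: 4; 0])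
    (two_rows [:: 0] [:: 1] 1 3) square [:: 0; 1] [:: 1; 1] [:: 1; 1]) => //.
- by apply: (stable_point K pE); [exact: (lex_stable [:: 4; 0]) | exact: (lex_type [:: 4; 0])].
- apply: (stable_point K pE); first exact: (@top_stable [::] 0 1 3).
  exact: (@two_rows_type 1 [:: 0] [:: 1] 1 3).
- by apply: (mono_point pE); [exact: square_ideal | exact: square_borel | exact: square_type].
Qed.

End Plane.

(** ** Translation to partitions *)

Definition two_point_partition (K : fieldType) (b : seq nat) (n : nat) : Prop :=
  let r := size b in
  [\/ part b 1 = 0 /\ r = 3,
      [/\ part b 1 = 0, r = 4, n = 2 & 2 \notin [pchar K]%R],
      [/\ 2 <= r, forall j : nat, 1 <= j <= r - 1 -> part b j = 1, part b r = 0
        & r - 1 <> 1 /\ r - 1 <> 3]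
    | [\/ [/\ 2 <= r, forall j : nat, 1 <= j <= r - 1 -> part b j = part b 1,
              2 <= part b 1, part b r = 0 & r - 1 <> 1],
          [/\ part b 2 < part b 1, part b 2 = 0 & r = 3],
          [/\ 3 <= r, forall j : nat, 1 <= j <= r - 2 -> part b j = part b 1,
              part b (r - 1) < part b 1 /\ part b (r - 1) = 1, part b r = 0
            & r - 2 <> 2]
        | [/\ 3 <= r, forall j : nat, 1 <= j <= r - 2 -> part b j = part b 1,
              part b (r - 1) < part b 1, 2 <= part b (r - 1) & part b r = 0]]].

Lemma part_in b j : 1 <= j <= size b -> part b j \in b.
Proof. by move=> /andP[j_gt0 le_j]; apply: mem_nth; rewrite prednK. Qed.

Lemma two_point_zero K b n : two_point_partition K b n -> 0 \in b.
Proof.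
have in_b j : 1 <= j <= size b -> part b j = 0 -> 0 \in b by move=> /part_in ? <-.
case=> [[p1 r3]|[p1 r4 _ _]|[r2 _ pr _]|[[r2 _ _ pr _]|[_ p2 r3]|[r3 _ _ pr _]|[r3 _ _ _ pr]]].
- by apply: (in_b 1) p1; rewrite r3.
- by apply: (in_b 1) p1; rewrite r4.
- by apply: (in_b (size b)) pr; lia.
- by apply: (in_b (size b)) pr; lia.
- by apply: (in_b 2) p2; rewrite r3.
- by apply: (in_b (size b)) pr; lia.
- by apply: (in_b (size b)) pr; lia.
Qed.

Lemma two_point_finite K e n : two_point_partition K (nseq e 0) n <->
  e = 3 \/ [/\ e = 4, n = 2 & 2 \notin [pchar K]%R].
Proof.
have p0 j : part (nseq e 0) j = 0 by rewrite /part nth_zeros.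
rewrite /two_point_partition size_nseq !p0; split; last first.
  by case=> [e3|[e4 n2 ch]]; [constructor 1 | constructor 2].
case=> [[_ ->]|[_ e4 n2 ch]|[r2 eq1 _ _]|[[]|[]|[_ _ []]|[]]] //; [by left|by right|].
by have := eq1 1; rewrite p0 => H; have := H _; lia.
Qed.

Section PositivePartition.
Variables (K : fieldType) (e z w n : nat) (lo : seq nat).
Hypotheses (w_gt0 : 0 < w) (e_gt0 : 0 < e).
Let b := nseq w (size lo).+1 ++ map S (parts lo) ++ nseq e 0.

Lemma parts_last : parts (e :: lo ++ w :: nseq z 0) = b.
Proof.
rewrite /= parts_cat /= parts_zeros /= map_cat -catA /b; congr (_ ++ _).
by rewrite map_nseq map_nseq addn0.
Qed.

Let s := w + sumn lo.

Let size_b : size b = s + e.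
Proof. by rewrite !size_cat !size_nseq size_map size_parts addnA. Qed.

Let part_top j : 1 <= j <= w -> part b j = (size lo).+1.
Proof.
move=> /andP[j_gt0 le_j]; rewrite /part nth_cat size_nseq nth_nseq.
by have -> : j.-1 < w by lia.
Qed.

Lemma parts_lt x : x \in parts lo -> x < size lo.
Proof.
move=> xs; rewrite ltnNge; apply/negP => le_x.
have := count_parts lo x; rewrite nth_default // => /count_memPn.
by rewrite xs.
Qed.

Let part_mid j : w < j <= s -> 0 < part b j < (size lo).+1.
Proof.
move=> /andP[lt_j le_j]; rewrite /part nth_cat size_nseq.
have -> : (j.-1 < w) = false by lia.
have lt_j' : j.-1 - w < size (parts lo) by rewrite size_parts; move: le_j; rewrite /s; lia.
rewrite nth_cat size_map lt_j' (nth_map 0) // ltnS /=.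
by apply: parts_lt; apply: mem_nth.
Qed.

Let part_bot j : s < j -> part b j = 0.
Proof.
move=> lt_j; rewrite /part /b catA nth_cat size_cat size_nseq size_map size_parts -/s.
have -> : (j.-1 < s) = false by lia.
exact: nth_zeros.
Qed.

Let part_one : sumn lo = 1 -> (part b w.+1 = 1 <-> head 0 lo = 1).
Proof.
move=> lo1; rewrite /part nth_cat size_nseq ltnn subnn /=.
have := size_parts lo; rewrite lo1; case e1 : (parts lo) => [|x []] //= _.
have := count_parts lo 0; rewrite e1 /= nth0 addn0 => <-.
by case: x {e1} => [|x]; split.
Qed.

(** Here [s] is the number of positive parts; if [sumn lo = 1] then exactly one of
    them differs from the largest part, and it is 1 if [head 0 lo = 1]. *)
Lemma two_point_positive : two_point_partition K b n <->
  (s = 1 /\ e = 2) \/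
  [/\ e = 1, 2 <= s, sumn lo <= 1, ~ (lo = [::] /\ w = 3)
    & ~ (head 0 lo = 1 /\ w = 2)].
Proof.
have lo_nil : size lo = 0 -> lo = [::] by apply: size0nil.
have head_pos : head 0 lo = 1 -> 0 < sumn lo by case: (lo) => //= x l ->; lia.
have p1 : part b 1 = (size lo).+1 by apply: part_top.
have le_s j : 0 < part b j -> j <= s by move=> pj; rewrite leqNgt; apply/negP => /part_bot; lia.
have gt_s j : 0 < j -> part b j = 0 -> s < j.
  move=> j_gt0 pj; rewrite ltnNge; apply/negP => le_j.
  case: (leqP j w) => [le_w|gt_w]; first by have := part_top (j := j); rewrite pj; lia.
  by have := part_mid (j := j); rewrite pj; lia.
have last1 r : r = size b -> 0 < part b (r - 1) -> part b r = 0 -> e = 1.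
  by move=> er /le_s le /gt_s lt; move: er; rewrite size_b; lia.
have all_top k : (forall j, 1 <= j <= k -> part b j = (size lo).+1) -> k <= s ->
    k <= w.
  move=> eqk le_k; rewrite leqNgt; apply/negP => lt_k.
  have := eqk w.+1; have := part_mid (j := w.+1); lia.
rewrite /two_point_partition p1 size_b; split.
  case=> [[//]|[//]|[r2 eqp pr [r1 r3]]|].
    have e1 : e = 1.
      apply: (last1 (s + e)) => //; rewrite eqp; lia.
    have d1 : size lo = 0 by have := eqp 1; rewrite p1; lia.
    have lo0 := lo_nil d1; have s2 : 2 <= s by lia.
    right; split=> //; first by rewrite lo0.
      by move=> [_ w3]; apply: r3; rewrite /s lo0 e1 /=; lia.
    by rewrite lo0 => -[].
  case=> [[r2 eqp d2 pr r1]|[_ p2 r3]|[r3 eqp [lt_d c1] pr r2]|[r3 eqp lt_d c2 pr]].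
  - have e1 : e = 1 by apply: (last1 (s + e)) => //; rewrite eqp; lia.
    have lew : s <= w by apply: all_top => // j lej; apply: eqp; lia.
    have lo0 : sumn lo = 0 by move: lew; rewrite /s; lia.
    have not3 : ~ (lo = [::] /\ w = 3) by move=> [lo_n _]; move: d2; rewrite lo_n.
    have not2 : ~ (head 0 lo = 1 /\ w = 2) by move=> [/head_pos hd _]; lia.
    by right; split=> //; lia.
  - by left; have := gt_s 2 isT p2; move: r3; rewrite /s; lia.
  - have e1 : e = 1 by apply: (last1 (s + e)) => //; rewrite c1.
    have lew : s - 1 <= w by apply: all_top => [j lej|]; [apply: eqp; lia | lia].
    have s_w : s = w.+1.
      case: (leqP s w) => [le_w|]; last by lia.
      by have := part_top (j := s + e - 1); lia.
    have lo1 : sumn lo = 1 by move: s_w; rewrite /s; lia.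
    have not3 : ~ (lo = [::] /\ w = 3) by move=> [lo_n _]; move: lo1; rewrite lo_n.
    have not2 : ~ (head 0 lo = 1 /\ w = 2) by move=> [_ w2]; apply: r2; lia.
    by right; split=> //; lia.
  - have e1 : e = 1 by apply: (last1 (s + e)) => //; lia.
    have lew : s - 1 <= w by apply: all_top => [j lej|]; [apply: eqp; lia | lia].
    have s_w : s = w.+1.
      case: (leqP s w) => [le_w|]; last by lia.
      by have := part_top (j := s + e - 1); lia.
    have lo1 : sumn lo = 1 by move: s_w; rewrite /s; lia.
    have not3 : ~ (lo = [::] /\ w = 3) by move=> [lo_n _]; move: lo1; rewrite lo_n.
    have not2 : ~ (head 0 lo = 1 /\ w = 2).
      move=> [hd _]; have := (part_one lo1).2 hd.
      by rewrite (_ : w.+1 = s + e - 1); lia.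
    by right; split=> //; lia.
case=> [[s1 e2]|[e1 s2 lo_le1 not3 not2]].
  have p2 : part b 2 = 0 by apply: part_bot; rewrite s1.
  by constructor 4; constructor 2; rewrite p2 s1 e2.
have pr : part b (s + e) = 0 by apply: part_bot; lia.
case: (posnP (sumn lo)) => [lo0|lo_gt0].
  have sw : s = w by rewrite /s lo0 addn0.
  case: (posnP (size lo)) => [d0|d_gt0].
    have ge2 : 2 <= s + e by lia.
    have not1 : s + e - 1 <> 1 by lia.
    have not_3 : s + e - 1 <> 3.
      by move=> w3; apply: not3; split; [apply: lo_nil | lia].
    constructor 3; split=> // j lej; rewrite part_top ?d0 //; lia.
  have ge2 : 2 <= s + e by lia.
  have not1 : s + e - 1 <> 1 by lia.
  constructor 4; constructor 1; split=> // j lej; rewrite part_top //; lia.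
have lo1 : sumn lo = 1 by lia.
have sw : s = w.+1 by rewrite /s lo1 addn1.
have mid := part_mid (j := w.+1).
have er : s + e - 1 = w.+1 by lia.
have top j : 1 <= j <= s + e - 2 -> part b j = (size lo).+1 by move=> lej; apply: part_top; lia.
have ge3 : 3 <= s + e by lia.
constructor 4; case: (eqVneq (part b w.+1) 1) => [c1|c1].
  have not_2 : s + e - 2 <> 2.
    by move=> w2; apply: not2; split; [apply/(part_one lo1) | lia].
  constructor 3; rewrite er; split=> //; lia.
constructor 4; rewrite er; split=> //; lia.
Qed.

End PositivePartition.

Local Open Scope ring_scope.

Theorem theorem1p1 (K : fieldType) (p : {poly rat}) (b : seq nat) (n : nat) :
  infinite_field K ->
  p != 0 ->
  admissible_hilbert_poly K p ->
  gotzmann_partition p b ->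
  ((size p).-1 + 2 <= n)%N ->
  let r := size b in
  exactly_two_ideals (@borel_fixed_point K n p) <->
  [\/ (* (i)(a) *)
      part b 1 = 0%N /\ r = 3%N,
      (* (i)(a') *)
      [/\ part b 1 = 0%N, r = 4%N, n = 2%N & 2%N \notin [pchar K]],
      (* (i)(b) *)
      [/\ (2 <= r)%N,
          forall j : nat, (1 <= j <= r - 1)%N -> part b j = 1%N,
          part b r = 0%N
        & (r - 1)%N <> 1%N /\ (r - 1)%N <> 3%N]
    | (* (i)(c), (ii)(a), (ii)(b), (ii)(c) *)
      [\/ [/\ (2 <= r)%N,
              forall j : nat, (1 <= j <= r - 1)%N -> part b j = part b 1,
              (2 <= part b 1)%N,
              part b r = 0%N
            & (r - 1)%N <> 1%N],
          [/\ (part b 2 < part b 1)%N, part b 2 = 0%N & r = 3%N],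
          [/\ (3 <= r)%N,
              forall j : nat, (1 <= j <= r - 2)%N -> part b j = part b 1,
              (part b (r - 1) < part b 1)%N /\ part b (r - 1) = 1%N,
              part b r = 0%N
            & (r - 2)%N <> 2%N]
        | [/\ (3 <= r)%N,
              forall j : nat, (1 <= j <= r - 2)%N -> part b j = part b 1,
              (part b (r - 1) < part b 1)%N,
              (2 <= part b (r - 1))%N
            & part b r = 0%N]]].
Proof.
move=> infK _ _ gb le_n r; rewrite -[X in _ <-> X]/(two_point_partition K b n) {r}.
have [sz_b sb _] := gb.
have le_b1 : (part b 1 + 2 <= n)%N.
  by apply: leq_trans le_n; rewrite leq_add2r; apply: gotzmann_head.
have lt_b : all (fun x => x < n)%N b.
  apply/allP => x xb; have : (x <= part b 1)%N.
    case: b sb xb {gb sz_b le_b1} => // y b sb; rewrite inE => /orP[/eqP->//|xb].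
    by have /allP := order_path_min geq_trans sb; apply.
  by move: le_b1; lia.
have eb := parts_counts sb lt_b; set a := mkseq _ n in eb.
have sz_a : size a = n by rewrite size_mkseq.
have pE (i : nat) : (sumn a < i)%N -> p.[i%:R] = (HL a i)%:R.
  move=> lt_i; rewrite (gotzmann_eval gb); last by rewrite -eb size_parts.
  by rewrite HL_parts eb.
move: le_b1; rewrite -eb {sz_b sb lt_b gb le_n eb}.
case: n a sz_a pE => [|n] [|e a] // [sz_a] pE le_b1.
have n_gt0 : (0 < n)%N by lia.
case: (posnP (sumn a)) => [/sumn0_zeros a0|/last_nonzero[lo [w [z [ea w_gt0]]]]].
  rewrite sz_a in a0; have -> : parts (e :: a) = nseq e 0%N by rewrite /= a0 parts_zeros.
  rewrite two_point_finite; case: (ltngtP e 3) => [lt3|gt3|e3].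
  - split=> [two|[e3|[e4]]]; [|by rewrite e3 in lt3|by rewrite e4 in lt3].
    by have := finite_small infK sz_a pE a0 n_gt0 lt3 two.
  - case: (ltngtP e 4) => [|gt4|e4]; first by lia.
      split=> [two|[e3|[e4]]]; try by [lia | subst e].
      by have := finite5 sz_a pE a0 n_gt0 gt4 two.
    case: (ltngtP n 1) => [|gt1|n1]; first by lia.
      split=> [two|[e3|[_ [n1]]]]; [|by lia|by lia].
      by have := finite4_space sz_a pE a0 n_gt0 e4 gt1 two.
    have ea : e :: a = [:: 4; 0]%N by rewrite e4 a0 n1.
    rewrite ea in pE; rewrite n1; case: (boolP (2%N \in [pchar K])) => ch.
      split=> [two|[e3|[_ _ //]]]; last by lia.
      by have := plane4_even pE ch two.
    by split=> [_|_]; [right | exact: plane4_odd infK pE ch].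
  - by split=> _; [left | exact: finite3 infK sz_a pE a0 n_gt0 e3].
case: (posnP e) => [e0|e_gt0].
  split=> [two|/two_point_zero]; first by have := no_zero_part infK sz_a pE e0 two.
  by rewrite -has_pred1 has_count count_parts /= e0.
case: z ea => [|z] ea.
  have := le_b1; rewrite ea parts_last // /part nth_cat size_nseq w_gt0 nth_nseq w_gt0.
  by move: sz_a; rewrite ea size_cat /=; lia.
rewrite {1}ea parts_last // two_point_positive //.
case: (ltngtP e 1) => [|gt1|e1]; first by lia.
  case: (leqP 2 (sumn lo + w)) => [s2|s1].
    split=> [two|[|[]]]; [|by lia|by lia].
    by have := many_points sz_a pE ea w_gt0 gt1 s2 two.
  have {}s1 : (sumn lo + w = 1)%N by lia.
  case: (ltngtP e 2) => [|gt2|e2]; first by lia.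
    split=> [two|[|[]]]; [|by lia|by lia].
    by have := linear_many_points sz_a pE ea w_gt0 gt2 s1 two.
  split=> [_|_]; first by left; lia.
  exact: (linear_two_points infK sz_a pE ea w_gt0 e2 s1).
case: (leqP 2 (sumn lo + w)) => [s2|s1]; last first.
  have {}s1 : (sumn lo + w = 1)%N by lia.
  split=> [two|[|[]]]; [|by lia|by lia].
  by have := linear_one_point infK sz_a pE ea w_gt0 e1 s1 two.
case: (leqP 2 (sumn lo)) => [lo2|lo1].
  split=> [two|[|[]]]; [|by lia|by lia].
  by have := one_point_mixed sz_a pE ea w_gt0 e1 lo2 two.
case: (EM (lo = [::] /\ w = 3%N)) => [[lo0 w3]|not3].
  split=> [two|[|[_ _ _ []]]]; [|by lia|by []].
  by have := one_point_cubic sz_a pE ea w_gt0 e1 lo0 w3 two.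
case: (EM (head 0%N lo = 1%N /\ w = 2)) => [[hd w2]|not2].
  split=> [two|[|[_ _ _ _ []]]]; [|by lia|by []].
  have lo_eq1 : sumn lo = 1%N by case: (lo) hd lo1 => //= x l -> /=; lia.
  by have := one_point_skew sz_a pE ea w_gt0 e1 lo_eq1 hd w2 two.
split=> _; last exact: (one_point_two infK sz_a pE ea w_gt0 e1 lo1 s2 not3 not2).
by right; split=> //; lia.
Qed.
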